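(* Consider the spacetime $\mathcal{M}=(0,\infty)\times S_1$ with metric $g=-dt\otimes dt+t^2d\phi\otimes d\phi$, where $S_1$ is the circle with angle $\phi\in[0,2\pi)$. Let $\lambda>0$, and let $S$ be the operator acting on the spatial Fourier coefficients by $(\widetilde{S}\widetilde{\varphi})(t,n)=\cosh(3\lambda n)^{-1/2}\,\widetilde{\varphi}(t,n)$, $n\in\mathbb{Z}$. Then $S$ maps $C_0^\infty(\mathcal{M})$ into $C_0^\infty(\mathcal{M})$, and is an isomorphism onto a proper subspace $C^\infty_{\mathrm{img}}(\mathcal{M})\subset C_0^\infty(\mathcal{M})$. It induces a symplectic isomorphism from the deformed symplectic vector space $(V_\star,\omega_\star)$ onto $(V_{\mathrm{img}},\omega)$ and a symplectic embedding of $(V_\star,\omega_\star)$ into the undeformed symplectic vector space $(V,\omega)$. These linear symplectic maps induce unique injective $\ast$-morphisms (sending the Weyl generator of $[\varphi]$ to the Weyl generator of $[S\varphi]$) between the corresponding Weyl algebras.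
   Context: Let $\xi\in\mathbb{R}$, $P=\square_g-\xi\mathfrak{R}$ ($\mathfrak{R}$ the scalar curvature of $g$), let $\Delta_\pm:C_0^\infty(\mathcal{M})\to C^\infty(\mathcal{M})$ be its unique retarded/advanced Green's operators ($P\Delta_\pm=\mathrm{id}$, $\Delta_\pm P=\mathrm{id}$ on $C_0^\infty(\mathcal{M})$, $\mathrm{supp}\,\Delta_\pm(\varphi)\subseteq J^\pm(\mathrm{supp}\,\varphi)$), $\Delta=\Delta_+-\Delta_-$, and $\mathrm{vol}$ the metric volume form. The spatial Fourier transform is the Fourier series in $\phi$ with discrete momenta $n\in\mathbb{Z}$. Put, for real functions, $$\omega(\varphi,\psi)=\int_{\mathcal{M}}\varphi\,\Delta(\psi)\,\mathrm{vol},\qquad\omega_\star(\varphi,\psi)=\int_{\mathcal{M}}\varphi\,\Delta(S^2\psi)\,\mathrm{vol},$$ and, with forms passed to the quotients, $(V,\omega)=\big(C_0^\infty(\mathcal{M},\mathbb{R})/P[C_0^\infty(\mathcal{M},\mathbb{R})],\omega\big)$, $(V_\star,\omega_\star)=\big(C_0^\infty(\mathcal{M},\mathbb{R})/P[C_0^\infty(\mathcal{M},\mathbb{R})],\omega_\star\big)$, $(V_{\mathrm{img}},\omega)=\big(S[C_0^\infty(\mathcal{M},\mathbb{R})]/S[P[C_0^\infty(\mathcal{M},\mathbb{R})]],\omega\big)$. All vector spaces are over $\mathbb{R}$; symplectic forms are antisymmetric, bilinear and weakly nondegenerate. The Weyl algebra of a symplectic vector space $(V,\rho)$ is the (unique up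 to $\ast$-isomorphism) unital $C^\ast$-algebra generated by elements $W(\varphi)$, $\varphi\in V$, with $W(0)=1$, $W(\varphi)^\ast=W(-\varphi)$, $W(\varphi)W(\psi)=e^{-i\rho(\varphi,\psi)/2}W(\varphi+\psi)$. *)

(* Defs.v *)
From Stdlib Require Import Reals Lra Lia ZArith Relations.
From Stdlib Require Import ClassicalEpsilon FunctionalExtensionality
  PropExtensionality ProofIrrelevance.
From Coquelicot Require Import Coquelicot.
Open Scope R_scope.

(** A complex function on the spacetime is represented by its expression
    [f t phi] in the global coordinates, 2 pi-periodic in [phi].  Only [0 < t]
    belongs to the spacetime; compactly supported functions are extended by
    [0] to [t <= 0], so that they are determined by their values on the
    spacetime, and other functions are compared with [eqM]. *)

Definition field := R -> R -> C.

Definition eqM (f g : field) : Prop := forall t phi, 0 < t -> f t phi = g t phi.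

Definition fplus (f g : field) : field := fun t phi => Cplus (f t phi) (g t phi).
Definition fopp (f : field) : field := fun t phi => Copp (f t phi).
Definition fminus (f g : field) : field := fun t phi => Cminus (f t phi) (g t phi).
Definition fscal (c : C) (f : field) : field := fun t phi => Cmult c (f t phi).

Definition re_part (f : field) : R -> R -> R := fun t phi => Re (f t phi).
Definition im_part (f : field) : R -> R -> R := fun t phi => Im (f t phi).

Definition smooth (u : R -> R -> R) : Prop :=
  forall n t phi, 0 < t -> ex_diff_n u n t phi.

(* C^oo(M) *)
Definition Csmooth (f : field) : Prop :=
  (forall t phi, 0 < t -> f t (phi + 2 * PI) = f t phi) /\
  smooth (re_part f) /\ smooth (im_part f).

(* C_0^oo(M): every compact subset of (0,oo) x S_1 lies in some compact
   [a,b] x S_1. *)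
Definition Ccomp (f : field) : Prop :=
  Csmooth f /\
  exists a b, 0 < a /\ forall t phi, t < a \/ b < t -> f t phi = RtoC 0.

(* C_0^oo(M,R) *)
Definition Ccomp_real (f : field) : Prop :=
  Ccomp f /\ forall t phi, Im (f t phi) = 0.

Inductive coord := Time | Angle.

Definition sum_coord (F : coord -> R) : R := F Time + F Angle.

Definition pd (i : coord) (u : R -> R -> R) : R -> R -> R :=
  match i with
  | Time => fun t phi => Derive (fun s => u s phi) t
  | Angle => fun t phi => Derive (fun s => u t s) phi
  end.

Definition metric (i j : coord) (t phi : R) : R :=
  match i, j with
  | Time, Time => - 1
  | Angle, Angle => t ^ 2
  | _, _ => 0
  end.

Definition det_metric (t phi : R) : R :=
  metric Time Time t phi * metric Angle Angle t phi
  - metric Time Angle t phi * metric Angle Time t phi.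

Definition inv_metric (i j : coord) (t phi : R) : R :=
  match i, j with
  | Time, Time => metric Angle Angle t phi
  | Angle, Angle => metric Time Time t phi
  | _, _ => - metric i j t phi
  end / det_metric t phi.

Definition sqrt_det (t phi : R) : R := sqrt (Rabs (det_metric t phi)).

(* Gamma^k_{ij} *)
Definition christoffel (k i j : coord) (t phi : R) : R :=
  / 2 * sum_coord (fun l => inv_metric k l t phi *
    (pd i (metric j l) t phi + pd j (metric i l) t phi - pd l (metric i j) t phi)).

Definition ricci (i j : coord) (t phi : R) : R :=
  sum_coord (fun k =>
    pd k (christoffel k i j) t phi - pd j (christoffel k i k) t phi
    + sum_coord (fun l =>
        christoffel k k l t phi * christoffel l i j t phi
        - christoffel k j l t phi * christoffel l i k t phi)).

Definition scalar_curvature (t phi : R) : R :=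
  sum_coord (fun i => sum_coord (fun j => inv_metric i j t phi * ricci i j t phi)).

(* |g|^{-1/2} d_i (|g|^{1/2} g^{ij} d_j u) *)
Definition box (u : R -> R -> R) (t phi : R) : R :=
  / sqrt_det t phi *
  sum_coord (fun i => sum_coord (fun j =>
    pd i (fun s theta => sqrt_det s theta * inv_metric i j s theta * pd j u s theta)
      t phi)).

Definition P_real (xi : R) (u : R -> R -> R) (t phi : R) : R :=
  box u t phi - xi * scalar_curvature t phi * u t phi.

(* P has real coefficients and acts on real and imaginary parts separately. *)
Definition P_op (xi : R) (f : field) : field :=
  fun t phi => (P_real xi (re_part f) t phi, P_real xi (im_part f) t phi).

(* integral against the metric volume form |g|^{1/2} dt /\ dphi *)
Definition integral_M (f : field) : C :=
  RInt_gen (V := C_R_CompleteNormedModule)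
    (fun t => RInt (V := C_R_CompleteNormedModule)
       (fun phi => Cmult (RtoC (sqrt_det t phi)) (f t phi)) 0 (2 * PI))
    (at_right 0) (Rbar_locally p_infty).

(** Causal relations are expressed on the universal cover (0,oo) x R.  A set
    that is 2 pi-periodic in the angle is the preimage of a subset of the
    spacetime, and causal curves lift, so for such a set the causal
    future/past below is the preimage of that of its image. *)

Definition supp (f : field) (p : R * R) : Prop :=
  0 < fst p /\
  forall D : R * R -> Prop, locally p D ->
    exists q, D q /\ 0 < fst q /\ f (fst q) (snd q) <> RtoC 0.

(* [p] and [q] are joined by a C^1 future-directed causal curve; the time
   orientation is d/dt. *)
Definition causal_segment (p q : R * R) : Prop :=
  exists gamma : coord -> R -> R,
    p = (gamma Time 0, gamma Angle 0) /\ q = (gamma Time 1, gamma Angle 1) /\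
    forall s, 0 <= s <= 1 ->
      0 < gamma Time s /\
      (forall i, ex_derive (gamma i) s /\ continuous (Derive (gamma i)) s) /\
      sum_coord (fun i => sum_coord (fun j =>
        metric i j (gamma Time s) (gamma Angle s)
        * Derive (gamma i) s * Derive (gamma j) s)) <= 0 /\
      sum_coord (fun i =>
        metric i Time (gamma Time s) (gamma Angle s) * Derive (gamma i) s) < 0.

(* piecewise C^1 causal curves; every point is in its own future *)
Definition causal : R * R -> R * R -> Prop := clos_refl_trans _ causal_segment.

Definition J_plus (A : R * R -> Prop) (q : R * R) : Prop :=
  exists p, A p /\ causal p q.
Definition J_minus (A : R * R -> Prop) (q : R * R) : Prop :=
  exists p, A p /\ causal q p.

Definition is_green (xi : R) (J : (R * R -> Prop) -> R * R -> Prop)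
    (D : field -> field) : Prop :=
  (forall f, Ccomp f -> Csmooth (D f)) /\
  (forall f g, Ccomp f -> Ccomp g -> eqM (D (fplus f g)) (fplus (D f) (D g))) /\
  (forall c f, Ccomp f -> eqM (D (fscal c f)) (fscal c (D f))) /\
  (forall f, Ccomp f -> eqM (P_op xi (D f)) f) /\
  (forall f, Ccomp f -> eqM (D (P_op xi f)) f) /\
  (forall f, Ccomp f -> forall p, supp (D f) p -> J (supp f) p).

Definition omega (Delta : field -> field) (f g : field) : C :=
  integral_M (fun t phi => Cmult (f t phi) (Delta g t phi)).

Definition expi (x : R) : C := (cos x, sin x).

Definition fourier (f : field) (t : R) (n : Z) : C :=
  Cmult (RtoC (/ (2 * PI)))
    (RInt (V := C_R_CompleteNormedModule)
       (fun phi => Cmult (f t phi) (expi (- (IZR n * phi)))) 0 (2 * PI)).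

Definition CSeries (a : nat -> C) : C :=
  (Series (fun k => Re (a k)), Series (fun k => Im (a k))).

(* limit of the symmetric partial sums over |n| <= N *)
Definition ZSeries (a : Z -> C) : C :=
  Cplus (a 0%Z)
    (CSeries (fun k => Cplus (a (Z.of_nat (S k))) (a (- Z.of_nat (S k))%Z))).

Definition S_coef (lambda : R) (n : Z) : R := / sqrt (cosh (3 * lambda * IZR n)).

Definition S_op (lambda : R) (f : field) : field :=
  fun t phi =>
    ZSeries (fun n =>
      Cmult (Cmult (RtoC (S_coef lambda n)) (fourier f t n)) (expi (IZR n * phi))).

Lemma field_ext (f g : field) : (forall t phi, f t phi = g t phi) -> f = g.
Proof.
intros H; apply functional_extensionality; intro t.
apply functional_extensionality; intro phi; apply H.
Qed.

Definition fzero : field := fun _ _ => RtoC 0.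

Definition field_AbelianMonoid_mixin : AbelianMonoid.mixin_of field.
Proof.
apply (AbelianMonoid.Mixin field fplus fzero);
  intros; apply field_ext; intros; unfold fplus, fzero; ring.
Defined.
Canonical field_AbelianMonoid :=
  AbelianMonoid.Pack field field_AbelianMonoid_mixin field.

Definition field_AbelianGroup_mixin : AbelianGroup.mixin_of field_AbelianMonoid.
Proof.
apply (AbelianGroup.Mixin field_AbelianMonoid fopp).
intros x; apply field_ext; intros t phi.
change (Cplus (x t phi) (Copp (x t phi)) = RtoC 0); ring.
Defined.
Canonical field_AbelianGroup :=
  AbelianGroup.Pack field
    (AbelianGroup.Class _ field_AbelianMonoid_mixin field_AbelianGroup_mixin) field.

Definition field_ModuleSpace_mixin : ModuleSpace.mixin_of R_Ring field_AbelianGroup.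
Proof.
apply (ModuleSpace.Mixin R_Ring field_AbelianGroup (fun k f => fscal (RtoC k) f));
  intros; apply field_ext; intros t phi.
- change (Cmult (RtoC x) (Cmult (RtoC y) (u t phi))
    = Cmult (RtoC (x * y)) (u t phi)); rewrite RtoC_mult; ring.
- change (Cmult (RtoC 1) (u t phi) = u t phi); ring.
- change (Cmult (RtoC x) (Cplus (u t phi) (v t phi))
    = Cplus (Cmult (RtoC x) (u t phi)) (Cmult (RtoC x) (v t phi))); ring.
- change (Cmult (RtoC (x + y)) (u t phi)
    = Cplus (Cmult (RtoC x) (u t phi)) (Cmult (RtoC y) (u t phi))).
  rewrite RtoC_plus; ring.
Defined.
Canonical field_ModuleSpace : ModuleSpace R_Ring :=
  ModuleSpace.Pack R_Ring field
    (ModuleSpace.Class R_Ring _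
       (AbelianGroup.class field_AbelianGroup) field_ModuleSpace_mixin) field.

Record subspace (E : ModuleSpace R_Ring) := Subspace {
  in_sub :> E -> Prop;
  sub_zero : in_sub zero;
  sub_plus : forall x y, in_sub x -> in_sub y -> in_sub (plus x y);
  sub_scal : forall (k : R) x, in_sub x -> in_sub (scal k x) }.
Arguments in_sub {E} _ _.
Arguments Subspace {E} _ _ _ _.

Definition linear_on {E F : ModuleSpace R_Ring} (A : E -> Prop) (T : E -> F) : Prop :=
  (forall x y, A x -> A y -> T (plus x y) = plus (T x) (T y)) /\
  (forall (k : R) x, A x -> T (scal k x) = scal k (T x)).

Definition linear_map {E F : ModuleSpace R_Ring} (T : E -> F) : Prop :=
  linear_on (fun _ => True) T.

Definition image_pred {E F : Type} (T : E -> F) (A : E -> Prop) (y : F) : Prop :=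
  exists x, A x /\ y = T x.

Definition image_sub {E F : ModuleSpace R_Ring} (T : E -> F) (A : subspace E)
    (HT : linear_on A T) : subspace F.
Proof.
apply (Subspace (image_pred T A)).
- exists zero; split; [apply sub_zero|].
  destruct HT as [_ H].
  transitivity (T (scal (0 : R) (zero : E))).
  + rewrite H by apply sub_zero. symmetry; apply (scal_zero_l (K := R_Ring)).
  + f_equal. apply (scal_zero_l (K := R_Ring)).
- intros x y [x' [Hx ->]] [y' [Hy ->]]; exists (plus x' y'); split.
  + now apply sub_plus.
  + symmetry; now apply HT.
- intros k x [x' [Hx ->]]; exists (scal k x'); split.
  + now apply sub_scal.
  + symmetry; now apply HT.
Defined.

Lemma minus_plus_plus {G : AbelianGroup} (a b c d : G) :
  minus (plus a b) (plus c d) = plus (minus a c) (minus b d).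
Proof.
unfold minus; rewrite (opp_plus c d), <- !plus_assoc; f_equal.
rewrite !plus_assoc; f_equal; apply plus_comm.
Qed.

Lemma opp_minus_opp {G : AbelianGroup} (a b : G) :
  opp (minus a b) = minus (opp a) (opp b).
Proof. unfold minus; apply opp_plus. Qed.

(* The quotient U/N: its elements are the cosets f + N with f in U. *)
Section Quotient.

Variables (E : ModuleSpace R_Ring) (U N : subspace E).

Definition is_coset (X : E -> Prop) : Prop :=
  exists f, U f /\ forall g, X g <-> N (minus g f).

Record quot := Quot { coset :> E -> Prop; cosetP : is_coset coset }.

Lemma sub_opp (A : subspace E) x : A x -> A (opp x).
Proof.
intros H; rewrite <- (scal_opp_one (K := R_Ring)).
apply (sub_scal E A (-1)), H.
Qed.

Lemma sub_minus (A : subspace E) x y : A x -> A y -> A (minus x y).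
Proof. intros Hx Hy; apply sub_plus; [assumption|now apply sub_opp]. Qed.

Definition cls (f : E) (Hf : U f) : quot :=
  Quot (fun g => N (minus g f)) (ex_intro _ f (conj Hf (fun g => iff_refl _))).

Lemma cls_self f Hf : cls f Hf f.
Proof. simpl; rewrite minus_eq_zero; apply sub_zero. Qed.

Lemma quot_ext (X Y : quot) f : X f -> Y f -> X = Y.
Proof.
destruct X as [X [x [Hx HX]]], Y as [Y [y [Hy HY]]]; simpl; intros HXf HYf.
assert (X = Y) as ->.
{ apply functional_extensionality; intro g; apply propositional_extensionality.
  rewrite HX, HY; apply HX in HXf; apply HY in HYf.
  assert (N (minus y x)).
  { rewrite (minus_trans f). apply sub_plus; [|assumption].
    rewrite <- opp_minus; now apply sub_opp. }
  split; intros H'.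
  - rewrite (minus_trans x). apply sub_plus; [assumption|].
    rewrite <- opp_minus; now apply sub_opp.
  - rewrite (minus_trans y). now apply sub_plus. }
f_equal; apply proof_irrelevance.
Qed.

Lemma quot_repr (X : quot) : exists f, U f /\ X f.
Proof.
destruct X as [X [x [Hx HX]]]; exists x; split; [assumption|].
apply HX; rewrite minus_eq_zero; apply sub_zero.
Qed.

Definition repr (X : quot) : E :=
  proj1_sig (constructive_indefinite_description _ (quot_repr X)).

Lemma repr_U (X : quot) : U (repr X).
Proof. unfold repr; now destruct constructive_indefinite_description as [? []]. Qed.

Lemma repr_in (X : quot) : X (repr X).
Proof. unfold repr; now destruct constructive_indefinite_description as [? []]. Qed.

Lemma quot_rel (X : quot) f g : X f -> (X g <-> N (minus g f)).
Proof.
destruct X as [X [x [Hx HX]]]; simpl; intros Hf; rewrite HX; apply HX in Hf.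
split; intros H.
- rewrite (minus_trans x); apply sub_plus; [assumption|].
  rewrite <- opp_minus; now apply sub_opp.
- rewrite (minus_trans f); now apply sub_plus.
Qed.

Definition quot_zero : quot := cls zero (sub_zero E U).
Definition quot_plus (X Y : quot) : quot :=
  cls (plus (repr X) (repr Y)) (sub_plus E U _ _ (repr_U X) (repr_U Y)).
Definition quot_opp (X : quot) : quot :=
  cls (opp (repr X)) (sub_opp U _ (repr_U X)).
Definition quot_scal (k : R) (X : quot) : quot :=
  cls (scal k (repr X)) (sub_scal E U k _ (repr_U X)).

Lemma quot_zero_in : quot_zero zero.
Proof. apply cls_self. Qed.

Lemma quot_plus_in (X Y : quot) f g : X f -> Y g -> quot_plus X Y (plus f g).
Proof.
intros Hf Hg; simpl; rewrite (minus_plus_plus (G := E)); apply sub_plus.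
- now apply (quot_rel X _ _ (repr_in X)).
- now apply (quot_rel Y _ _ (repr_in Y)).
Qed.

Lemma quot_scal_in k (X : quot) f : X f -> quot_scal k X (scal k f).
Proof.
intros Hf; simpl.
replace (minus (scal k f) (scal k (repr X))) with (scal k (minus f (repr X))).
- apply sub_scal; now apply (quot_rel X _ _ (repr_in X)).
- apply (scal_minus_distr_l (K := R_Ring)).
Qed.

Lemma quot_opp_in (X : quot) f : X f -> quot_opp X (opp f).
Proof.
intros Hf; simpl.
rewrite <- (opp_minus_opp (G := E)).
apply sub_opp; now apply (quot_rel X _ _ (repr_in X)).
Qed.

Definition quot_AbelianMonoid_mixin : AbelianMonoid.mixin_of quot.
Proof.
apply (AbelianMonoid.Mixin quot quot_plus quot_zero).
- intros X Y; apply (quot_ext _ _ (plus (repr X) (repr Y))).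
  + apply quot_plus_in; apply repr_in.
  + rewrite plus_comm; apply quot_plus_in; apply repr_in.
- intros X Y Z; apply (quot_ext _ _ (plus (repr X) (plus (repr Y) (repr Z)))).
  + apply quot_plus_in; [apply repr_in|]; apply quot_plus_in; apply repr_in.
  + rewrite plus_assoc; apply quot_plus_in; [|apply repr_in].
    apply quot_plus_in; apply repr_in.
- intros X; apply (quot_ext _ _ (repr X)); [|apply repr_in].
  generalize (quot_plus_in X quot_zero _ _ (repr_in X) quot_zero_in).
  now rewrite (plus_zero_r (G := E)).
Defined.
Canonical quot_AbelianMonoid :=
  AbelianMonoid.Pack quot quot_AbelianMonoid_mixin quot.

Definition quot_AbelianGroup_mixin : AbelianGroup.mixin_of quot_AbelianMonoid.
Proof.
apply (AbelianGroup.Mixin quot_AbelianMonoid quot_opp).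
intros X; apply (quot_ext _ _ zero); [|apply quot_zero_in].
generalize (quot_plus_in X _ _ _ (repr_in X) (quot_opp_in X _ (repr_in X))).
now rewrite (plus_opp_r (G := E)).
Defined.
Canonical quot_AbelianGroup :=
  AbelianGroup.Pack quot
    (AbelianGroup.Class _ quot_AbelianMonoid_mixin quot_AbelianGroup_mixin) quot.

Definition quot_ModuleSpace_mixin : ModuleSpace.mixin_of R_Ring quot_AbelianGroup.
Proof.
apply (ModuleSpace.Mixin R_Ring quot_AbelianGroup quot_scal).
- intros x y X; apply (quot_ext _ _ (scal x (scal y (repr X)))).
  + apply quot_scal_in, quot_scal_in, repr_in.
  + rewrite scal_assoc; apply quot_scal_in, repr_in.
- intros X; apply (quot_ext _ _ (repr X)); [|apply repr_in].
  generalize (quot_scal_in 1 X _ (repr_in X)).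
  now rewrite (scal_one (K := R_Ring)).
- intros x X Y; apply (quot_ext _ _ (scal x (plus (repr X) (repr Y)))).
  + apply quot_scal_in, quot_plus_in; apply repr_in.
  + rewrite scal_distr_l; apply quot_plus_in; apply quot_scal_in, repr_in.
- intros x y X; apply (quot_ext _ _ (scal (plus x y) (repr X))).
  + apply quot_scal_in, repr_in.
  + rewrite scal_distr_r; apply quot_plus_in; apply quot_scal_in, repr_in.
Defined.
Canonical quot_ModuleSpace : ModuleSpace R_Ring :=
  ModuleSpace.Pack R_Ring quot
    (ModuleSpace.Class R_Ring _
       (AbelianGroup.class quot_AbelianGroup) quot_ModuleSpace_mixin) quot.

End Quotient.

Arguments coset {E U N} _ _.
Arguments repr {E U N} _.

(** The following facts make [P[C_0^oo(M,R)]], [S[C_0^oo(M,R)]] and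
    [S[P[C_0^oo(M,R)]]] subspaces. *)

Definition smooth_n (n : nat) (u : R -> R -> R) : Prop :=
  forall t phi, 0 < t -> ex_diff_n u n t phi.

Lemma pos_locally_2d t phi : 0 < t -> locally_2d (fun s _ => 0 < s) t phi.
Proof.
intros Ht; exists (mkposreal t Ht); simpl; intros s _ H _.
apply Rabs_lt_between in H; lra.
Qed.

Lemma pos_locally t : 0 < t -> locally t (fun s => 0 < s).
Proof. apply (open_gt 0). Qed.

Lemma smooth_n_ext n u v :
  (forall t phi, 0 < t -> u t phi = v t phi) -> smooth_n n u -> smooth_n n v.
Proof.
intros H Hu t phi Ht; apply (ex_diff_n_ext_loc u); [|now apply Hu].
destruct (pos_locally_2d t phi Ht) as [d Hd]; exists d; intros s r Hs Hr.
apply H, (Hd s r Hs Hr).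
Qed.

Lemma smooth_n_pd n u i : smooth_n (S n) u -> smooth_n n (pd i u).
Proof. intros H t phi Ht; destruct (H t phi Ht) as [_ [_ [_ [? ?]]]]; now destruct i. Qed.

Lemma smooth_n_S n u : smooth_n (S n) u -> smooth_n n u.
Proof. intros H t phi Ht; apply (ex_diff_n_m (S n)); [lia|now apply H]. Qed.

Lemma smooth_n_ex_T n u t phi :
  smooth_n (S n) u -> 0 < t -> ex_derive (fun s => u s phi) t.
Proof. intros H Ht; now destruct (H t phi Ht) as [_ [? _]]. Qed.

Lemma smooth_n_ex_A n u t phi :
  smooth_n (S n) u -> 0 < t -> ex_derive (fun s => u t s) phi.
Proof. intros H Ht; now destruct (H t phi Ht) as [_ [_ [? _]]]. Qed.

Lemma smooth_n_step n u :
  (forall t phi, 0 < t -> continuity_2d_pt u t phi) ->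
  (forall t phi, 0 < t -> ex_derive (fun s => u s phi) t) ->
  (forall t phi, 0 < t -> ex_derive (fun s => u t s) phi) ->
  smooth_n n (pd Time u) -> smooth_n n (pd Angle u) -> smooth_n (S n) u.
Proof. intros H0 H1 H2 H3 H4 t phi Ht; repeat split; auto. Qed.

Lemma smooth_n_cont n u t phi : smooth_n n u -> 0 < t -> continuity_2d_pt u t phi.
Proof. intros H Ht; generalize (H t phi Ht); now destruct n as [|n]; intros []. Qed.

Lemma pd_const i (c : R) t phi : pd i (fun _ _ => c) t phi = 0.
Proof. destruct i; unfold pd; apply Derive_const. Qed.

Lemma smooth_n_const n c : smooth_n n (fun _ _ => c).
Proof.
revert c; induction n as [|n IH]; intros c.
- intros t phi _; split; [apply continuity_2d_pt_const|exact I].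
- apply smooth_n_step; intros; try apply continuity_2d_pt_const;
    try apply ex_derive_const;
    apply (smooth_n_ext n (fun _ _ => 0)); auto; intros; symmetry; apply pd_const.
Qed.

Lemma smooth_n_plus n u v :
  smooth_n n u -> smooth_n n v -> smooth_n n (fun t phi => u t phi + v t phi).
Proof.
revert u v; induction n as [|n IH]; intros u v Hu Hv.
- intros t phi Ht; split; [|exact I].
  apply continuity_2d_pt_plus; [now apply Hu|now apply Hv].
- assert (Hu' := fun t phi => smooth_n_ex_T n u t phi Hu).
  assert (Hv' := fun t phi => smooth_n_ex_T n v t phi Hv).
  assert (Hu'' := fun t phi => smooth_n_ex_A n u t phi Hu).
  assert (Hv'' := fun t phi => smooth_n_ex_A n v t phi Hv).
  apply smooth_n_step.
  + intros t phi Ht; apply continuity_2d_pt_plus; [now apply Hu|now apply Hv].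
  + intros t phi Ht; apply (ex_derive_plus (fun s => u s phi) (fun s => v s phi)); auto.
  + intros t phi Ht; apply (ex_derive_plus (u t) (v t)); auto.
  + apply (smooth_n_ext n (fun t phi => pd Time u t phi + pd Time v t phi)).
    * intros; symmetry; apply Derive_plus; auto.
    * now apply IH; apply smooth_n_pd.
  + apply (smooth_n_ext n (fun t phi => pd Angle u t phi + pd Angle v t phi)).
    * intros; symmetry; apply Derive_plus; auto.
    * now apply IH; apply smooth_n_pd.
Qed.

Lemma smooth_n_mult n u v :
  smooth_n n u -> smooth_n n v -> smooth_n n (fun t phi => u t phi * v t phi).
Proof.
revert u v; induction n as [|n IH]; intros u v Hu Hv.
- intros t phi Ht; split; [|exact I].
  apply continuity_2d_pt_mult; [now apply Hu|now apply Hv].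
- assert (Hu' := fun t phi => smooth_n_ex_T n u t phi Hu).
  assert (Hv' := fun t phi => smooth_n_ex_T n v t phi Hv).
  assert (Hu'' := fun t phi => smooth_n_ex_A n u t phi Hu).
  assert (Hv'' := fun t phi => smooth_n_ex_A n v t phi Hv).
  apply smooth_n_step.
  + intros t phi Ht; apply continuity_2d_pt_mult; [now apply Hu|now apply Hv].
  + intros t phi Ht; apply (ex_derive_mult (fun s => u s phi) (fun s => v s phi)); auto.
  + intros t phi Ht; apply (ex_derive_mult (u t) (v t)); auto.
  + apply (smooth_n_ext n
      (fun t phi => pd Time u t phi * v t phi + u t phi * pd Time v t phi)).
    * intros; symmetry; apply Derive_mult; auto.
    * apply smooth_n_plus; apply IH; auto using smooth_n_pd, smooth_n_S.
  + apply (smooth_n_ext n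
      (fun t phi => pd Angle u t phi * v t phi + u t phi * pd Angle v t phi)).
    * intros; symmetry; apply Derive_mult; auto.
    * apply smooth_n_plus; apply IH; auto using smooth_n_pd, smooth_n_S.
Qed.

Lemma smooth_n_inv n : smooth_n n (fun t _ => / t).
Proof.
induction n as [|n IH].
- intros t phi Ht; split; [|exact I].
  apply continuity_2d_pt_inv; [apply continuity_2d_pt_id1|lra].
- apply smooth_n_step.
  + intros; now apply smooth_n_cont with n.
  + intros t phi Ht; auto_derive; lra.
  + intros; apply ex_derive_const.
  + apply (smooth_n_ext n (fun t _ => (- 1) * (/ t * / t))).
    * intros t phi Ht; symmetry; apply is_derive_unique; auto_derive; [lra|field; lra].
    * apply smooth_n_mult; [apply smooth_n_const|now apply smooth_n_mult].
  + apply (smooth_n_ext n (fun _ _ => 0)); [|apply smooth_n_const].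
    intros t phi _; symmetry; unfold pd; apply Derive_const.
Qed.

Lemma smooth_pd u i : smooth u -> smooth (pd i u).
Proof. intros H n; exact (smooth_n_pd n u i (H (S n))). Qed.

Lemma smooth_ext u v :
  (forall t phi, 0 < t -> u t phi = v t phi) -> smooth u -> smooth v.
Proof. intros H Hu n; exact (smooth_n_ext n u v H (Hu n)). Qed.

Lemma smooth_ex_T u t phi : smooth u -> 0 < t -> ex_derive (fun s => u s phi) t.
Proof. intros H; exact (smooth_n_ex_T 0 u t phi (H 1%nat)). Qed.

Lemma smooth_ex_A u t phi : smooth u -> 0 < t -> ex_derive (fun s => u t s) phi.
Proof. intros H; exact (smooth_n_ex_A 0 u t phi (H 1%nat)). Qed.

Lemma smooth_plus u v : smooth u -> smooth v -> smooth (fun t phi => u t phi + v t phi).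
Proof. intros Hu Hv n; exact (smooth_n_plus n u v (Hu n) (Hv n)). Qed.

Lemma smooth_mult u v : smooth u -> smooth v -> smooth (fun t phi => u t phi * v t phi).
Proof. intros Hu Hv n; exact (smooth_n_mult n u v (Hu n) (Hv n)). Qed.

Lemma smooth_scal k u : smooth u -> smooth (fun t phi => k * u t phi).
Proof. intros Hu; exact (smooth_mult _ _ (fun n => smooth_n_const n k) Hu). Qed.

Lemma smooth_inv : smooth (fun t _ => / t).
Proof. exact smooth_n_inv. Qed.

Lemma sqrt_det_pos t phi : 0 < t -> sqrt_det t phi = t.
Proof.
intros Ht; unfold sqrt_det, det_metric, metric.
replace (-1 * t ^ 2 - 0 * 0) with (- (t * t)) by ring.
rewrite Rabs_Ropp, Rabs_pos_eq by nra; apply sqrt_square; lra.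
Qed.

Lemma inv_metric_pos i j t phi : 0 < t ->
  inv_metric i j t phi =
    match i, j with Time, Time => - 1 | Angle, Angle => / t * / t | _, _ => 0 end.
Proof.
intros Ht; unfold inv_metric, det_metric, metric; destruct i, j; field; lra.
Qed.

Lemma pd_ext i u v t phi :
  (forall s theta, 0 < s -> u s theta = v s theta) -> 0 < t ->
  pd i u t phi = pd i v t phi.
Proof.
intros H Ht; destruct i; apply Derive_ext_loc.
- generalize (pos_locally t Ht); apply filter_imp; intros; now apply H.
- apply filter_forall; intros; now apply H.
Qed.

Lemma box_pos u t phi : smooth u -> 0 < t ->
  box u t phi = - pd Time (pd Time u) t phi - / t * pd Time u t phi
    + / t * / t * pd Angle (pd Angle u) t phi.
Proof.
intros Hu Ht; unfold box, sum_coord; rewrite (sqrt_det_pos t phi Ht).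
assert (G : forall i j, pd i (fun s theta => sqrt_det s theta * inv_metric i j s theta
    * pd j u s theta) t phi
  = match i, j with
    | Time, Time => pd Time (fun s theta => - (s * pd Time u s theta)) t phi
    | Angle, Angle => pd Angle (fun s theta => / s * pd Angle u s theta) t phi
    | _, _ => 0
    end).
{ intros i j; destruct i, j.
  - apply pd_ext; auto; intros; rewrite sqrt_det_pos, inv_metric_pos by auto; ring.
  - rewrite <- (pd_const Time 0 t phi); apply pd_ext; auto.
    intros; rewrite inv_metric_pos by auto; ring.
  - rewrite <- (pd_const Angle 0 t phi); apply pd_ext; auto.
    intros; rewrite inv_metric_pos by auto; ring.
  - apply pd_ext; auto; intros; rewrite sqrt_det_pos, inv_metric_pos by auto; field; lra. }
rewrite !G.
replace (pd Time (fun s theta => - (s * pd Time u s theta)) t phi)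
  with (- (pd Time u t phi + t * pd Time (pd Time u) t phi)).
- replace (pd Angle (fun s theta => / s * pd Angle u s theta) t phi)
    with (/ t * pd Angle (pd Angle u) t phi).
  + field; lra.
  + symmetry; apply Derive_scal.
- symmetry; apply is_derive_unique.
  assert (H := smooth_ex_T _ t phi (smooth_pd u Time Hu) Ht).
  unfold pd at 1; auto_derive; [exact H|unfold pd; simpl; ring].
Qed.

Lemma pd_metric i j k t phi :
  pd i (metric j k) t phi =
    match i, j, k with Time, Angle, Angle => 2 * t | _, _, _ => 0 end.
Proof.
destruct i, j, k; unfold pd, metric; try apply Derive_const.
apply is_derive_unique; auto_derive; [exact I|ring].
Qed.

Lemma christoffel_pos k i j t phi : 0 < t ->
  christoffel k i j t phi =
    match k, i, j with
    | Time, Angle, Angle => t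
    | Angle, Time, Angle | Angle, Angle, Time => / t
    | _, _, _ => 0
    end.
Proof.
intros Ht; unfold christoffel, sum_coord.
rewrite !inv_metric_pos, !pd_metric by assumption.
destruct k, i, j; field; lra.
Qed.

Lemma pd_christoffel l k i j t phi : 0 < t ->
  pd l (christoffel k i j) t phi =
    match l, k, i, j with
    | Time, Time, Angle, Angle => 1
    | Time, Angle, Time, Angle | Time, Angle, Angle, Time => - (/ t * / t)
    | _, _, _, _ => 0
    end.
Proof.
intros Ht.
rewrite (pd_ext l _ _ t phi (fun s theta H => christoffel_pos k i j s theta H) Ht).
destruct l, k, i, j; unfold pd; try apply Derive_const;
  apply is_derive_unique; auto_derive; try lra; try exact I; field; lra.
Qed.

Lemma scalar_curvature_pos t phi : 0 < t -> scalar_curvature t phi = 0.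
Proof.
intros Ht; unfold scalar_curvature, ricci, sum_coord.
rewrite !inv_metric_pos, !pd_christoffel, !christoffel_pos by assumption.
field; lra.
Qed.

Lemma P_real_pos xi u t phi : smooth u -> 0 < t ->
  P_real xi u t phi = - pd Time (pd Time u) t phi - / t * pd Time u t phi
    + / t * / t * pd Angle (pd Angle u) t phi.
Proof.
intros Hu Ht; unfold P_real.
rewrite box_pos, scalar_curvature_pos by assumption; ring.
Qed.

Definition tsupp (a b : R) (u : R -> R -> R) : Prop :=
  forall t phi, t < a \/ b < t -> u t phi = 0.

Lemma tsupp_pd a b u i : tsupp a b u -> tsupp a b (pd i u).
Proof.
intros H t phi Ht; destruct i; unfold pd.
- rewrite (Derive_ext_loc _ (fun _ => 0)); [apply Derive_const|].
  destruct Ht as [Ht|Ht].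
  + generalize (open_lt a t Ht); apply filter_imp; auto.
  + generalize (open_gt b t Ht); apply filter_imp; auto.
- rewrite (Derive_ext _ (fun _ => 0)); [apply Derive_const|auto].
Qed.

Lemma tsupp_mult a b u v : tsupp a b v -> tsupp a b (fun t phi => u t phi * v t phi).
Proof. intros H t phi Ht; rewrite H by assumption; ring. Qed.

Lemma tsupp_P a b xi u : tsupp a b u -> tsupp a b (P_real xi u).
Proof.
intros H t phi Ht; unfold P_real, box, sum_coord.
rewrite (H t phi Ht).
assert (G : forall i j, pd i (fun s theta =>
    sqrt_det s theta * inv_metric i j s theta * pd j u s theta) t phi = 0).
{ intros i j.
  apply (tsupp_pd a b _ i (tsupp_mult a b
    (fun s theta => sqrt_det s theta * inv_metric i j s theta) _ (tsupp_pd a b u j H)));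
    assumption. }
rewrite !G; ring.
Qed.

Lemma smooth_P xi u : smooth u -> smooth (P_real xi u).
Proof.
intros Hu.
apply (smooth_ext (fun t phi => (- 1) * pd Time (pd Time u) t phi
  + ((- 1) * (/ t * pd Time u t phi) + (/ t * / t) * pd Angle (pd Angle u) t phi))).
- intros t phi Ht; rewrite P_real_pos by assumption; ring.
- repeat apply smooth_plus; repeat apply smooth_scal; repeat apply smooth_mult;
    auto using smooth_pd, smooth_inv.
Qed.

Lemma pd_periodic u i :
  (forall t phi, 0 < t -> u t (phi + 2 * PI) = u t phi) ->
  forall t phi, 0 < t -> pd i u t (phi + 2 * PI) = pd i u t phi.
Proof.
intros H t phi Ht; destruct i; unfold pd.
- apply Derive_ext_loc; generalize (pos_locally t Ht); apply filter_imp; auto.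
- transitivity (Derive (fun s => u t (s + 2 * PI)) phi).
  + unfold Derive; f_equal; apply Lim_ext; intros h; do 3 f_equal; ring.
  + apply Derive_ext; intros; now apply H.
Qed.

Lemma P_real_periodic xi u : smooth u ->
  (forall t phi, 0 < t -> u t (phi + 2 * PI) = u t phi) ->
  forall t phi, 0 < t -> P_real xi u t (phi + 2 * PI) = P_real xi u t phi.
Proof.
intros Hu H t phi Ht; rewrite !P_real_pos by assumption.
now rewrite !(pd_periodic _ _ (pd_periodic _ _ H)), (pd_periodic _ _ H).
Qed.

Lemma P_real_plus a b xi u v : 0 < a -> smooth u -> smooth v ->
  tsupp a b u -> tsupp a b v -> forall t phi,
  P_real xi (fun s theta => u s theta + v s theta) t phi
    = P_real xi u t phi + P_real xi v t phi.
Proof.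
intros Ha Hu Hv Su Sv t phi; destruct (Rlt_dec 0 t) as [Ht|Ht].
- rewrite !P_real_pos by auto using smooth_plus.
  assert (D : forall i u v, smooth u -> smooth v -> forall t phi, 0 < t ->
    pd i (fun s theta => u s theta + v s theta) t phi = pd i u t phi + pd i v t phi).
  { clear; intros i u v Hu Hv t phi Ht.
    destruct i; apply Derive_plus; auto using smooth_ex_T, smooth_ex_A. }
  rewrite (D Time u v) by assumption.
  rewrite (pd_ext Time (pd Time (fun s theta => u s theta + v s theta)) _ t phi
    (fun s theta Hs => D Time u v Hu Hv s theta Hs) Ht).
  rewrite (pd_ext Angle (pd Angle (fun s theta => u s theta + v s theta)) _ t phi
    (fun s theta Hs => D Angle u v Hu Hv s theta Hs) Ht).
  rewrite !D by auto using smooth_pd; ring.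
- rewrite !(tsupp_P a b); auto; try lra.
  intros s theta Hs; rewrite Su, Sv by assumption; ring.
Qed.

Lemma P_real_scal xi k u t phi :
  P_real xi (fun s theta => k * u s theta) t phi = k * P_real xi u t phi.
Proof.
assert (D : forall i u t phi,
  pd i (fun s theta => k * u s theta) t phi = k * pd i u t phi).
{ clear; intros i u t phi; destruct i; apply Derive_scal. }
assert (E : forall i (u v : R -> R -> R) t phi,
  (forall s theta, u s theta = v s theta) -> pd i u t phi = pd i v t phi).
{ clear; intros i u v t phi H; destruct i; apply Derive_ext; auto. }
assert (G : forall i j, pd i (fun s theta => sqrt_det s theta * inv_metric i j s theta
    * pd j (fun s theta => k * u s theta) s theta) t phi
  = k * pd i (fun s theta => sqrt_det s theta * inv_metric i j s theta
    * pd j u s theta) t phi).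
{ intros i j; rewrite <- D; apply E; intros; rewrite D; ring. }
unfold P_real, box, sum_coord; rewrite !G; ring.
Qed.

Lemma Ccomp_split f : Ccomp f <->
  (forall t phi, 0 < t -> f t (phi + 2 * PI) = f t phi) /\
  smooth (re_part f) /\ smooth (im_part f) /\
  exists a b, 0 < a /\ tsupp a b (re_part f) /\ tsupp a b (im_part f).
Proof.
split.
- intros [[H1 [H2 H3]] [a [b [Ha H4]]]]; do 3 (split; [assumption|]).
  exists a, b; split; [assumption|]; split; intros t phi Ht;
    unfold re_part, im_part; now rewrite H4.
- intros [H1 [H2 [H3 [a [b [Ha [H4 H5]]]]]]]; split; [now repeat split|].
  exists a, b; split; [assumption|]; intros t phi Ht.
  apply injective_projections; [now apply H4|now apply H5].
Qed.

Lemma tsupp_weaken a b a' b' u : a' <= a -> b <= b' -> tsupp a b u -> tsupp a' b' u.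
Proof. intros Ha Hb H t phi Ht; apply H; lra. Qed.

Lemma Ccomp_common f g : Ccomp f -> Ccomp g ->
  exists a b, 0 < a /\ (tsupp a b (re_part f) /\ tsupp a b (im_part f)) /\
    (tsupp a b (re_part g) /\ tsupp a b (im_part g)).
Proof.
intros Hf Hg; apply Ccomp_split in Hf; apply Ccomp_split in Hg.
destruct Hf as [_ [_ [_ [a [b [Ha [H1 H2]]]]]]].
destruct Hg as [_ [_ [_ [a' [b' [Ha' [H1' H2']]]]]]].
exists (Rmin a a'), (Rmax b b').
assert (A1 := Rmin_l a a'); assert (A2 := Rmin_r a a').
assert (B1 := Rmax_l b b'); assert (B2 := Rmax_r b b').
split; [now apply Rmin_glb_lt|].
repeat split; [apply (tsupp_weaken a b)|apply (tsupp_weaken a b)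
  |apply (tsupp_weaken a' b')|apply (tsupp_weaken a' b')]; assumption.
Qed.

Lemma Ccomp_plus f g : Ccomp f -> Ccomp g -> Ccomp (fplus f g).
Proof.
intros Hf Hg; destruct (Ccomp_common f g Hf Hg) as [a [b [Ha [[A1 A2] [B1 B2]]]]].
apply Ccomp_split in Hf; apply Ccomp_split in Hg; apply Ccomp_split.
destruct Hf as [H1 [H2 [H3 _]]], Hg as [G1 [G2 [G3 _]]].
split; [intros; unfold fplus; now rewrite H1, G1|].
split; [now apply smooth_plus|]; split; [now apply smooth_plus|].
exists a, b; split; [assumption|]; split; intros t phi Ht.
- change (re_part f t phi + re_part g t phi = 0); rewrite A1, B1 by assumption; ring.
- change (im_part f t phi + im_part g t phi = 0); rewrite A2, B2 by assumption; ring.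
Qed.

Lemma re_part_scal (k : R) f : re_part (fscal (RtoC k) f) = fun t phi => k * re_part f t phi.
Proof.
apply functional_extensionality; intro t; apply functional_extensionality; intro phi.
apply re_scal_l.
Qed.

Lemma im_part_scal (k : R) f : im_part (fscal (RtoC k) f) = fun t phi => k * im_part f t phi.
Proof.
apply functional_extensionality; intro t; apply functional_extensionality; intro phi.
apply im_scal_l.
Qed.

Lemma Ccomp_scal (k : R) f : Ccomp f -> Ccomp (fscal (RtoC k) f).
Proof.
intros Hf; apply Ccomp_split in Hf; apply Ccomp_split.
destruct Hf as [H1 [H2 [H3 [a [b [Ha [H4 H5]]]]]]].
rewrite re_part_scal, im_part_scal.
split; [intros; unfold fscal; now rewrite H1|].
split; [now apply smooth_scal|]; split; [now apply smooth_scal|].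
exists a, b; split; [assumption|]; split; now apply tsupp_mult.
Qed.

Lemma Ccomp_zero : Ccomp fzero.
Proof.
apply Ccomp_split; split; [reflexivity|].
split; [exact (fun n => smooth_n_const n 0)|]; split; [exact (fun n => smooth_n_const n 0)|].
exists 1, 1; split; [lra|]; now split; intros t phi _.
Qed.

(* C_0^oo(M,R) as a real vector space *)
Definition test_real : subspace field_ModuleSpace.
Proof.
apply (Subspace (E := field_ModuleSpace) Ccomp_real).
- split; [apply Ccomp_zero|reflexivity].
- intros f g [Hf Hf'] [Hg Hg']; split; [now apply Ccomp_plus|].
  intros t phi; change (Im (f t phi) + Im (g t phi) = 0); rewrite Hf', Hg'; ring.
- intros k f [Hf Hf']; split; [now apply Ccomp_scal|].
  intros t phi; change (Im (Cmult (RtoC k) (f t phi)) = 0).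
  rewrite im_scal_l, Hf'; ring.
Defined.

Lemma P_op_Ccomp xi f : Ccomp f -> Ccomp (P_op xi f).
Proof.
intros Hf; apply Ccomp_split in Hf; apply Ccomp_split.
destruct Hf as [H1 [H2 [H3 [a [b [Ha [H4 H5]]]]]]].
split; [|split; [now apply smooth_P|split; [now apply smooth_P|]]].
- intros t phi Ht; unfold P_op; f_equal; apply P_real_periodic; auto;
    intros; unfold re_part, im_part; now rewrite H1.
- exists a, b; split; [assumption|]; split; now apply tsupp_P.
Qed.

Lemma P_op_Ccomp_real xi f : Ccomp_real f -> Ccomp_real (P_op xi f).
Proof.
intros [Hf Hf']; split; [now apply P_op_Ccomp|]; intros t phi.
change (P_real xi (im_part f) t phi = 0).
replace (im_part f) with (fun t phi => 0 * im_part f t phi).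
- rewrite P_real_scal; ring.
- apply functional_extensionality; intro s; apply functional_extensionality; intro r.
  unfold im_part; rewrite Hf'; ring.
Qed.

Lemma P_op_linear xi : linear_on (E := field_ModuleSpace) (F := field_ModuleSpace)
  test_real (P_op xi).
Proof.
split.
- intros f g [Hf _] [Hg _].
  destruct (Ccomp_common f g Hf Hg) as [a [b [Ha [[A1 A2] [B1 B2]]]]].
  destruct Hf as [[_ [Hf1 Hf2]] _], Hg as [[_ [Hg1 Hg2]] _].
  apply field_ext; intros t phi; apply injective_projections.
  + now apply (P_real_plus a b xi (re_part f) (re_part g)).
  + now apply (P_real_plus a b xi (im_part f) (im_part g)).
- intros k f _; apply field_ext; intros t phi.
  change (P_op xi (fscal (RtoC k) f) t phi = Cmult (RtoC k) (P_op xi f t phi)).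
  unfold P_op; rewrite re_part_scal, im_part_scal, !P_real_scal.
  apply injective_projections; simpl; ring.
Qed.

Lemma Ccomp_ex_derive f t phi : Ccomp f ->
  ex_derive (fun s => re_part f t s) phi /\ ex_derive (fun s => im_part f t s) phi.
Proof.
intros [[_ [H2 H3]] [a [b [Ha H4]]]]; destruct (Rlt_dec 0 t) as [Ht|Ht].
- split; now apply smooth_ex_A.
- split; apply (ex_derive_ext (fun _ => 0)); try apply ex_derive_const;
    intros s; unfold re_part, im_part; rewrite H4 by lra; reflexivity.
Qed.

Lemma ex_RInt_diff (g : R -> R) a b : (forall x, ex_derive g x) -> ex_RInt g a b.
Proof.
intros H; apply (ex_RInt_continuous (V := R_CompleteNormedModule)); intros z _.
apply (ex_derive_continuous (K := R_AbsRing) (V := R_NormedModule)), H.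
Qed.

Definition fourier_integrand (f : field) (t : R) (n : Z) (phi : R) : C :=
  Cmult (f t phi) (expi (- (IZR n * phi))).

Lemma ex_RInt_fourier f t n : Ccomp f ->
  ex_RInt (V := C_R_CompleteNormedModule) (fourier_integrand f t n) 0 (2 * PI).
Proof.
intros Hf; apply (ex_RInt_fct_extend_pair (U := R_NormedModule) (V := R_NormedModule)).
- apply (ex_RInt_diff (fun phi => re_part f t phi * cos (- (IZR n * phi))
    - im_part f t phi * sin (- (IZR n * phi)))).
  intros phi; destruct (Ccomp_ex_derive f t phi Hf); auto_derive; auto.
- apply (ex_RInt_diff (fun phi => re_part f t phi * sin (- (IZR n * phi))
    + im_part f t phi * cos (- (IZR n * phi)))).
  intros phi; destruct (Ccomp_ex_derive f t phi Hf); auto_derive; auto.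
Qed.

Lemma Cmod_expi x : Cmod (expi x) = 1.
Proof.
unfold Cmod, expi; simpl.
replace (cos x * (cos x * 1) + sin x * (sin x * 1)) with 1; [apply sqrt_1|].
generalize (sin2_cos2 x); unfold Rsqr; lra.
Qed.

Lemma fourier_bound f t : Ccomp f ->
  exists M, 0 <= M /\ forall n, Cmod (fourier f t n) <= M.
Proof.
intros Hf.
set (g := fun phi => 1 + (re_part f t phi ^ 2 + im_part f t phi ^ 2)).
assert (Hg : ex_RInt g 0 (2 * PI)).
{ apply ex_RInt_diff; intros phi; destruct (Ccomp_ex_derive f t phi Hf).
  unfold g; auto_derive; auto. }
assert (PP := PI_RGT_0).
assert (B : forall n, Cmod (fourier f t n) <= / (2 * PI) * RInt g 0 (2 * PI)).
{ intros n; unfold fourier; rewrite Cmod_mult, Cmod_R.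
  rewrite Rabs_pos_eq by (left; apply Rinv_0_lt_compat; lra).
  apply Rmult_le_compat_l; [left; apply Rinv_0_lt_compat; lra|].
  rewrite Cmod_norm.
  apply (norm_RInt_le (V := C_R_NormedModule) (fourier_integrand f t n) g 0 (2 * PI)).
  - lra.
  - intros phi _; rewrite <- Cmod_norm; unfold fourier_integrand.
    rewrite Cmod_mult, Cmod_expi, Rmult_1_r; unfold g, Cmod.
    change (fst (f t phi)) with (re_part f t phi).
    change (snd (f t phi)) with (im_part f t phi).
    set (y := _ + _ ^ 2).
    assert (0 <= y) by (unfold y; nra).
    apply Rsqr_incr_0_var; [|lra]; unfold Rsqr; rewrite sqrt_sqrt by assumption; nra.
  - apply (RInt_correct (V := C_R_CompleteNormedModule)), ex_RInt_fourier, Hf.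
  - apply (RInt_correct (V := R_CompleteNormedModule)), Hg. }
exists (/ (2 * PI) * RInt g 0 (2 * PI)); split; [|exact B].
eapply Rle_trans; [apply Cmod_ge_0|apply (B 0%Z)].
Qed.

Lemma fourier_plus f g t n : Ccomp f -> Ccomp g ->
  fourier (fplus f g) t n = Cplus (fourier f t n) (fourier g t n).
Proof.
intros Hf Hg; unfold fourier.
rewrite <- Cmult_plus_distr_l; f_equal.
transitivity (RInt (V := C_R_CompleteNormedModule) (fun phi =>
  plus (fourier_integrand f t n phi) (fourier_integrand g t n phi)) 0 (2 * PI)).
- apply RInt_ext; intros phi _; apply Cmult_plus_distr_r.
- apply (RInt_plus (V := C_R_CompleteNormedModule)); now apply ex_RInt_fourier.
Qed.

Lemma fourier_scal (k : R) f t n : Ccomp f ->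
  fourier (fscal (RtoC k) f) t n = Cmult (RtoC k) (fourier f t n).
Proof.
intros Hf; unfold fourier.
transitivity (Cmult (RtoC (/ (2 * PI)))
  (Cmult (RtoC k) (RInt (V := C_R_CompleteNormedModule)
    (fourier_integrand f t n) 0 (2 * PI)))); [|unfold fourier_integrand; ring].
f_equal; rewrite <- scal_R_Cmult.
rewrite <- (RInt_scal (V := C_R_CompleteNormedModule)) by now apply ex_RInt_fourier.
assert (E : forall phi, Cmult (fscal (RtoC k) f t phi) (expi (- (IZR n * phi)))
  = Cmult (RtoC k) (fourier_integrand f t n phi)).
{ intros; unfold fourier_integrand, fscal; ring. }
apply RInt_ext; intros phi _; rewrite scal_R_Cmult; exact (E phi).
Qed.

Lemma S_coef_bound (lambda : R) (k : nat) (n : Z) :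
  0 < lambda -> n = Z.of_nat (S k) \/ n = (- Z.of_nat (S k))%Z ->
  0 <= S_coef lambda n <= 2 * exp (- (3 * lambda / 2)) ^ S k.
Proof.
intros Hl Hn; unfold S_coef.
set (x := 3 * lambda * INR (S k)).
assert (Hx : cosh (3 * lambda * IZR n) = cosh x).
{ destruct Hn as [-> | ->]; unfold x, cosh; rewrite ?opp_IZR, <- INR_IZR_INZ;
    [reflexivity|].
  replace (3 * lambda * - INR (S k)) with (- (3 * lambda * INR (S k))) by ring.
  rewrite Ropp_involutive; lra. }
rewrite Hx; clear Hx.
assert (He : exp (- (3 * lambda / 2)) ^ S k = / exp (x / 2)).
{ rewrite <- exp_Ropp, <- Rpower_pow by apply exp_pos; unfold Rpower; rewrite ln_exp.
  f_equal; unfold x; field. }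
rewrite He.
assert (Hc : exp (x / 2) / 2 <= sqrt (cosh x)).
{ assert (P1 := exp_pos (x / 2)); assert (P2 := exp_pos x); assert (P3 := exp_pos (- x)).
  rewrite <- (sqrt_square (exp (x / 2) / 2)) by lra; apply sqrt_le_1_alt.
  replace (exp (x / 2) / 2 * (exp (x / 2) / 2)) with (exp x / 4).
  - unfold cosh; lra.
  - replace x with (x / 2 + x / 2) at 1 by field; rewrite exp_plus; field. }
assert (P1 := exp_pos (x / 2)).
split; [left; apply Rinv_0_lt_compat; lra|].
replace (2 * / exp (x / 2)) with (/ (exp (x / 2) / 2)) by (field; lra).
apply Rinv_le_contravar; lra.
Qed.

Definition S_term (lambda : R) (f : field) (t phi : R) (n : Z) : C :=
  Cmult (Cmult (RtoC (S_coef lambda n)) (fourier f t n)) (expi (IZR n * phi)).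

Definition S_pair (lambda : R) (f : field) (t phi : R) (k : nat) : C :=
  Cplus (S_term lambda f t phi (Z.of_nat (S k)))
    (S_term lambda f t phi (- Z.of_nat (S k))%Z).

Lemma S_pair_ex_series lambda f t phi : 0 < lambda -> Ccomp f ->
  ex_series (fun k => Re (S_pair lambda f t phi k)) /\
  ex_series (fun k => Im (S_pair lambda f t phi k)).
Proof.
intros Hl Hf; destruct (fourier_bound f t Hf) as [M [HM Bf]].
set (q := exp (- (3 * lambda / 2))).
assert (Hq : 0 < q < 1).
{ split; [apply exp_pos|]; rewrite <- exp_0; apply exp_increasing; lra. }
assert (HB : ex_series (fun k => (4 * M * q) * q ^ k)).
{ apply (ex_series_scal (V := R_NormedModule) (4 * M * q) (fun k => q ^ k)),
    ex_series_geom.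
  rewrite Rabs_pos_eq; lra. }
assert (Bt : forall k n, n = Z.of_nat (S k) \/ n = (- Z.of_nat (S k))%Z ->
  Cmod (S_term lambda f t phi n) <= 2 * M * q * q ^ k).
{ intros k n Hn; unfold S_term; rewrite !Cmod_mult, Cmod_expi, Cmod_R, Rmult_1_r.
  destruct (S_coef_bound lambda k n Hl Hn) as [H1 H2]; rewrite Rabs_pos_eq by assumption.
  replace (2 * M * q * q ^ k) with (2 * q ^ S k * M) by (simpl; ring).
  apply Rmult_le_compat; auto using Cmod_ge_0. }
assert (Bp : forall k, Cmod (S_pair lambda f t phi k) <= (4 * M * q) * q ^ k).
{ intros k; unfold S_pair; eapply Rle_trans; [apply Cmod_triangle|].
  assert (H1 := Bt k _ (or_introl eq_refl)); assert (H2 := Bt k _ (or_intror eq_refl)).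
  lra. }
split; apply (ex_series_le (K := R_AbsRing) (V := R_CompleteNormedModule) _
    (fun k => (4 * M * q) * q ^ k)); try assumption; intros k;
  (eapply Rle_trans; [|apply Bp]).
- apply re_le_Cmod.
- change (Rabs (Im (S_pair lambda f t phi k)) <= Cmod (S_pair lambda f t phi k)).
  eapply Rle_trans; [apply Rmax_r|apply Rmax_Cmod].
Qed.

Lemma S_term_plus lambda f g t phi n : Ccomp f -> Ccomp g ->
  S_term lambda (fplus f g) t phi n
    = Cplus (S_term lambda f t phi n) (S_term lambda g t phi n).
Proof. intros; unfold S_term; rewrite fourier_plus by assumption; ring. Qed.

Lemma S_term_scal lambda (k : R) f t phi n : Ccomp f ->
  S_term lambda (fscal (RtoC k) f) t phi n = Cmult (RtoC k) (S_term lambda f t phi n).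
Proof. intros; unfold S_term; rewrite fourier_scal by assumption; ring. Qed.

Lemma S_op_plus lambda f g : 0 < lambda -> Ccomp f -> Ccomp g ->
  S_op lambda (fplus f g) = fplus (S_op lambda f) (S_op lambda g).
Proof.
intros Hl Hf Hg; apply field_ext; intros t phi.
destruct (S_pair_ex_series lambda f t phi Hl Hf) as [F1 F2].
destruct (S_pair_ex_series lambda g t phi Hl Hg) as [G1 G2].
change (Cplus (S_term lambda (fplus f g) t phi 0%Z)
    (CSeries (S_pair lambda (fplus f g) t phi))
  = Cplus (Cplus (S_term lambda f t phi 0%Z) (CSeries (S_pair lambda f t phi)))
      (Cplus (S_term lambda g t phi 0%Z) (CSeries (S_pair lambda g t phi)))).
rewrite S_term_plus by assumption.
assert (E : forall k, S_pair lambda (fplus f g) t phi k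
  = Cplus (S_pair lambda f t phi k) (S_pair lambda g t phi k)).
{ intros k; unfold S_pair; rewrite !S_term_plus by assumption; ring. }
replace (CSeries (S_pair lambda (fplus f g) t phi))
  with (Cplus (CSeries (S_pair lambda f t phi)) (CSeries (S_pair lambda g t phi)));
  [ring|].
unfold CSeries; rewrite (Series_ext _ _ (fun k => f_equal Re (E k))),
  (Series_ext _ _ (fun k => f_equal Im (E k))).
apply injective_projections; symmetry; now apply Series_plus.
Qed.

Lemma S_op_scal lambda (k : R) f : Ccomp f ->
  S_op lambda (fscal (RtoC k) f) = fscal (RtoC k) (S_op lambda f).
Proof.
intros Hf; apply field_ext; intros t phi.
change (Cplus (S_term lambda (fscal (RtoC k) f) t phi 0%Z)
    (CSeries (S_pair lambda (fscal (RtoC k) f) t phi))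
  = Cmult (RtoC k)
      (Cplus (S_term lambda f t phi 0%Z) (CSeries (S_pair lambda f t phi)))).
rewrite S_term_scal by assumption.
assert (E : forall j, S_pair lambda (fscal (RtoC k) f) t phi j
  = Cmult (RtoC k) (S_pair lambda f t phi j)).
{ intros j; unfold S_pair; rewrite !S_term_scal by assumption; ring. }
assert (E1 : forall j, Re (S_pair lambda (fscal (RtoC k) f) t phi j)
  = k * Re (S_pair lambda f t phi j)) by (intros j; rewrite E; apply re_scal_l).
assert (E2 : forall j, Im (S_pair lambda (fscal (RtoC k) f) t phi j)
  = k * Im (S_pair lambda f t phi j)) by (intros j; rewrite E; apply im_scal_l).
replace (CSeries (S_pair lambda (fscal (RtoC k) f) t phi))
  with (Cmult (RtoC k) (CSeries (S_pair lambda f t phi))); [ring|].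
unfold CSeries; rewrite (Series_ext _ _ E1), (Series_ext _ _ E2), !Series_scal_l.
apply injective_projections; simpl; ring.
Qed.

Lemma S_op_linear (lambda : posreal) (A : field -> Prop) : (forall f, A f -> Ccomp f) ->
  linear_on (E := field_ModuleSpace) (F := field_ModuleSpace) A (S_op lambda).
Proof.
intros HA; split.
- intros f g Hf Hg; apply S_op_plus; auto; apply cond_pos.
- intros k f Hf; apply S_op_scal; auto.
Qed.

(* P[C_0^oo(M,R)], S[C_0^oo(M,R)] and S[P[C_0^oo(M,R)]] *)
Definition P_image (xi : R) : subspace field_ModuleSpace :=
  image_sub (P_op xi) test_real (P_op_linear xi).

Lemma test_real_Ccomp f : test_real f -> Ccomp f.
Proof. now intros [H _]. Qed.

Lemma P_image_Ccomp xi f : P_image xi f -> Ccomp f.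
Proof. intros [g [[Hg _] ->]]; now apply P_op_Ccomp. Qed.

Definition S_image (lambda : posreal) : subspace field_ModuleSpace :=
  image_sub (S_op lambda) test_real (S_op_linear lambda _ test_real_Ccomp).

Definition SP_image (lambda : posreal) (xi : R) : subspace field_ModuleSpace :=
  image_sub (S_op lambda) (P_image xi) (S_op_linear lambda _ (P_image_Ccomp xi)).

(* The vector space underlying both (V, omega) and (V_star, omega_star). *)
Definition V_space (xi : R) : ModuleSpace R_Ring :=
  quot_ModuleSpace field_ModuleSpace test_real (P_image xi).

Definition V_img_space (lambda : posreal) (xi : R) : ModuleSpace R_Ring :=
  quot_ModuleSpace field_ModuleSpace (S_image lambda) (SP_image lambda xi).

(* The form on U/N obtained by evaluating [om] on chosen representatives; it is
   the form induced by [om] as soon as [descends_to om (quot_form om)]. *)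
Definition quot_form {U N : subspace field_ModuleSpace} (om : field -> field -> C)
    (X Y : quot field_ModuleSpace U N) : R :=
  Re (om (repr X) (repr Y)).

Definition descends_to {U N : subspace field_ModuleSpace} (om : field -> field -> C)
    (rho : quot field_ModuleSpace U N -> quot field_ModuleSpace U N -> R) : Prop :=
  forall (X Y : quot field_ModuleSpace U N) f g, X f -> Y g -> om f g = RtoC (rho X Y).

Definition symplectic_form {V : ModuleSpace R_Ring} (rho : V -> V -> R) : Prop :=
  (forall x y z, rho (plus x y) z = rho x z + rho y z) /\
  (forall (k : R) x y, rho (scal k x) y = k * rho x y) /\
  (forall x y z, rho x (plus y z) = rho x y + rho x z) /\
  (forall (k : R) x y, rho x (scal k y) = k * rho x y) /\
  (forall x y, rho x y = - rho y x) /\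
  (forall x, (forall y, rho x y = 0) -> x = zero).

Definition symplectic_map {V W : ModuleSpace R_Ring}
    (rho : V -> V -> R) (sigma : W -> W -> R) (T : V -> W) : Prop :=
  linear_map T /\ forall x y, sigma (T x) (T y) = rho x y.

(* T[f] = [Op f] for every class [f] *)
Definition induced_by {U N U' N' : subspace field_ModuleSpace} (Op : field -> field)
    (T : quot field_ModuleSpace U N -> quot field_ModuleSpace U' N') : Prop :=
  forall (X : quot field_ModuleSpace U N) f, X f -> T X (Op f).

(* Nonzero unital C*-algebras.  The zero algebra is excluded: it would
   trivially satisfy the Weyl relations. *)
Record CStarAlgebra := {
  cs_space :> CompleteNormedModule C_AbsRing;
  cs_mul : cs_space -> cs_space -> cs_space;
  cs_one : cs_space;
  cs_star : cs_space -> cs_space;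
  cs_mul_assoc : forall a b c, cs_mul a (cs_mul b c) = cs_mul (cs_mul a b) c;
  cs_mul_1_l : forall a, cs_mul cs_one a = a;
  cs_mul_1_r : forall a, cs_mul a cs_one = a;
  cs_mul_plus_l : forall a b c, cs_mul (plus a b) c = plus (cs_mul a c) (cs_mul b c);
  cs_mul_plus_r : forall a b c, cs_mul a (plus b c) = plus (cs_mul a b) (cs_mul a c);
  cs_mul_scal_l : forall (z : C) a b, cs_mul (scal z a) b = scal z (cs_mul a b);
  cs_mul_scal_r : forall (z : C) a b, cs_mul a (scal z b) = scal z (cs_mul a b);
  cs_star_star : forall a, cs_star (cs_star a) = a;
  cs_star_plus : forall a b, cs_star (plus a b) = plus (cs_star a) (cs_star b);
  cs_star_scal : forall (z : C) a, cs_star (scal z a) = scal (Cconj z) (cs_star a);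
  cs_star_mul : forall a b, cs_star (cs_mul a b) = cs_mul (cs_star b) (cs_star a);
  cs_norm_mul : forall a b, norm (cs_mul a b) <= norm a * norm b;
  cs_norm_star : forall a, norm (cs_mul (cs_star a) a) = norm a ^ 2;
  cs_one_neq_0 : cs_one <> zero }.

Arguments cs_mul {_} _ _.
Arguments cs_one {_}.
Arguments cs_star {_} _.

Definition star_morphism (A B : CStarAlgebra) (alpha : A -> B) : Prop :=
  (forall a b, alpha (plus a b) = plus (alpha a) (alpha b)) /\
  (forall (z : C) a, alpha (scal z a) = scal z (alpha a)) /\
  (forall a b, alpha (cs_mul a b) = cs_mul (alpha a) (alpha b)) /\
  alpha cs_one = cs_one /\
  (forall a, alpha (cs_star a) = cs_star (alpha a)).

Definition star_subalgebra (A : CStarAlgebra) (D : A -> Prop) : Prop :=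
  D cs_one /\
  (forall a b, D a -> D b -> D (plus a b)) /\
  (forall (z : C) a, D a -> D (scal z a)) /\
  (forall a b, D a -> D b -> D (cs_mul a b)) /\
  (forall a, D a -> D (cs_star a)).

Definition weyl_algebra {V : ModuleSpace R_Ring} (rho : V -> V -> R)
    (A : CStarAlgebra) (W : V -> A) : Prop :=
  W zero = cs_one /\
  (forall x, cs_star (W x) = W (opp x)) /\
  (forall x y, cs_mul (W x) (W y) = scal (expi (- rho x y / 2)) (W (plus x y))) /\
  (forall D : A -> Prop, closed D -> star_subalgebra A D -> (forall x, D (W x)) ->
     forall a, D a).

(* Uniqueness is among all *-morphisms with the given values on generators. *)
Definition induces_unique_injective_morphism {V V' : ModuleSpace R_Ring} (T : V -> V')
    (A B : CStarAlgebra) (W : V -> A) (W' : V' -> B) : Prop :=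
  exists alpha : A -> B,
    (star_morphism A B alpha /\ forall x, alpha (W x) = W' (T x)) /\
    (forall a b, alpha a = alpha b -> a = b) /\
    forall beta : A -> B,
      star_morphism A B beta -> (forall x, beta (W x) = W' (T x)) ->
      forall a, beta a = alpha a.

(* Main.v *)
Require Import Defs.
From Stdlib Require Import Reals ZArith FinFun Lra Lia List Classical ClassicalEpsilon
  FunctionalExtensionality Relations.
From Coquelicot Require Import Coquelicot.
Open Scope R_scope.

(** [S] is convolution in the angle with an even continuous kernel, so it commutes with
    derivatives and is symmetric; its multipliers [cosh(3 lambda n)^(-1/2)] are positive and
    decay exponentially, whence injectivity (Fourier uniqueness) and properness (compare with
    the Poisson kernel, whose coefficients decay more slowly).  The metric is flat, so [P]
    has no curvature term; Green's identity and the Green operators themselves give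
    uniqueness of retarded and advanced solutions by duality.  Hence [Delta f] is real for
    real [f], [S] commutes with [Delta], and [omega_star(f,g) = omega(Sf,Sg)].

    For the Weyl algebras no Hilbert space is needed.  For a nondegenerate form, averaging
    over conjugations with generators shows that the scalar part of a finite combination of
    generators is bounded by its norm, so the l^2 norm of the coefficients is too.  The
    generators occurring in [h^n] number only polynomially many in [n]; comparing l^1 and
    l^2 norms of coefficients and taking [n]-th roots shows that all C*-norms agree.  The
    closure of the graph of the correspondence of generators is then the graph of an
    isometric morphism.  A star-morphism is automatically contractive because a
    self-adjoint [a] of norm [< 1] is the real part of the unitary [a + i sqrt(1 - a^2)]. *)

(** * C*-algebras *)

(** Two obstacles shape the symplectic part. The image of [S] is a proper subspace, so weak
    nondegeneracy of omega(Sf, Sg) does not follow by restricting omega: the pairing of g with S S f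
    is used instead, with g ranging over all test functions, and both factors [S] are then removed
    by injectivity of the convolution on each time slice. Moreover [Delta f] is not compactly
    supported, so Green's identity is applied to pairs of which one function vanishes near t = 0 and
    the other for large t; as the circle is compact, the supports of the Green operators yield
    exactly such conditions on time.

    In the algebraic part, uniqueness ranges over all star-morphisms, with no continuity assumed,
    which is why contractivity has to be proved. The count of generators rests on commutativity of
    V: W(x) W(y) is a multiple of W(x + y), so the powers of a fixed combination involve integer
    combinations of finitely many vectors with bounded coefficients. Words in independent generators
    could multiply exponentially, and the n-th root would then leave a factor. Injectivity of the
    morphism comes from its being isometric. *)

Section GroupFacts.
Context {G : AbelianGroup}.
Implicit Types a b c d : G.

Lemma plus_plus_swap a b c d : plus (plus a b) (plus c d) = plus (plus a c) (plus b d).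
Proof.
rewrite <- !plus_assoc; f_equal; rewrite !plus_assoc; f_equal; apply plus_comm.
Qed.

Lemma plus_minus_cancel a b : plus (minus a b) b = a.
Proof. unfold minus; now rewrite <- plus_assoc, plus_opp_l, plus_zero_r. Qed.

Lemma minus_eq_zero_eq a b : minus a b = zero -> a = b.
Proof. intros H; rewrite <- (plus_minus_cancel a b), H; apply plus_zero_l. Qed.

Lemma plus_rearrange (p u v q b : G) :
  plus (plus p u) (plus v (plus q b)) = plus (plus p q) (plus (plus u v) b).
Proof.
rewrite !plus_assoc; f_equal; rewrite <- !plus_assoc; f_equal.
rewrite plus_assoc; apply plus_comm.
Qed.

(** With [t = y^2] and [e = 1] this turns the fixed point equation 2y = x + y^2 into x + (1 - y)^2 =
    1, the form in which the square root of 1 - h^2 is needed. *)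
Lemma plus_minus_minus (x t y e : G) :
  plus x t = plus y y -> plus x (minus (minus e y) (minus y t)) = e.
Proof.
intros H; transitivity (plus x (plus (minus e y) (minus t y))).
- f_equal; rewrite <- (opp_minus y t); reflexivity.
- rewrite <- minus_plus_plus, <- H, minus_plus_plus, minus_eq_zero, plus_zero_r, plus_comm.
  apply plus_minus_cancel.
Qed.

End GroupFacts.

Lemma scal_eq_C (z w : C) {E : ModuleSpace C_Ring} (x : E) : z = w -> scal z x = scal w x.
Proof. now intros ->. Qed.

(** The norm axiom gives the upper bound; applied to [Cinv z] and [scal z x] it also gives the lower
    one. *)
Lemma norm_scal_C {E : NormedModule C_AbsRing} (z : C) (x : E) :
  norm (scal z x) = Cmod z * norm x.
Proof.
apply Rle_antisym; [exact (norm_scal z x)|].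
destruct (Ceq_dec z 0) as [->|Hz].
- rewrite Cmod_0, Rmult_0_l; apply norm_ge_0.
- assert (Hz' : 0 < Cmod z) by now apply Cmod_gt_0.
  apply Rmult_le_reg_l with (/ Cmod z); [now apply Rinv_0_lt_compat|].
  replace (/ Cmod z * (Cmod z * norm x)) with (norm x) by (field; lra).
  rewrite <- Cmod_inv by assumption.
  replace x with (scal (Cinv z) (scal z x)) at 1; [exact (norm_scal (Cinv z) (scal z x))|].
  rewrite scal_assoc; transitivity (scal (one : C) x); [|apply scal_one].
  apply scal_eq_C; change (Cmult (Cinv z) z = 1); field; assumption.
Qed.


(** Each notation fixes the structure at which an operation is taken: the same operation reached
    along two inheritance paths is convertible, but [rewrite] would not recognise it. *)
Notation cs_plus := (@plus (CompleteNormedModule.AbelianMonoid C_AbsRing (cs_space _))).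
Notation cs_0 := (@zero (CompleteNormedModule.AbelianMonoid C_AbsRing (cs_space _))).
Notation cs_opp := (@opp (CompleteNormedModule.AbelianGroup C_AbsRing (cs_space _))).
Notation cs_minus := (@minus (CompleteNormedModule.AbelianGroup C_AbsRing (cs_space _))).
Notation cs_scal :=
  (@scal C_Ring (CompleteNormedModule.ModuleSpace C_AbsRing (cs_space _))).
Notation cs_norm :=
  (@norm C_AbsRing (CompleteNormedModule.NormedModule C_AbsRing (cs_space _))).
Notation vplus := (@plus (ModuleSpace.AbelianMonoid R_Ring _)).
Notation vzero := (@zero (ModuleSpace.AbelianMonoid R_Ring _)).
Notation vopp := (@opp (ModuleSpace.AbelianGroup R_Ring _)).
Notation vscal := (@scal R_Ring _).

Section CStar.
Context {A : CStarAlgebra}.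
Implicit Types a b u : A.

Lemma cs_norm_ge_0 a : 0 <= cs_norm a.
Proof. exact (norm_ge_0 a). Qed.

Lemma scal_0_C a : cs_scal (RtoC 0) a = cs_0.
Proof. exact (scal_zero_l (K := C_Ring) a). Qed.

Lemma cs_mul_0_l a : cs_mul cs_0 a = cs_0.
Proof. rewrite <- (scal_0_C cs_0) at 1; now rewrite cs_mul_scal_l, scal_0_C. Qed.

Lemma cs_mul_0_r a : cs_mul a cs_0 = cs_0.
Proof. rewrite <- (scal_0_C cs_0) at 1; now rewrite cs_mul_scal_r, scal_0_C. Qed.

Lemma cs_star_0 : cs_star (cs_0 : A) = cs_0.
Proof.
rewrite <- (scal_0_C cs_0) at 1; rewrite cs_star_scal.
replace (Cconj 0) with (RtoC 0); [apply scal_0_C|].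
apply injective_projections; simpl; ring.
Qed.

Lemma opp_scal_C a : cs_opp a = cs_scal (- (1))%C a.
Proof. exact (eq_sym (scal_opp_one (K := C_Ring) a)). Qed.

Lemma cs_mul_opp_l a b : cs_mul (cs_opp a) b = cs_opp (cs_mul a b).
Proof. now rewrite !opp_scal_C, cs_mul_scal_l. Qed.

Lemma cs_mul_opp_r a b : cs_mul a (cs_opp b) = cs_opp (cs_mul a b).
Proof. now rewrite !opp_scal_C, cs_mul_scal_r. Qed.

Lemma cs_mul_minus_l a b c : cs_mul (cs_minus a b) c = cs_minus (cs_mul a c) (cs_mul b c).
Proof. unfold cs_minus; now rewrite cs_mul_plus_l, cs_mul_opp_l. Qed.

Lemma cs_mul_minus_r a b c : cs_mul a (cs_minus b c) = cs_minus (cs_mul a b) (cs_mul a c).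
Proof. unfold cs_minus; now rewrite cs_mul_plus_r, cs_mul_opp_r. Qed.

Lemma cs_star_opp a : cs_star (cs_opp a) = cs_opp (cs_star a).
Proof.
rewrite !opp_scal_C, cs_star_scal; apply scal_eq_C.
apply injective_projections; simpl; ring.
Qed.

Lemma cs_star_minus a b : cs_star (cs_minus a b) = cs_minus (cs_star a) (cs_star b).
Proof. unfold cs_minus; now rewrite cs_star_plus, cs_star_opp. Qed.

Lemma cs_star_one : cs_star (cs_one : A) = cs_one.
Proof.
rewrite <- (cs_mul_1_r A (cs_star cs_one)).
rewrite <- (cs_star_star A cs_one) at 2.
rewrite <- cs_star_mul, cs_mul_1_r; apply cs_star_star.
Qed.

(** From |a|^2 = |a^* a| <= |a^*| |a| follows |a| <= |a^*|; the same for a^* gives the converse. *)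
Lemma cs_norm_star_eq a : cs_norm (cs_star a) = cs_norm a.
Proof.
assert (H : forall a : A, cs_norm a <= cs_norm (cs_star a)).
{ intros b; assert (H1 := cs_norm_star A b).
  assert (H2 := cs_norm_mul A (cs_star b) b).
  destruct (Req_dec (cs_norm b) 0) as [E|E]; [rewrite E; apply cs_norm_ge_0|].
  assert (H3 := cs_norm_ge_0 b).
  apply Rmult_le_reg_r with (cs_norm b); lra. }
apply Rle_antisym; [|apply H].
rewrite <- (cs_star_star A a) at 2; apply H.
Qed.

Lemma cs_norm_unitary u : cs_mul (cs_star u) u = cs_one -> cs_norm u = 1.
Proof.
(* |1|^2 = |1| leaves the values 0 and 1, and 0 is excluded because the algebra is nonzero. *)
assert (H1 : cs_norm (cs_one : A) = 1).
{ assert (H := cs_norm_star A cs_one); rewrite cs_star_one, cs_mul_1_l in H.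
  assert (cs_norm (cs_one : A) <> 0).
  { intros E; exact (cs_one_neq_0 A (norm_eq_zero (V := CompleteNormedModule.NormedModule C_AbsRing A) _ E)). }
  nra. }
intros H; assert (H2 := cs_norm_star A u); rewrite H, H1 in H2.
assert (H3 := cs_norm_ge_0 u); nra.
Qed.

Lemma cs_norm_one : cs_norm (cs_one : A) = 1.
Proof. apply cs_norm_unitary; now rewrite cs_star_one, cs_mul_1_l. Qed.

Definition self_adjoint a := cs_star a = a.

Lemma self_adjoint_norm_sq a : self_adjoint a -> cs_norm (cs_mul a a) = cs_norm a ^ 2.
Proof. intros H; rewrite <- cs_norm_star; now rewrite H. Qed.

End CStar.

Lemma norm_small_zero {K : AbsRing} {E : NormedModule K} (x : E) :
  (forall eps, 0 < eps -> norm x <= eps) -> x = zero.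
Proof.
intros H; apply norm_eq_zero, Rle_antisym; [|apply norm_ge_0].
apply le_epsilon; intros eps He; rewrite Rplus_0_l; now apply H.
Qed.

Lemma norm_minus_sym {K : AbsRing} {E : NormedModule K} (x y : E) :
  norm (minus x y) = norm (minus y x).
Proof. rewrite <- (norm_opp (minus x y)), opp_minus; reflexivity. Qed.

Lemma norm_minus_trans {K : AbsRing} {E : NormedModule K} (y x z : E) :
  norm (minus x z) <= norm (minus x y) + norm (minus y z).
Proof. rewrite (minus_trans y); apply norm_triangle. Qed.

(** If no point of [D] were near [x], the complement of [D] would be a neighbourhood of [x], which
    is what the filter definition of closedness excludes. *)
Lemma closed_intro {K : AbsRing} {E : NormedModule K} (D : E -> Prop) :
  (forall x, (forall eps, 0 < eps -> exists y, D y /\ norm (minus y x) < eps) -> D x) ->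
  closed D.
Proof.
intros H x Hx; apply H; intros eps He.
apply NNPP; intros Hn; apply Hx.
apply (locally_le_locally_norm x); exists (mkposreal eps He); intros y Hy Dy.
apply Hn; exists y; split; [assumption|exact Hy].
Qed.

(** * Finite combinations of Weyl operators *)

Section CStarNorm.
Context {A : CStarAlgebra}.
Implicit Types a b c : A.

Lemma cs_norm_scal (z : C) a : cs_norm (cs_scal z a) = Cmod z * cs_norm a.
Proof. exact (norm_scal_C z a). Qed.

Lemma cs_norm_plus a b : cs_norm (cs_plus a b) <= cs_norm a + cs_norm b.
Proof. exact (norm_triangle a b). Qed.

Lemma cs_norm_zero : cs_norm (cs_0 : A) = 0.
Proof. exact (norm_zero (V := CompleteNormedModule.NormedModule C_AbsRing A)). Qed.

Lemma cs_norm_opp a : cs_norm (cs_opp a) = cs_norm a.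
Proof. exact (norm_opp a). Qed.

Lemma cs_scal_scal (z w : C) a : cs_scal z (cs_scal w a) = cs_scal (z * w)%C a.
Proof. exact (scal_assoc (K := C_Ring) z w a). Qed.

Lemma cs_scal_1 a : cs_scal (RtoC 1) a = a.
Proof. exact (scal_one (K := C_Ring) a). Qed.

Lemma cs_scal_plus_l (z w : C) a : cs_scal (z + w)%C a = cs_plus (cs_scal z a) (cs_scal w a).
Proof. exact (scal_distr_r (K := C_Ring) z w a). Qed.

Lemma cs_scal_plus_r (z : C) a b : cs_scal z (cs_plus a b) = cs_plus (cs_scal z a) (cs_scal z b).
Proof. exact (scal_distr_l (K := C_Ring) z a b). Qed.

Lemma cs_scal_zero_r (z : C) : cs_scal z (cs_0 : A) = cs_0.
Proof. exact (scal_zero_r (K := C_Ring) (V := A) z). Qed.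

Lemma cs_plus_assoc a b c : cs_plus a (cs_plus b c) = cs_plus (cs_plus a b) c.
Proof. exact (plus_assoc a b c). Qed.

Lemma cs_plus_0_l a : cs_plus cs_0 a = a.
Proof. exact (plus_zero_l a). Qed.

Lemma cs_plus_0_r a : cs_plus a cs_0 = a.
Proof. exact (plus_zero_r a). Qed.

End CStarNorm.

Lemma expi_plus x y : expi (x + y) = (expi x * expi y)%C.
Proof.
unfold expi; rewrite cos_plus, sin_plus; apply injective_projections; simpl; ring.
Qed.

Lemma expi_0 : expi 0 = 1.
Proof. unfold expi; now rewrite cos_0, sin_0. Qed.

Section Weyl.
Context {V : ModuleSpace R_Ring} (rho : V -> V -> R) (Hrho : symplectic_form rho).

Lemma vplus_opp_l (x : V) : vplus (vopp x) x = vzero.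
Proof. exact (plus_opp_l x). Qed.
Lemma vplus_opp_r (x : V) : vplus x (vopp x) = vzero.
Proof. exact (plus_opp_r x). Qed.
Lemma vplus_0_r (x : V) : vplus x vzero = x.
Proof. exact (plus_zero_r x). Qed.
Lemma vplus_0_l (x : V) : vplus vzero x = x.
Proof. exact (plus_zero_l x). Qed.
Lemma vplus_assoc (x y z : V) : vplus x (vplus y z) = vplus (vplus x y) z.
Proof. exact (plus_assoc x y z). Qed.
Lemma vplus_comm (x y : V) : vplus x y = vplus y x.
Proof. exact (plus_comm x y). Qed.

Lemma rho_plus_l x y z : rho (vplus x y) z = rho x z + rho y z.
Proof. apply Hrho. Qed.
Lemma rho_scal_l k x y : rho (vscal k x) y = k * rho x y.
Proof. apply Hrho. Qed.
Lemma rho_anti x y : rho x y = - rho y x.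
Proof. apply Hrho. Qed.
Lemma rho_opp_r x y : rho x (vopp y) = - rho x y.
Proof.
rewrite <- (scal_opp_one y); destruct Hrho as [_ [_ [_ [H _]]]].
transitivity (-1 * rho x y); [apply (H (-1))|ring].
Qed.
Lemma rho_diag x : rho x x = 0.
Proof. assert (H := rho_anti x x); lra. Qed.

(** The Weyl relations without generation: the operators W'(T x) need not generate the target
    algebra, yet the norm estimates must apply to them. *)
Definition weyl_system (A : CStarAlgebra) (W : V -> A) : Prop :=
  W vzero = cs_one /\
  (forall x, cs_star (W x) = W (vopp x)) /\
  (forall x y, cs_mul (W x) (W y) = cs_scal (expi (- rho x y / 2)) (W (vplus x y))).

Definition vsum {A : CStarAlgebra} (P : list V) (F : V -> A) : A :=
  fold_right (fun x s => cs_plus (F x) s) cs_0 P.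

Section OneSystem.
Context {A : CStarAlgebra} (W : V -> A) (HW : weyl_system A W).
Implicit Types a b : A.

Lemma weyl_mul x y : cs_mul (W x) (W y) = cs_scal (expi (- rho x y / 2)) (W (vplus x y)).
Proof. apply HW. Qed.
Lemma weyl_star x : cs_star (W x) = W (vopp x).
Proof. apply HW. Qed.
Lemma weyl_zero : W vzero = cs_one.
Proof. apply HW. Qed.

Lemma weyl_norm x : cs_norm (W x) = 1.
Proof.
apply cs_norm_unitary; rewrite weyl_star, weyl_mul, vplus_opp_l, weyl_zero.
rewrite rho_anti, rho_opp_r, rho_diag.
replace (- - - 0 / 2) with 0 by field; rewrite expi_0; apply cs_scal_1.
Qed.

Lemma weyl_conj x y :
  cs_mul (cs_mul (W x) (W y)) (W (vopp x)) = cs_scal (expi (- rho x y)) (W y).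
Proof.
rewrite weyl_mul, cs_mul_scal_l, weyl_mul, cs_scal_scal, <- expi_plus.
f_equal.
- f_equal; rewrite rho_plus_l, !rho_opp_r, rho_diag, (rho_anti y x); field.
- f_equal; rewrite (vplus_comm x y), <- vplus_assoc, vplus_opp_r; apply vplus_0_r.
Qed.

Definition ev (l : list (C * V)) : A :=
  fold_right (fun p s => cs_plus (cs_scal (fst p) (W (snd p))) s) cs_0 l.

Lemma ev_app l l' : ev (l ++ l') = cs_plus (ev l) (ev l').
Proof.
induction l as [|p l IH]; simpl; [now rewrite cs_plus_0_l|].
rewrite IH; apply cs_plus_assoc.
Qed.

Lemma ev_scal c l : cs_scal c (ev l) = ev (map (fun p => ((c * fst p)%C, snd p)) l).
Proof.
induction l as [|p l IH]; simpl; [apply cs_scal_zero_r|].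
now rewrite cs_scal_plus_r, cs_scal_scal, IH.
Qed.

Lemma ev_conj x l : cs_mul (cs_mul (W x) (ev l)) (W (vopp x))
  = ev (map (fun p => ((expi (- rho x (snd p)) * fst p)%C, snd p)) l).
Proof.
induction l as [|p l IH]; simpl; [now rewrite cs_mul_0_r, cs_mul_0_l|].
rewrite cs_mul_plus_r, cs_mul_plus_l, IH; f_equal.
rewrite cs_mul_scal_r, cs_mul_scal_l, weyl_conj, cs_scal_scal; f_equal; ring.
Qed.

Lemma ev_plus_coef (l : list (C * V)) (f g : C * V -> C) :
  cs_plus (ev (map (fun p => (f p, snd p)) l)) (ev (map (fun p => (g p, snd p)) l))
  = ev (map (fun p => ((f p + g p)%C, snd p)) l).
Proof.
induction l as [|p l IH]; simpl; [apply cs_plus_0_l|].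
rewrite <- IH, cs_scal_plus_l; apply (plus_plus_swap (G := A)).
Qed.

(* Averaging over conjugation with W(y), where rho(y,x) = pi, removes W(x) and does
   not change the scalar part. *)
Lemma weyl_scalar_part_le (l : list (C * V)) (z : C) :
  (forall p, In p l -> snd p <> vzero) ->
  Cmod z <= cs_norm (cs_plus (cs_scal z cs_one) (ev l)).
Proof.
(* Induction on the length, because averaging changes the scalar and the coefficients of the
   remaining terms. *)
remember (length l) as n eqn:Hn; revert l z Hn; induction n as [|n IH]; intros l z Hn Hl.
- destruct l; [|discriminate]; simpl.
  rewrite cs_plus_0_r, cs_norm_scal, cs_norm_one; lra.
- destruct l as [|[c x] l]; [discriminate|].
  assert (Hx : x <> vzero) by exact (Hl (c, x) (or_introl eq_refl)).
  assert (Hy : exists y, rho y x = PI).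
  (* Nondegeneracy provides a vector pairing nontrivially with [x]; rescaling makes the value pi,
     whose phase is -1. *)
  { destruct (classic (exists y, rho x y <> 0)) as [[y Hy]|Hno].
    - exists (vscal (PI / rho y x) y); rewrite rho_scal_l; rewrite rho_anti in Hy; field; lra.
    - exfalso; apply Hx; apply Hrho; intros y; apply NNPP; intros Hy; apply Hno; now exists y. }
  destruct Hy as [y Hy].
  set (b := cs_plus (cs_scal z cs_one) (ev ((c, x) :: l))).
  set (b' := cs_mul (cs_mul (W y) b) (W (vopp y))).
  assert (Hb' : cs_norm b' <= cs_norm b).
  { unfold b'; eapply Rle_trans; [apply cs_norm_mul|]; rewrite weyl_norm, Rmult_1_r.
    eapply Rle_trans; [apply cs_norm_mul|]; rewrite weyl_norm; lra. }
  assert (E : cs_plus b b' = cs_plus (cs_scal (2 * z)%C cs_one)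
    (ev (map (fun p => ((fst p + expi (- rho y (snd p)) * fst p)%C, snd p)) l))).
  { unfold b'; rewrite <- weyl_zero.
    (* The scalar is treated as the coefficient of W(0), which every conjugation fixes, so it
       doubles in the sum of [b] and [b']. *)
    assert (Eb : b = ev ((z, vzero) :: (c, x) :: l)).
    { unfold b; simpl; now rewrite weyl_zero. }
    rewrite Eb, ev_conj.
    rewrite <- (map_id ((z, vzero) :: _)) at 1.
    rewrite (map_ext _ (fun p : C * V => (fst p, snd p))) by now intros [].
    rewrite (ev_plus_coef _ fst (fun p => (expi (- rho y (snd p)) * fst p)%C)); simpl.
    f_equal.
    - f_equal.
      replace (rho y vzero) with 0; [rewrite Ropp_0, expi_0; ring|].
      rewrite rho_anti, <- (scal_zero_l (K := R_Ring) (y : V)).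
      transitivity (- (0 * rho y y)); [ring|f_equal; symmetry; apply (rho_scal_l 0)].
    - rewrite Hy; replace (c + expi (- PI) * c)%C with (RtoC 0).
      + now rewrite scal_0_C, cs_plus_0_l.
      + unfold expi; rewrite cos_neg, sin_neg, cos_PI, sin_PI.
        apply injective_projections; simpl; ring. }
  assert (H2 : Cmod (2 * z) <= cs_norm (cs_plus b b')).
  { rewrite E; apply IH.
    - rewrite length_map; simpl in Hn; lia.
    - intros p Hp; apply in_map_iff in Hp; destruct Hp as [q [<- Hq]]; simpl.
      apply Hl; now right. }
  rewrite Cmod_mult in H2; rewrite Cmod_R in H2.
  rewrite Rabs_pos_eq in H2 by lra.
  assert (H3 := cs_norm_plus b b'); fold b; lra.
Qed.

Definition no_scalar_part a : Prop :=
  exists l, (forall p, In p l -> snd p <> vzero) /\ a = ev l.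

Lemma no_scalar_part_zero : no_scalar_part cs_0.
Proof. exists nil; split; [intros p []|reflexivity]. Qed.

Lemma no_scalar_part_plus a b :
  no_scalar_part a -> no_scalar_part b -> no_scalar_part (cs_plus a b).
Proof.
intros [l [Hl ->]] [l' [Hl' ->]]; exists (l ++ l'); split; [|now rewrite ev_app].
intros p Hp; apply in_app_or in Hp; destruct Hp; auto.
Qed.

Lemma no_scalar_part_scal c a : no_scalar_part a -> no_scalar_part (cs_scal c a).
Proof.
intros [l [Hl ->]]; rewrite ev_scal; eexists; split; [|reflexivity].
intros p Hp; apply in_map_iff in Hp; destruct Hp as [q [<- Hq]]; simpl; auto.
Qed.

Lemma no_scalar_part_star_mul x y : x <> y -> no_scalar_part (cs_mul (cs_star (W x)) (W y)).
Proof.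
intros Hxy; rewrite weyl_star, weyl_mul; apply no_scalar_part_scal.
exists ((RtoC 1, vplus (vopp x) y) :: nil); split.
- intros p [<-|[]]; simpl; intros E; apply Hxy.
  rewrite <- (vplus_0_r x), <- E, vplus_assoc, vplus_opp_r; apply vplus_0_l.
- simpl; now rewrite cs_scal_1, cs_plus_0_r.
Qed.

Definition sumsq (P : list V) (d : V -> C) : R :=
  fold_right (fun x s => Cmod (d x) ^ 2 + s) 0 P.

Definition combi (P : list V) (d : V -> C) : A := vsum P (fun x => cs_scal (d x) (W x)).

Lemma no_scalar_part_combi_l x P d :
  ~ In x P -> no_scalar_part (cs_mul (cs_star (W x)) (combi P d)).
Proof.
induction P as [|y P IH]; unfold combi; simpl; intros H.
- rewrite cs_mul_0_r; apply no_scalar_part_zero.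
- rewrite cs_mul_plus_r, cs_mul_scal_r; apply no_scalar_part_plus.
  + apply no_scalar_part_scal, no_scalar_part_star_mul; intros ->; tauto.
  + apply IH; tauto.
Qed.

Lemma no_scalar_part_combi_r x P d :
  ~ In x P -> no_scalar_part (cs_mul (cs_star (combi P d)) (W x)).
Proof.
induction P as [|y P IH]; unfold combi; simpl; intros H.
- rewrite cs_star_0, cs_mul_0_l; apply no_scalar_part_zero.
- rewrite cs_star_plus, cs_star_scal, cs_mul_plus_l, cs_mul_scal_l.
  apply no_scalar_part_plus.
  + apply no_scalar_part_scal, no_scalar_part_star_mul; intros ->; tauto.
  + apply IH; tauto.
Qed.

(** In the expanded product the diagonal terms W(x)^* W(x) = 1 carry |d x|^2, and an off-diagonal
    term is a multiple of W(y - x) with y - x nonzero because [P] has no repetitions. *)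
Lemma combi_star_mul P d : NoDup P -> exists b, no_scalar_part b /\
  cs_mul (cs_star (combi P d)) (combi P d) = cs_plus (cs_scal (RtoC (sumsq P d)) cs_one) b.
Proof.
induction 1 as [|x P Hx HP [b [Hb E]]]; simpl.
- exists cs_0; split; [apply no_scalar_part_zero|].
  unfold combi; simpl; now rewrite cs_mul_0_r, scal_0_C, cs_plus_0_r.
- set (u := cs_scal (Cconj (d x)) (cs_mul (cs_star (W x)) (combi P d))).
  set (v := cs_scal (d x) (cs_mul (cs_star (combi P d)) (W x))).
  exists (cs_plus (cs_plus u v) b); split.
  { repeat apply no_scalar_part_plus; auto.
    - now apply no_scalar_part_scal, no_scalar_part_combi_l.
    - now apply no_scalar_part_scal, no_scalar_part_combi_r. }
  change (combi (x :: P) d) with (cs_plus (cs_scal (d x) (W x)) (combi P d)).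
  rewrite cs_star_plus, cs_mul_plus_l, !cs_mul_plus_r, E, cs_star_scal, !cs_mul_scal_l,
    !cs_mul_scal_r, cs_scal_scal.
  fold u; fold v.
  replace (cs_mul (cs_star (W x)) (W x)) with (cs_one : A).
  2:{ rewrite weyl_star, weyl_mul, vplus_opp_l, weyl_zero.
      rewrite rho_anti, rho_opp_r, rho_diag.
      replace (- - - 0 / 2) with 0 by field; rewrite expi_0; symmetry; apply cs_scal_1. }
  rewrite RtoC_plus, cs_scal_plus_l.
  replace (Cconj (d x) * d x)%C with (RtoC (Cmod (d x) ^ 2)).
  2:{ rewrite Cmod2_alt; apply injective_projections; simpl; unfold Re, Im; ring. }
  set (p := cs_scal _ _); set (q := cs_scal _ _).
  apply (plus_rearrange (G := CompleteNormedModule.AbelianGroup C_AbsRing A)).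
Qed.

Lemma sumsq_le P d : NoDup P -> sumsq P d <= cs_norm (combi P d) ^ 2.
Proof.
intros HP; destruct (combi_star_mul P d HP) as [b [[l [Hl ->]] E]].
rewrite <- cs_norm_star, E.
eapply Rle_trans; [|now apply weyl_scalar_part_le].
rewrite Cmod_R; apply Rle_abs.
Qed.

Definition sumabs (P : list V) (d : V -> C) : R :=
  fold_right (fun x s => Cmod (d x) + s) 0 P.

Lemma combi_norm_le P d : cs_norm (combi P d) <= sumabs P d.
Proof.
induction P as [|x P IH]; unfold combi; simpl; [rewrite cs_norm_zero; lra|].
eapply Rle_trans; [apply cs_norm_plus|]; rewrite cs_norm_scal, weyl_norm.
fold (combi P d); lra.
Qed.

Lemma sumabs_sq_le P d : sumabs P d ^ 2 <= INR (length P) * sumsq P d.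
Proof.
induction P as [|x P IH]; [simpl; lra|].
change (sumabs (x :: P) d) with (Cmod (d x) + sumabs P d).
change (sumsq (x :: P) d) with (Cmod (d x) ^ 2 + sumsq P d).
change (length (x :: P)) with (S (length P)); rewrite S_INR.
assert (Hn := pos_INR (length P)).
destruct Hn as [Hn|Hn].
- set (n := INR (length P)) in *; set (s := sumabs P d) in *; set (q := sumsq P d) in *.
  set (e := Cmod (d x)).
  (* From (n e - s)^2 >= 0 and the induction hypothesis s^2 <= n q, after division by n. *)
  assert (H : 2 * e * s <= n * e ^ 2 + q).
  { apply Rmult_le_reg_l with n; [assumption|].
    assert (H := pow2_ge_0 (n * e - s)); nra. }
  nra.
- destruct P; [simpl; assert (H := Cmod_ge_0 (d x)); nra|].
  simpl length in Hn; rewrite S_INR in Hn; assert (H := pos_INR (length P)); lra.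
Qed.

End OneSystem.
End Weyl.

(** * Uniqueness of the C*-norm *)

(** The factor 2 is for k = 3, where k^2 = 9 exceeds 2^k = 8. *)
Lemma sq_le_two_pow (k : nat) : INR k ^ 2 <= 2 * 2 ^ k.
Proof.
assert (H : (3 <= k)%nat -> INR k ^ 2 <= 2 * 2 ^ k).
{ induction 1 as [|k Hk IH]; [simpl; lra|].
  rewrite S_INR; assert (3 <= INR k) by (apply (le_INR 3) in Hk; simpl in Hk; lra).
  change (2 ^ S k) with (2 * 2 ^ k); nra. }
destruct k as [|[|[|k]]]; [simpl; lra..|apply H; lia].
Qed.

(** If q = x / y exceeded 1, the bound would give 2^k ln q <= m (k + 1) ln 2 after sqrt z <= z and
    logarithms, and the left side outgrows every multiple of k. The exponents 2^k are those of
    iterated squares. *)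
Lemma polynomial_growth_le (x y : R) (m : nat) : 0 <= x -> 0 <= y ->
  (forall k, x ^ (2 ^ k) <= sqrt (INR ((2 ^ k + 1) ^ m)) * y ^ (2 ^ k)) -> x <= y.
Proof.
intros Hx Hy H; apply Rnot_lt_le; intros Hlt.
assert (Hy' : 0 < y).
{ destruct Hy as [Hy|<-]; [assumption|].
  specialize (H 0%nat); simpl in H; lra. }
set (q := x / y).
assert (Hq : 1 < q).
{ unfold q; apply Rmult_lt_reg_r with y; [assumption|]; field_simplify; lra. }
assert (Hlq : 0 < ln q) by (rewrite <- ln_1; apply ln_increasing; lra).
(* For k >= 1 one has m (k + 1) ln 2 <= D k; together with k^2 <= 2 * 2^k this leaves k ln q <= 2
   D. *)
set (D := 2 * ln 2 * INR m).
assert (Hl2 : 0 < ln 2) by (rewrite <- ln_1; apply ln_increasing; lra).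
assert (HD : 0 <= D) by (unfold D; assert (H1 := pos_INR m); nra).
assert (B : forall k, (1 <= k)%nat -> INR k * ln q <= 2 * D).
{ intros k Hk.
  assert (Hk' : 1 <= INR k) by (apply (le_INR 1) in Hk; simpl in Hk; lra).
  assert (H1 : q ^ (2 ^ k) <= (2 ^ (k + 1)) ^ m).
  { apply Rle_trans with (INR ((2 ^ k + 1) ^ m)).
    - apply Rle_trans with (sqrt (INR ((2 ^ k + 1) ^ m))).
      + unfold q, Rdiv; rewrite Rpow_mult_distr, pow_inv.
        assert (Hp := pow_lt y (2 ^ k) Hy').
        apply Rmult_le_reg_r with (y ^ (2 ^ k)); [assumption|].
        field_simplify; [|lra]; rewrite (Rmult_comm (y ^ _)); apply H.
      + set (z := INR ((2 ^ k + 1) ^ m)).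
        assert (Hz : 1 <= z).
        { unfold z; apply (le_INR 1).
          assert ((2 ^ k + 1) ^ m <> 0)%nat by (apply Nat.pow_nonzero; lia); lia. }
        rewrite <- (sqrt_square z) at 2 by lra; apply sqrt_le_1_alt; nra.
    - rewrite pow_INR; apply pow_incr; split; [apply pos_INR|].
      rewrite plus_INR, pow_INR, pow_add, pow_1; change (INR 2) with (1 + 1); change (INR 1) with 1.
      replace (1 + 1) with 2 by ring; assert (Hp : 1 <= 2 ^ k) by (apply pow_R1_Rle; lra); lra. }
  apply ln_le in H1; [|apply pow_lt; lra].
  rewrite !ln_pow in H1 by (try apply pow_lt; lra).
  rewrite pow_INR, plus_INR in H1; change (INR 2) with (1 + 1) in H1; change (INR 1) with 1 in H1.
  assert (H2 := sq_le_two_pow k).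
  assert (H3 : INR m * ((INR k + 1) * ln 2) <= D * INR k).
  { unfold D; assert (H3 := pos_INR m).
    replace (2 * ln 2 * INR m * INR k) with (INR m * ((2 * INR k) * ln 2)) by ring.
    apply Rmult_le_compat_l; [assumption|]; apply Rmult_le_compat_r; lra. }
  assert (H4 : INR k ^ 2 * ln q <= 2 * (D * INR k)).
  { apply Rle_trans with (2 * ((1 + 1) ^ k * ln q)); [|lra].
    replace (1 + 1) with 2 by ring; nra. }
  apply Rmult_le_reg_r with (INR k); [lra|nra]. }
destruct (archimed_cor1 (ln q / (2 * D + 1))) as [N [HN HN']].
{ apply Rdiv_lt_0_compat; lra. }
specialize (B N ltac:(lia)).
assert (HN0 : 0 < INR N) by now apply lt_0_INR.
apply (Rmult_lt_compat_r (INR N * (2 * D + 1))) in HN; [|nra].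
replace (/ INR N * (INR N * (2 * D + 1))) with (2 * D + 1) in HN by (field; lra).
replace (ln q / (2 * D + 1) * (INR N * (2 * D + 1))) with (INR N * ln q) in HN
  by (field; lra).
lra.
Qed.

Section Box.
Context {V : ModuleSpace R_Ring}.

Definition eq_dec_V (x y : V) : {x = y} + {x <> y} := excluded_middle_informative (x = y).

(** All sums of k_i x_i with 0 <= k_i <= n, where [xs] lists the x_i. A product of n operators
    W(x_i) is a multiple of W at such a sum, and for fixed [xs] the length is polynomial in n.
    Repetitions are removed by [nodup] where the list is used. *)
Fixpoint box (xs : list V) (n : nat) : list V :=
  match xs with
  | nil => vzero :: nil
  | x :: xs' => flat_map (fun k => map (vplus (vscal (INR k) x)) (box xs' n)) (seq 0 (n + 1))
  end.

Lemma box_length xs n : length (box xs n) = ((n + 1) ^ length xs)%nat.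
Proof.
induction xs as [|x xs IH]; [reflexivity|].
change (box (x :: xs) n)
  with (flat_map (fun k => map (vplus (vscal (INR k) x)) (box xs n)) (seq 0 (n + 1))).
assert (H : forall (g : nat -> list V) m js, (forall k, length (g k) = m) ->
  length (flat_map g js) = (length js * m)%nat).
{ intros g m js Hg; induction js as [|j js IHj]; simpl; [reflexivity|].
  now rewrite length_app, IHj, Hg. }
rewrite (H _ (length (box xs n))) by (intros; apply length_map).
rewrite length_seq, IH; reflexivity.
Qed.

Lemma in_box_cons x xs n v : In v (box (x :: xs) n) <->
  exists k w, (k <= n)%nat /\ In w (box xs n) /\ v = vplus (vscal (INR k) x) w.
Proof.
change (box (x :: xs) n)
  with (flat_map (fun k => map (vplus (vscal (INR k) x)) (box xs n)) (seq 0 (n + 1))).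
rewrite in_flat_map; split.
- intros [k [Hk Hv]]; apply in_seq in Hk; apply in_map_iff in Hv.
  destruct Hv as [w [<- Hw]]; exists k, w; repeat split; auto; lia.
- intros [k [w [Hk [Hw ->]]]]; exists k; split; [apply in_seq; lia|].
  now apply in_map.
Qed.

Lemma box_plus xs n n' u v :
  In u (box xs n) -> In v (box xs n') -> In (vplus u v) (box xs (n + n')).
Proof.
revert u v; induction xs as [|x xs IH]; intros u v.
- intros [<-|[]] [<-|[]]; left; symmetry; apply vplus_0_l.
- rewrite !in_box_cons; intros [k [w [Hk [Hw ->]]]] [k' [w' [Hk' [Hw' ->]]]].
  exists (k + k')%nat, (vplus w w'); split; [lia|]; split; [now apply IH|].
  rewrite (plus_plus_swap (G := V)); f_equal.
  rewrite plus_INR; symmetry; exact (scal_distr_r (K := R_Ring) (INR k) (INR k') x).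
Qed.

Lemma zero_in_box xs n : In vzero (box xs n).
Proof.
induction xs as [|x xs IH]; [now left|].
apply in_box_cons; exists 0%nat, vzero; split; [lia|]; split; [assumption|].
rewrite vplus_0_r; symmetry; exact (scal_zero_l (K := R_Ring) x).
Qed.

Lemma incl_box xs : incl xs (box xs 1).
Proof.
induction xs as [|x xs IH]; intros y Hy; [destruct Hy|].
apply in_box_cons; destruct Hy as [->|Hy].
- exists 1%nat, vzero; split; [lia|]; split; [apply zero_in_box|].
  rewrite vplus_0_r; symmetry; exact (scal_one (K := R_Ring) y).
- exists 0%nat, y; split; [lia|]; split; [now apply IH|].
  transitivity (vplus vzero y); [now rewrite vplus_0_l|].
  f_equal; symmetry; exact (scal_zero_l (K := R_Ring) x).
Qed.

End Box.

Section TwoSystems.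
Context {V : ModuleSpace R_Ring} (rho : V -> V -> R) (Hrho : symplectic_form rho).
Context {A B : CStarAlgebra} (W1 : V -> A) (W2 : V -> B).
Context (HW1 : weyl_system rho A W1) (HW2 : weyl_system rho B W2).
Implicit Types (a : A) (b : B).

(** The same coefficients in both algebras. As a relation it is stable under sums, products and
    adjoints by construction, and that it is the graph of a function is left to the norm
    estimate. *)
Definition span (P : list V) a b : Prop :=
  exists d, a = combi W1 P d /\ b = combi W2 P d.

Lemma combi_plus {C0 : CStarAlgebra} (W : V -> C0) P d d' :
  cs_plus (combi W P d) (combi W P d') = combi W P (fun x => d x + d' x)%C.
Proof.
induction P as [|x P IH]; unfold combi in *; simpl; [apply cs_plus_0_l|].
rewrite <- IH, cs_scal_plus_l; apply (plus_plus_swap (G := C0)).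
Qed.

Lemma combi_scal {C0 : CStarAlgebra} (W : V -> C0) P c d :
  cs_scal c (combi W P d) = combi W P (fun x => c * d x)%C.
Proof.
induction P as [|x P IH]; unfold combi in *; simpl; [apply cs_scal_zero_r|].
now rewrite cs_scal_plus_r, cs_scal_scal, IH.
Qed.

Lemma combi_indicator {C0 : CStarAlgebra} (W : V -> C0) Q x c : NoDup Q -> In x Q ->
  combi W Q (fun y => if eq_dec_V y x then c else RtoC 0) = cs_scal c (W x).
Proof.
intros HQ; assert (Z : forall P, ~ In x P ->
  combi W P (fun y => if eq_dec_V y x then c else RtoC 0) = cs_0).
{ induction P as [|y P IH]; intros H; unfold combi in *; simpl in *; [reflexivity|].
  destruct (eq_dec_V y x) as [->|_]; [tauto|].
  rewrite scal_0_C, cs_plus_0_l; tauto. }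
induction HQ as [|y Q Hy HQ IH]; intros [].
- subst y; unfold combi; simpl; destruct (eq_dec_V x x) as [_|[]]; [|reflexivity].
  fold (combi W Q (fun y => if eq_dec_V y x then c else RtoC 0)).
  now rewrite (Z Q Hy), cs_plus_0_r.
- unfold combi; simpl; destruct (eq_dec_V y x) as [->|_]; [contradiction|].
  rewrite scal_0_C, cs_plus_0_l; now apply IH.
Qed.

Lemma span_zero P : span P cs_0 cs_0.
Proof.
exists (fun _ => RtoC 0); split; symmetry.
- rewrite <- (scal_0_C (combi W1 P (fun _ => RtoC 0))), combi_scal.
  f_equal; apply functional_extensionality; intros; ring.
- rewrite <- (scal_0_C (combi W2 P (fun _ => RtoC 0))), combi_scal.
  f_equal; apply functional_extensionality; intros; ring.
Qed.

Lemma span_plus P a b a' b' :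
  span P a b -> span P a' b' -> span P (cs_plus a a') (cs_plus b b').
Proof. intros [d [-> ->]] [d' [-> ->]]; rewrite !combi_plus; now eexists. Qed.

Lemma span_scal P c a b : span P a b -> span P (cs_scal c a) (cs_scal c b).
Proof. intros [d [-> ->]]; rewrite !combi_scal; now eexists. Qed.

Lemma span_single Q x : NoDup Q -> In x Q -> span Q (W1 x) (W2 x).
Proof.
intros HQ Hx; exists (fun y => if eq_dec_V y x then RtoC 1 else RtoC 0).
now rewrite !combi_indicator, !cs_scal_1.
Qed.

(** Induction over pairs: closure properties are checked on sums and on multiples of one generator,
    in both algebras at once. *)
Lemma span_ind_pairs (Q : A -> B -> Prop) P a b : Q cs_0 cs_0 ->
  (forall a b a' b', Q a b -> Q a' b' -> Q (cs_plus a a') (cs_plus b b')) ->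
  (forall c x, In x P -> Q (cs_scal c (W1 x)) (cs_scal c (W2 x))) ->
  span P a b -> Q a b.
Proof.
intros H0 Hp Hs [d [-> ->]]; induction P as [|x P IH]; [exact H0|].
apply Hp; [apply Hs; now left|]; apply IH; intros; apply Hs; now right.
Qed.

Lemma span_incl P Q a b : NoDup Q -> incl P Q -> span P a b -> span Q a b.
Proof.
intros HQ HPQ; apply span_ind_pairs.
- apply span_zero.
- intros; now apply span_plus.
- intros c x Hx; apply span_scal, span_single; auto.
Qed.

Lemma span_mul P Q S a b a' b' : NoDup S ->
  (forall x y, In x P -> In y Q -> In (vplus x y) S) ->
  span P a b -> span Q a' b' -> span S (cs_mul a a') (cs_mul b b').
Proof.
intros HS H Hab Hab'; revert Hab.
apply (span_ind_pairs (fun a b => span S (cs_mul a a') (cs_mul b b'))).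
- rewrite !cs_mul_0_l; apply span_zero.
- intros; rewrite !cs_mul_plus_l; now apply span_plus.
- intros c x Hx; rewrite !cs_mul_scal_l; apply span_scal; revert Hab'.
  apply (span_ind_pairs (fun a' b' => span S (cs_mul (W1 x) a') (cs_mul (W2 x) b'))).
  + rewrite !cs_mul_0_r; apply span_zero.
  + intros; rewrite !cs_mul_plus_r; now apply span_plus.
  + intros c' y Hy; rewrite !cs_mul_scal_r; apply span_scal.
    rewrite (weyl_mul rho W1 HW1), (weyl_mul rho W2 HW2).
    apply span_scal, span_single; auto.
Qed.

Lemma span_star P Q a b : NoDup Q -> incl (map vopp P) Q ->
  span P a b -> span Q (cs_star a) (cs_star b).
Proof.
intros HQ HPQ; apply (span_ind_pairs (fun a b => span Q (cs_star a) (cs_star b))).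
- rewrite !cs_star_0; apply span_zero.
- intros; rewrite !cs_star_plus; now apply span_plus.
- intros c x Hx; rewrite !cs_star_scal; apply span_scal.
  rewrite (weyl_star rho W1 HW1), (weyl_star rho W2 HW2).
  apply span_single, HPQ, in_map; assumption.
Qed.

(** |a| is at most the l^1 norm of the coefficients, this is at most sqrt(|P|) times their l^2 norm,
    and the latter is at most |b|: the upper bound is taken in [A], the lower one in [B]. *)
Lemma span_norm_le P a b : NoDup P -> span P a b ->
  cs_norm a <= sqrt (INR (length P)) * cs_norm b.
Proof.
intros HP [d [-> ->]].
eapply Rle_trans; [apply (combi_norm_le rho Hrho W1 HW1)|].
assert (H1 := sumabs_sq_le P d); assert (H2 := sumsq_le rho Hrho W2 HW2 P d HP).
assert (H3 := pos_INR (length P)).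
rewrite <- (sqrt_Rsqr (cs_norm (combi W2 P d))) by apply cs_norm_ge_0.
rewrite <- sqrt_mult_alt by assumption.
apply Rsqr_incr_0_var; [|apply sqrt_pos].
unfold Rsqr at 1; rewrite Rsqr_sqrt by (apply Rmult_le_pos; auto; apply Rle_0_sqr).
unfold Rsqr; nra.
Qed.

(** The power h^(2^k). Squaring preserves self-adjointness, so the C*-identity evaluates the norm of
    each such power exactly. *)
Fixpoint sq_iter {C0 : CStarAlgebra} (h : C0) (k : nat) : C0 :=
  match k with O => h | S k => cs_mul (sq_iter h k) (sq_iter h k) end.

Lemma sq_iter_norm {C0 : CStarAlgebra} (h : C0) k : self_adjoint h ->
  self_adjoint (sq_iter h k) /\ cs_norm (sq_iter h k) = cs_norm h ^ (2 ^ k).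
Proof.
intros Hh; induction k as [|k [IH1 IH2]]; simpl; [split; [assumption|ring]|]; split.
- unfold self_adjoint in *; now rewrite cs_star_mul, IH1.
- rewrite self_adjoint_norm_sq, IH2, <- pow_mult by assumption; f_equal; lia.
Qed.

Lemma span_sq_iter xs a b k : span xs a b ->
  span (nodup eq_dec_V (box xs (2 ^ k))) (sq_iter a k) (sq_iter b k).
Proof.
intros H; induction k as [|k IH].
- apply (span_incl xs); [apply NoDup_nodup| |exact H].
  intros x Hx; apply nodup_In; now apply incl_box.
- apply (span_mul _ _ _ _ _ _ _ (NoDup_nodup _ _)) with (2 := IH) (3 := IH).
  intros x y; rewrite !nodup_In; intros Hx Hy.
  replace (2 ^ S k)%nat with (2 ^ k + 2 ^ k)%nat by (simpl; lia); now apply box_plus.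
Qed.

Lemma nodup_length_le (l : list V) : (length (nodup eq_dec_V l) <= length l)%nat.
Proof.
induction l as [|x l IH]; simpl; [lia|]; destruct (in_dec eq_dec_V x l); simpl; lia.
Qed.

(* h^n is a combination of polynomially many Weyl operators, so comparing the l^1-norm
   with the l^2-norm of the coefficients costs nothing after taking n-th roots. *)
Lemma span_norm_le_1 P a b : span P a b -> cs_norm a <= cs_norm b.
Proof.
intros H.
(* Passing to the self-adjoint a^* a, of norm |a|^2, makes the norms of iterated squares equal to
   powers of the norm. *)
set (h := cs_mul (cs_star a) a); set (h' := cs_mul (cs_star b) b).
assert (Sh : self_adjoint h) by (unfold self_adjoint, h; now rewrite cs_star_mul, cs_star_star).
assert (Sh' : self_adjoint h') by (unfold self_adjoint, h'; now rewrite cs_star_mul, cs_star_star).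
set (N := nodup eq_dec_V (map vopp P)).
assert (HN : span N (cs_star a) (cs_star b)).
{ apply (span_star P); [apply NoDup_nodup| |exact H]; intros x Hx; unfold N; now rewrite nodup_In. }
set (Q := nodup eq_dec_V (flat_map (fun x => map (vplus x) P) N)).
assert (HQ : span Q h h').
{ apply (span_mul N P); [apply NoDup_nodup| |exact HN|exact H].
  intros x y Hx Hy; apply nodup_In, in_flat_map; exists x; split; [assumption|].
  now apply in_map. }
assert (L : cs_norm h <= cs_norm h').
{ apply (polynomial_growth_le _ _ (length Q)); try apply cs_norm_ge_0; intros k.
  destruct (sq_iter_norm h k Sh) as [_ <-]; destruct (sq_iter_norm h' k Sh') as [_ <-].
  eapply Rle_trans; [apply (span_norm_le _ _ _ (NoDup_nodup _ _) (span_sq_iter Q h h' k HQ))|].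
  apply Rmult_le_compat_r; [apply cs_norm_ge_0|]; apply sqrt_le_1_alt, le_INR.
  rewrite <- box_length; apply nodup_length_le. }
unfold h, h' in L; rewrite !cs_norm_star in L.
assert (H1 := cs_norm_ge_0 a); assert (H2 := cs_norm_ge_0 b).
apply Rsqr_incr_0_var; [unfold Rsqr; nra|assumption].
Qed.

End TwoSystems.

(** * Contractivity of star-morphisms *)

Section CStarLimits.
Context {A : CStarAlgebra}.
Implicit Types a b c : A.

Lemma cs_norm_minus_trans b a c :
  cs_norm (cs_minus a c) <= cs_norm (cs_minus a b) + cs_norm (cs_minus b c).
Proof. exact (norm_minus_trans b a c). Qed.

Lemma cs_norm_minus_sym a b : cs_norm (cs_minus a b) = cs_norm (cs_minus b a).
Proof. exact (norm_minus_sym a b). Qed.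

Lemma cs_minus_diag a : cs_minus a a = cs_0.
Proof. exact (minus_eq_zero a). Qed.

Lemma cs_norm_minus_small_eq a b :
  (forall eps, 0 < eps -> cs_norm (cs_minus a b) <= eps) -> a = b.
Proof.
intros H; apply (minus_eq_zero_eq (G := CompleteNormedModule.AbelianGroup C_AbsRing A)).
exact (norm_small_zero (E := CompleteNormedModule.NormedModule C_AbsRing A) _ H).
Qed.

Lemma cs_minus_plus_plus a b c d :
  cs_minus (cs_plus a b) (cs_plus c d) = cs_plus (cs_minus a c) (cs_minus b d).
Proof. exact (minus_plus_plus a b c d). Qed.

Lemma cs_scal_minus z a b : cs_scal z (cs_minus a b) = cs_minus (cs_scal z a) (cs_scal z b).
Proof. exact (scal_minus_distr_l (K := C_Ring) z a b). Qed.

Lemma cs_norm_mul_minus a b a' b' :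
  cs_norm (cs_minus (cs_mul a b) (cs_mul a' b'))
  <= cs_norm (cs_minus a a') * cs_norm b + cs_norm a' * cs_norm (cs_minus b b').
Proof.
eapply Rle_trans; [apply (cs_norm_minus_trans (cs_mul a' b))|].
rewrite <- cs_mul_minus_l, <- cs_mul_minus_r; apply Rplus_le_compat; apply cs_norm_mul.
Qed.

Lemma cs_norm_le_minus a b : cs_norm a <= cs_norm b + cs_norm (cs_minus a b).
Proof.
assert (E : a = cs_plus (cs_minus a b) b) by (symmetry; exact (plus_minus_cancel a b)).
rewrite E at 1; assert (H := cs_norm_plus (cs_minus a b) b); lra.
Qed.

Lemma cs_complete (x : nat -> A) :
  (forall eps, 0 < eps -> exists N, forall n m, (N <= n)%nat -> (N <= m)%nat ->
     cs_norm (cs_minus (x n) (x m)) < eps) ->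
  exists y, forall eps, 0 < eps -> exists N, forall n, (N <= n)%nat ->
     cs_norm (cs_minus (x n) y) < eps.
Proof.
intros H.
destruct (proj1 (filterlim_locally_cauchy (F := eventually) x)) as [y Hy].
- intros eps; destruct (H eps (cond_pos eps)) as [N HN].
  exists (fun n => (N <= n)%nat); split; [now exists N|].
  intros u v Hu Hv; apply (norm_compat1 (V := CompleteNormedModule.NormedModule C_AbsRing A)).
  now apply HN.
- exists y; intros eps He.
  destruct (Hy (fun z => cs_norm (cs_minus z y) < eps)) as [N HN]; [|now exists N].
  apply (locally_le_locally_norm (V := CompleteNormedModule.NormedModule C_AbsRing A) y).
  exists (mkposreal eps He); intros z Hz; exact Hz.
Qed.

Lemma cs_closed (D : A -> Prop) :
  (forall x, (forall eps, 0 < eps -> exists y, D y /\ cs_norm (cs_minus y x) < eps) -> D x) ->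
  closed (T := CompleteNormedModule.UniformSpace C_AbsRing A) D.
Proof.
intros H; apply (closed_intro (E := CompleteNormedModule.NormedModule C_AbsRing A) D), H.
Qed.

End CStarLimits.

Section SquareRoot.
Context {A : CStarAlgebra} (x : A) (r : R).
Hypotheses (Hr : 0 <= r < 1) (Hx : cs_norm x <= r).

(** Fixed point iteration for y = (x + y^2) / 2, started at 0. Every iterate is a real polynomial in
    [x], hence self-adjoint if [x] is, and it commutes with whatever commutes with [x]. *)
Fixpoint root_iter (n : nat) : A :=
  match n with
  | O => cs_0
  | S n => cs_scal (RtoC (/ 2)) (cs_plus x (cs_mul (root_iter n) (root_iter n)))
  end.

(** The smaller solution of r + q^2 = 2 q, the same equation for numbers: the iteration preserves
    the ball of radius [q] and contracts it by the factor [q]. *)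
Let q := 1 - sqrt (1 - r).

Lemma root_rate : 0 <= q < 1 /\ r + q * q = 2 * q.
Proof.
unfold q; assert (H1 : 0 < sqrt (1 - r)) by (apply sqrt_lt_R0; lra).
assert (H2 : sqrt (1 - r) <= 1) by (rewrite <- sqrt_1 at 2; apply sqrt_le_1_alt; lra).
assert (H3 := sqrt_sqrt (1 - r) ltac:(lra)); split; nra.
Qed.

Lemma root_iter_norm n : cs_norm (root_iter n) <= q.
Proof.
destruct root_rate as [H1 H2]; induction n as [|n IH]; simpl; [rewrite cs_norm_zero; lra|].
rewrite cs_norm_scal, Cmod_R, Rabs_pos_eq by lra.
assert (H3 := cs_norm_plus x (cs_mul (root_iter n) (root_iter n))).
assert (H4 := cs_norm_mul A (root_iter n) (root_iter n)).
assert (H5 := cs_norm_ge_0 (root_iter n)); nra.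
Qed.

Lemma root_step (y z : A) : cs_norm y <= q -> cs_norm z <= q ->
  cs_norm (cs_minus (cs_scal (RtoC (/ 2)) (cs_plus x (cs_mul y y)))
    (cs_scal (RtoC (/ 2)) (cs_plus x (cs_mul z z)))) <= q * cs_norm (cs_minus y z).
Proof.
intros Hy Hz; rewrite <- cs_scal_minus, cs_minus_plus_plus, cs_minus_diag, cs_plus_0_l.
rewrite cs_norm_scal, Cmod_R, Rabs_pos_eq by lra.
assert (H := cs_norm_mul_minus y y z z); assert (H1 := cs_norm_ge_0 (cs_minus y z)); nra.
Qed.

Lemma root_iter_cauchy n k : cs_norm (cs_minus (root_iter (n + k)) (root_iter n)) <= 2 * q ^ n.
Proof.
destruct root_rate as [H1 _]; induction n as [|n IH].
- simpl; eapply Rle_trans; [apply (norm_triangle (root_iter k))|].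
  rewrite cs_norm_opp, cs_norm_zero.
  assert (H := root_iter_norm k); unfold cs_norm in *; lra.
- change (root_iter (S n + k)) with
    (cs_scal (RtoC (/ 2)) (cs_plus x (cs_mul (root_iter (n + k)) (root_iter (n + k))))).
  change (root_iter (S n)) with
    (cs_scal (RtoC (/ 2)) (cs_plus x (cs_mul (root_iter n) (root_iter n)))).
  eapply Rle_trans; [apply root_step; apply root_iter_norm|].
  simpl; nra.
Qed.

(* The fixed point y of y = (x + y^2)/2 gives (1 - y)^2 = 1 - x. *)
Lemma fixed_point_root : exists y : A, cs_scal (RtoC 2) y = cs_plus x (cs_mul y y) /\
  forall D : A -> Prop,
    (forall z, (forall eps, 0 < eps -> exists w, D w /\ cs_norm (cs_minus w z) < eps) -> D z) ->
    (forall n, D (root_iter n)) -> D y.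
Proof.
destruct root_rate as [Hq _].
assert (Hpow : forall eps, 0 < eps -> exists N, forall n, (N <= n)%nat -> 2 * q ^ n < eps).
{ intros eps He; destruct (pow_lt_1_zero q) with (y := eps / 2) as [N HN];
    [rewrite Rabs_pos_eq; lra|lra|].
  exists N; intros n Hn; specialize (HN n Hn); apply Rabs_def2 in HN; lra. }
destruct (cs_complete root_iter) as [y Hy].
- intros eps He; destruct (Hpow eps He) as [N HN]; exists N; intros n m Hn Hm.
  destruct (Nat.le_ge_cases m n) as [H|H].
  + replace n with (m + (n - m))%nat by lia.
    eapply Rle_lt_trans; [apply root_iter_cauchy|now apply HN].
  + rewrite cs_norm_minus_sym; replace m with (n + (m - n))%nat by lia.
    eapply Rle_lt_trans; [apply root_iter_cauchy|now apply HN].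
- exists y; split.
  (* A property closed under norm limits passes from the iterates to [y]; it serves for
     self-adjointness and for commutation with [h]. *)
  2:{ intros D HD Hn; apply HD; intros eps He; destruct (Hy eps He) as [N HN].
      exists (root_iter N); split; auto. }
  assert (Hyq : cs_norm y <= q).
  { apply le_epsilon; intros eps He; destruct (Hy eps He) as [N HN].
    assert (H1 := cs_norm_le_minus y (root_iter N)); rewrite cs_norm_minus_sym in H1.
    assert (H2 := root_iter_norm N); specialize (HN N (Nat.le_refl _)); lra. }
  assert (E : y = cs_scal (RtoC (/ 2)) (cs_plus x (cs_mul y y))).
  { apply cs_norm_minus_small_eq; intros eps He.
    destruct (Hy (eps / 2) ltac:(lra)) as [N HN].
    eapply Rle_trans; [apply (cs_norm_minus_trans (root_iter (S N)))|].
    rewrite (cs_norm_minus_sym y).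
    assert (H1 := HN (S N) ltac:(lia)).
    assert (H2 := root_step _ _ (root_iter_norm N) Hyq).
    assert (H3 := HN N ltac:(lia)).
    assert (H4 := cs_norm_ge_0 (cs_minus (root_iter N) y)).
    change (root_iter (S N)) with
      (cs_scal (RtoC (/ 2)) (cs_plus x (cs_mul (root_iter N) (root_iter N)))) at 2.
    set (t := cs_norm (cs_minus (root_iter N) y)) in *.
    nra. }
  rewrite E at 1; rewrite cs_scal_scal.
  replace (RtoC 2 * RtoC (/ 2))%C with (RtoC 1); [apply cs_scal_1|].
  apply injective_projections; simpl; field.
Qed.

End SquareRoot.

Lemma root_iter_self_adjoint {A : CStarAlgebra} (x : A) n :
  self_adjoint x -> self_adjoint (root_iter x n).
Proof.
intros Hx; induction n as [|n IH]; unfold self_adjoint in *; simpl; [apply cs_star_0|].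
rewrite cs_star_scal, cs_star_plus, cs_star_mul, IH, Hx; f_equal.
apply injective_projections; simpl; ring.
Qed.

Lemma root_iter_commute {A : CStarAlgebra} (x h : A) n :
  cs_mul h x = cs_mul x h -> cs_mul h (root_iter x n) = cs_mul (root_iter x n) h.
Proof.
intros Hx; induction n as [|n IH]; simpl; [now rewrite cs_mul_0_l, cs_mul_0_r|].
rewrite cs_mul_scal_l, cs_mul_scal_r, cs_mul_plus_l, cs_mul_plus_r, Hx.
now rewrite cs_mul_assoc, IH, <- (cs_mul_assoc _ (root_iter x n) h), IH, cs_mul_assoc.
Qed.

(* If h is self-adjoint with norm h < 1, then h = (u + u^-1) / 2 with
   u = h + i sqrt(1 - h^2) unitary. *)
Lemma self_adjoint_average_unitary {A : CStarAlgebra} (h : A) :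
  self_adjoint h -> cs_norm h < 1 ->
  exists u, cs_mul (cs_star u) u = cs_one /\ cs_plus u (cs_star u) = cs_scal (RtoC 2) h.
Proof.
intros Hh H1; assert (H0 := cs_norm_ge_0 h).
set (x := cs_mul h h).
assert (Hx : self_adjoint x) by (unfold self_adjoint, x; now rewrite cs_star_mul, Hh).
destruct (fixed_point_root x (cs_norm h ^ 2)) as [y [E HD]]; [nra| |].
{ unfold x; rewrite self_adjoint_norm_sq by assumption; apply Rle_refl. }
assert (Sy : self_adjoint y).
{ apply (HD self_adjoint); [|intros; now apply root_iter_self_adjoint].
  intros z Hz; apply cs_norm_minus_small_eq; intros eps He.
  destruct (Hz (eps / 2)) as [w [Hw Hw']]; [lra|].
  eapply Rle_trans; [apply (cs_norm_minus_trans w)|].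
  rewrite <- Hw at 1; rewrite <- cs_star_minus.
  rewrite cs_norm_star_eq.
  assert (H := cs_norm_minus_sym z w); unfold self_adjoint in *.
  lra. }
assert (Cy : cs_mul h y = cs_mul y h).
{ apply (HD (fun y => cs_mul h y = cs_mul y h));
    [|intros; apply root_iter_commute; unfold x; apply cs_mul_assoc].
  intros z Hz; apply cs_norm_minus_small_eq; intros eps He.
  destruct (Hz (eps / (2 * (cs_norm h + 1)))) as [w [Hw Hw']].
  { apply Rdiv_lt_0_compat; lra. }
  eapply Rle_trans; [apply (cs_norm_minus_trans (cs_mul h w))|].
  rewrite Hw at 2; rewrite <- cs_mul_minus_r, <- cs_mul_minus_l.
  assert (I1 := cs_norm_mul A h (cs_minus z w)); assert (I2 := cs_norm_mul A (cs_minus w z) h).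
  rewrite cs_norm_minus_sym in I1.
  apply (Rmult_lt_compat_r (2 * (cs_norm h + 1))) in Hw'; [|lra].
  replace (eps / (2 * (cs_norm h + 1)) * (2 * (cs_norm h + 1))) with eps in Hw' by (field; lra).
  assert (I3 := cs_norm_ge_0 (cs_minus w z)).
  nra. }
(* [k] is the square root of 1 - h^2, self-adjoint and commuting with [h], so that h + i k is
   unitary. *)
set (k := cs_minus cs_one y).
assert (Sk : cs_star k = k) by (unfold k; now rewrite cs_star_minus, cs_star_one, Sy).
assert (Ck : cs_mul h k = cs_mul k h).
{ unfold k; now rewrite cs_mul_minus_l, cs_mul_minus_r, cs_mul_1_l, cs_mul_1_r, Cy. }
assert (K2 : cs_plus (cs_mul h h) (cs_mul k k) = cs_one).
{ fold x; unfold k; rewrite cs_mul_minus_l, !cs_mul_minus_r, !cs_mul_1_l, !cs_mul_1_r.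
  apply (plus_minus_minus (G := CompleteNormedModule.AbelianGroup C_AbsRing A)).
  transitivity (cs_scal (RtoC 2) y); [symmetry; exact E|].
  replace (RtoC 2) with (1 + 1)%C by (apply injective_projections; simpl; ring).
  now rewrite cs_scal_plus_l, cs_scal_1. }
assert (Si : cs_star (cs_scal Ci k) = cs_scal (- Ci)%C k).
{ rewrite cs_star_scal, Sk; f_equal; apply injective_projections; simpl; ring. }
exists (cs_plus h (cs_scal Ci k)); split.
- rewrite cs_star_plus, Si, Hh.
  rewrite cs_mul_plus_l, !cs_mul_plus_r, !cs_mul_scal_l, !cs_mul_scal_r, cs_scal_scal, Ck.
  rewrite <- K2.
  replace (- Ci * Ci)%C with (RtoC 1) by (apply injective_projections; simpl; ring).
  rewrite cs_scal_1.
  set (p := cs_mul h h); set (s := cs_mul k h); set (t := cs_mul k k).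
  transitivity (cs_plus p (cs_plus (cs_plus (cs_scal Ci s) (cs_scal (- Ci)%C s)) t)).
  + rewrite <- !cs_plus_assoc; reflexivity.
  + rewrite <- cs_scal_plus_l.
    replace (Ci + - Ci)%C with (RtoC 0) by (apply injective_projections; simpl; ring).
    now rewrite scal_0_C, cs_plus_0_l.
- rewrite cs_star_plus, Si, Hh.
  transitivity (cs_plus (cs_plus h h) (cs_plus (cs_scal Ci k) (cs_scal (- Ci)%C k))).
  + exact (plus_plus_swap (G := CompleteNormedModule.AbelianGroup C_AbsRing A) _ _ _ _).
  + rewrite <- cs_scal_plus_l.
    replace (Ci + - Ci)%C with (RtoC 0) by (apply injective_projections; simpl; ring).
    rewrite scal_0_C, cs_plus_0_r.
    replace (RtoC 2) with (1 + 1)%C by (apply injective_projections; simpl; ring).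
    now rewrite cs_scal_plus_l, cs_scal_1.
Qed.

Section Contractive.
Context {A B : CStarAlgebra} (beta : A -> B) (Hb : star_morphism A B beta).

Lemma morphism_contractive_self_adjoint h : self_adjoint h -> cs_norm (beta h) <= cs_norm h.
Proof.
destruct Hb as [Hp [Hs [Hm [H1 Hst]]]].
assert (L : forall h : A, self_adjoint h -> cs_norm h < 1 -> cs_norm (beta h) <= 1).
{ intros g Sg Ng; destruct (self_adjoint_average_unitary g Sg Ng) as [u [Hu Eu]].
  assert (Nu : cs_norm (beta u) = 1).
  { apply cs_norm_unitary; now rewrite <- Hst, <- Hm, Hu. }
  apply (f_equal beta) in Eu; rewrite Hp, Hs, Hst in Eu.
  apply (f_equal cs_norm) in Eu; rewrite cs_norm_scal, Cmod_R, Rabs_pos_eq in Eu by lra.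
  assert (H2 := cs_norm_plus (beta u) (cs_star (beta u))).
  rewrite Eu, Nu in H2.
  rewrite cs_norm_star_eq in H2; lra. }
intros Sh; apply Rnot_lt_le; intros Hlt.
(* Were |h| < |beta h|, division by the midpoint [c] would bring |h| below 1 and leave |beta h|
   above 1. *)
set (c := (cs_norm h + cs_norm (beta h)) / 2).
assert (H0 := cs_norm_ge_0 h).
assert (Hc : 0 < c) by (unfold c; lra).
assert (Hc' : 0 < / c) by now apply Rinv_0_lt_compat.
assert (L' := L (cs_scal (RtoC (/ c)) h)).
rewrite Hs, !cs_norm_scal, Cmod_R, Rabs_pos_eq in L' by lra.
assert (1 < / c * cs_norm (beta h)).
{ apply Rmult_lt_reg_l with c; [assumption|]; unfold c; field_simplify; [lra|].
  unfold c in Hc; lra. }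
assert (/ c * cs_norm h < 1).
{ apply Rmult_lt_reg_l with c; [assumption|]; unfold c; field_simplify; [lra|].
  unfold c in Hc; lra. }
assert (self_adjoint (cs_scal (RtoC (/ c)) h)).
{ unfold self_adjoint in *; rewrite cs_star_scal, Sh; f_equal.
  apply injective_projections; simpl; ring. }
specialize (L' H3 H2); lra.
Qed.

Lemma morphism_contractive a : cs_norm (beta a) <= cs_norm a.
Proof.
assert (H := morphism_contractive_self_adjoint (cs_mul (cs_star a) a)).
assert (Hb' := Hb); destruct Hb' as [_ [_ [Hm [_ Hst]]]].
rewrite Hm, Hst, !cs_norm_star in H.
specialize (H ltac:(unfold self_adjoint; now rewrite cs_star_mul, cs_star_star)).
apply Rsqr_incr_0_var; [|apply cs_norm_ge_0].
unfold Rsqr; nra.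
Qed.

End Contractive.

(** * Morphisms between Weyl algebras *)

Section WeylUniqueness.
Context {V : ModuleSpace R_Ring} (rho : V -> V -> R) (Hrho : symplectic_form rho).
Context {A B : CStarAlgebra} (W1 : V -> A) (W2 : V -> B).
Context (HW1 : weyl_algebra rho A W1) (HW2 : weyl_system rho B W2).
Implicit Types (a : A) (b : B).

Lemma weyl_algebra_system : weyl_system rho A W1.
Proof. destruct HW1 as [H1 [H2 [H3 _]]]; now repeat split. Qed.

Definition graph a b : Prop := exists P, span W1 W2 P a b.

Lemma span_swap P a b : span W1 W2 P a b -> span W2 W1 P b a.
Proof. intros [d [H1 H2]]; now exists d. Qed.

Lemma graph_norm a b : graph a b -> cs_norm a = cs_norm b.
Proof.
intros [P H]; assert (HW1' := weyl_algebra_system); apply Rle_antisym.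
- exact (span_norm_le_1 rho Hrho W1 W2 HW1' HW2 P a b H).
- exact (span_norm_le_1 rho Hrho W2 W1 HW2 HW1' P b a (span_swap P a b H)).
Qed.

Lemma graph_plus a b a' b' : graph a b -> graph a' b' -> graph (cs_plus a a') (cs_plus b b').
Proof.
intros [P H] [P' H']; exists (nodup eq_dec_V (P ++ P')).
apply span_plus; [apply (span_incl _ _ P)|apply (span_incl _ _ P')];
  try apply NoDup_nodup; try assumption; intros x Hx; apply nodup_In, in_or_app; tauto.
Qed.

Lemma graph_scal c a b : graph a b -> graph (cs_scal c a) (cs_scal c b).
Proof. intros [P H]; exists P; now apply span_scal. Qed.

Lemma graph_mul a b a' b' : graph a b -> graph a' b' -> graph (cs_mul a a') (cs_mul b b').
Proof.
intros [P H] [P' H']; exists (nodup eq_dec_V (flat_map (fun x => map (vplus x) P') P)).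
apply (span_mul rho W1 W2 weyl_algebra_system HW2 P P'); try assumption; [apply NoDup_nodup|].
intros x y Hx Hy; apply nodup_In, in_flat_map; exists x; split; [assumption|].
now apply in_map.
Qed.

Lemma graph_star a b : graph a b -> graph (cs_star a) (cs_star b).
Proof.
intros [P H]; exists (nodup eq_dec_V (map vopp P)).
apply (span_star rho W1 W2 weyl_algebra_system HW2 P); try assumption; [apply NoDup_nodup|].
intros x Hx; now apply nodup_In.
Qed.

Lemma graph_weyl x : graph (W1 x) (W2 x).
Proof.
exists (x :: nil); apply span_single; [|now left].
constructor; [intros []|constructor].
Qed.

Definition closure_graph a b : Prop := forall eps, 0 < eps ->
  exists a' b', graph a' b' /\ cs_norm (cs_minus a a') < eps /\ cs_norm (cs_minus b b') < eps.

Lemma graph_closure a b : graph a b -> closure_graph a b.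
Proof.
intros H eps He; exists a, b; split; [assumption|].
now rewrite !cs_minus_diag, !cs_norm_zero.
Qed.

Lemma closure_graph_norm a b : closure_graph a b -> cs_norm a = cs_norm b.
Proof.
intros H; apply Rle_antisym; apply le_epsilon; intros eps He;
  destruct (H (eps / 2)) as [a' [b' [G [Ha Hb]]]]; try lra;
  apply graph_norm in G;
  assert (H1 := cs_norm_le_minus a a'); assert (H2 := cs_norm_le_minus b b');
  assert (H3 := cs_norm_le_minus a' a); assert (H4 := cs_norm_le_minus b' b);
  rewrite (cs_norm_minus_sym a' a) in H3; rewrite (cs_norm_minus_sym b' b) in H4; lra.
Qed.

Lemma closure_graph_plus a b a' b' : closure_graph a b -> closure_graph a' b' ->
  closure_graph (cs_plus a a') (cs_plus b b').
Proof.
intros H H' eps He.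
destruct (H (eps / 2)) as [u [v [G [Ha Hb]]]]; [lra|].
destruct (H' (eps / 2)) as [u' [v' [G' [Ha' Hb']]]]; [lra|].
exists (cs_plus u u'), (cs_plus v v'); split; [now apply graph_plus|].
rewrite !cs_minus_plus_plus; split; (eapply Rle_lt_trans; [apply cs_norm_plus|lra]).
Qed.

Lemma closure_graph_scal c a b : closure_graph a b ->
  closure_graph (cs_scal c a) (cs_scal c b).
Proof.
intros H eps He; assert (Hc := Cmod_ge_0 c).
destruct (H (eps / (Cmod c + 1))) as [u [v [G [Ha Hb]]]]; [apply Rdiv_lt_0_compat; lra|].
exists (cs_scal c u), (cs_scal c v); split; [now apply graph_scal|].
rewrite <- !cs_scal_minus, !cs_norm_scal.
assert (E : eps / (Cmod c + 1) * (Cmod c + 1) = eps) by (field; lra).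
assert (H1 := cs_norm_ge_0 (cs_minus a u)); assert (H2 := cs_norm_ge_0 (cs_minus b v)).
set (e := eps / (Cmod c + 1)) in *; split; nra.
Qed.

Lemma closure_graph_star a b : closure_graph a b -> closure_graph (cs_star a) (cs_star b).
Proof.
intros H eps He; destruct (H eps He) as [u [v [G [Ha Hb]]]].
exists (cs_star u), (cs_star v); split; [now apply graph_star|].
rewrite <- !cs_star_minus; now rewrite !cs_norm_star_eq.
Qed.

Lemma mul_approx {C0 : CStarAlgebra} (a a' u u' : C0) (M d : R) :
  0 < d <= 1 -> 0 <= M -> cs_norm a <= M -> cs_norm a' <= M ->
  cs_norm (cs_minus a u) < d -> cs_norm (cs_minus a' u') < d ->
  cs_norm (cs_minus (cs_mul a a') (cs_mul u u')) <= d * (2 * M + 1).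
Proof.
intros Hd HM Ha Ha' Hu Hu'.
assert (H := cs_norm_mul_minus a a' u u').
assert (H1 := cs_norm_le_minus u a); rewrite cs_norm_minus_sym in H1.
assert (N1 := cs_norm_ge_0 (cs_minus a u)); assert (N2 := cs_norm_ge_0 (cs_minus a' u')).
assert (N3 := cs_norm_ge_0 a'); assert (N4 := cs_norm_ge_0 u).
assert (cs_norm (cs_minus a u) * cs_norm a' <= d * M) by (apply Rmult_le_compat; lra).
assert (cs_norm u * cs_norm (cs_minus a' u') <= (M + 1) * d) by (apply Rmult_le_compat; lra).
nra.
Qed.

Lemma closure_graph_mul a b a' b' : closure_graph a b -> closure_graph a' b' ->
  closure_graph (cs_mul a a') (cs_mul b b').
Proof.
intros H H' eps He.
assert (Nb := closure_graph_norm _ _ H); assert (Nb' := closure_graph_norm _ _ H').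
set (M := cs_norm a + cs_norm a').
assert (Na := cs_norm_ge_0 a); assert (Na' := cs_norm_ge_0 a').
assert (HM : 0 <= M) by (unfold M; lra).
(* The bound 1 keeps the approximants of norm at most M + 1; the other bound makes the error d (2 M
   + 1) of [mul_approx] at most eps / 2. *)
set (d := Rmin 1 (eps / 2 / (2 * M + 1))).
assert (Hd : 0 < d <= 1).
{ unfold d; split; [|apply Rmin_l]; apply Rmin_glb_lt; [lra|].
  apply Rdiv_lt_0_compat; lra. }
assert (Hd' : d * (2 * M + 1) < eps).
{ apply Rle_lt_trans with (eps / 2); [|lra].
  assert (Hm := Rmin_r 1 (eps / 2 / (2 * M + 1))); fold d in Hm.
  apply (Rmult_le_compat_r (2 * M + 1)) in Hm; [|lra].
  replace (eps / 2 / (2 * M + 1) * (2 * M + 1)) with (eps / 2) in Hm by (field; lra); lra. }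
destruct (H d) as [u [v [G [Ha Hb]]]]; [lra|].
destruct (H' d) as [u' [v' [G' [Ha' Hb']]]]; [lra|].
exists (cs_mul u u'), (cs_mul v v'); split; [now apply graph_mul|].
split; (eapply Rle_lt_trans; [apply (mul_approx _ _ _ _ M d); unfold M; lra|assumption]).
Qed.

Lemma closure_graph_minus a b a' b' : closure_graph a b -> closure_graph a' b' ->
  closure_graph (cs_minus a a') (cs_minus b b').
Proof.
intros H H'; apply (closure_graph_scal (- (1))%C) in H'.
rewrite <- !opp_scal_C in H'; exact (closure_graph_plus _ _ _ _ H H').
Qed.

Lemma closure_graph_isometry a b a' b' : closure_graph a b -> closure_graph a' b' ->
  cs_norm (cs_minus b b') = cs_norm (cs_minus a a').
Proof. intros H H'; symmetry; now apply closure_graph_norm, closure_graph_minus. Qed.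

(** The domain of the closure is a star-subalgebra containing the generators. It is closed because,
    by isometry, the images of a convergent sequence form a Cauchy sequence in the complete algebra
    [B]. Generation of [A] does the rest. *)
Lemma closure_graph_total a : exists b, closure_graph a b.
Proof.
destruct HW1 as [H0 [_ [_ Hgen]]].
apply (Hgen (fun a => exists b, closure_graph a b)).
- apply cs_closed; clear a; intros a Ha.
  set (pick n := constructive_indefinite_description _
    (Ha (/ (INR n + 1)) ltac:(apply Rinv_0_lt_compat; assert (H := pos_INR n); lra))).
  set (x n := proj1_sig (pick n)).
  assert (Hx : forall n, (exists b, closure_graph (x n) b) /\
    cs_norm (cs_minus (x n) a) < / (INR n + 1)) by (intros n; exact (proj2_sig (pick n))).
  set (y n := proj1_sig (constructive_indefinite_description _ (proj1 (Hx n)))).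
  assert (Hy : forall n, closure_graph (x n) (y n))
    by (intros n; exact (proj2_sig (constructive_indefinite_description _ (proj1 (Hx n))))).
  assert (Lx : forall eps, 0 < eps -> exists N, forall n, (N <= n)%nat ->
    cs_norm (cs_minus (x n) a) < eps).
  { intros eps He; destruct (archimed_cor1 eps He) as [N [HN HN']]; exists N; intros n Hn.
    eapply Rlt_trans; [apply Hx|]; eapply Rle_lt_trans; [|exact HN].
    apply Rinv_le_contravar; [now apply lt_0_INR|].
    apply le_INR in Hn; lra. }
  destruct (cs_complete y) as [b Hb].
  { intros eps He; destruct (Lx (eps / 2) ltac:(lra)) as [N HN]; exists N; intros n m Hn Hm.
    rewrite (closure_graph_isometry _ _ _ _ (Hy n) (Hy m)).
    eapply Rle_lt_trans; [apply (cs_norm_minus_trans a)|].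
    rewrite (cs_norm_minus_sym a (x m)).
    specialize (HN n Hn) as HN1; specialize (HN m Hm) as HN2; lra. }
  exists b; intros eps He.
  destruct (Lx (eps / 2) ltac:(lra)) as [N HN]; destruct (Hb (eps / 2) ltac:(lra)) as [M HM].
  specialize (HN (N + M)%nat ltac:(lia)); specialize (HM (N + M)%nat ltac:(lia)).
  destruct (Hy (N + M)%nat (eps / 2) ltac:(lra)) as [u [v [G [Hu Hv]]]].
  exists u, v; split; [assumption|].
  assert (H1 := cs_norm_minus_trans (x (N + M)%nat) a u).
  assert (H2 := cs_norm_minus_trans (y (N + M)%nat) b v).
  rewrite (cs_norm_minus_sym a (x _)) in H1; rewrite (cs_norm_minus_sym b (y _)) in H2; lra.
- repeat split.
  + exists cs_one; rewrite <- H0, <- (weyl_zero rho W2 HW2).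
    apply graph_closure, graph_weyl.
  + intros u v [u' Hu] [v' Hv]; exists (cs_plus u' v'); now apply closure_graph_plus.
  + intros z u [u' Hu]; exists (cs_scal z u'); now apply closure_graph_scal.
  + intros u v [u' Hu] [v' Hv]; exists (cs_mul u' v'); now apply closure_graph_mul.
  + intros u [u' Hu]; exists (cs_star u'); now apply closure_graph_star.
- intros x; exists (W2 x); apply graph_closure, graph_weyl.
Qed.

Lemma closure_graph_functional a b b' : closure_graph a b -> closure_graph a b' -> b = b'.
Proof.
intros H H'; apply cs_norm_minus_small_eq; intros eps He.
rewrite (closure_graph_isometry _ _ _ _ H H'), cs_minus_diag, cs_norm_zero; lra.
Qed.

Definition weyl_morphism a : B :=
  proj1_sig (constructive_indefinite_description _ (closure_graph_total a)).

Lemma weyl_morphismP a : closure_graph a (weyl_morphism a).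
Proof. exact (proj2_sig (constructive_indefinite_description _ (closure_graph_total a))). Qed.

Lemma weyl_morphism_eq a b : closure_graph a b -> weyl_morphism a = b.
Proof. intros H; exact (closure_graph_functional _ _ _ (weyl_morphismP a) H). Qed.

Lemma weyl_morphism_W x : weyl_morphism (W1 x) = W2 x.
Proof. apply weyl_morphism_eq, graph_closure, graph_weyl. Qed.

Lemma weyl_morphism_star_morphism : star_morphism A B weyl_morphism.
Proof.
repeat split; intros; try apply weyl_morphism_eq.
- apply closure_graph_plus; apply weyl_morphismP.
- apply closure_graph_scal, weyl_morphismP.
- apply closure_graph_mul; apply weyl_morphismP.
- destruct HW1 as [H0 _]; rewrite <- H0, <- (weyl_zero rho W2 HW2).
  apply graph_closure, graph_weyl.
- apply closure_graph_star, weyl_morphismP.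
Qed.

Lemma weyl_morphism_injective a a' : weyl_morphism a = weyl_morphism a' -> a = a'.
Proof.
intros H; apply cs_norm_minus_small_eq; intros eps He.
rewrite <- (closure_graph_isometry _ _ _ _ (weyl_morphismP a) (weyl_morphismP a')), H.
rewrite cs_minus_diag, cs_norm_zero; lra.
Qed.

Lemma morphism_minus (beta : A -> B) a a' : star_morphism A B beta ->
  beta (cs_minus a a') = cs_minus (beta a) (beta a').
Proof.
intros [Hp [Hs _]]; unfold minus.
transitivity (cs_plus (beta a) (beta (cs_opp a'))); [apply Hp|f_equal].
rewrite opp_scal_C; rewrite Hs; symmetry; apply opp_scal_C.
Qed.

(** Two morphisms agree on a star-subalgebra; that it is closed uses contractivity, [beta] being
    given as an algebraic morphism only. *)
Lemma weyl_morphism_unique (beta : A -> B) : star_morphism A B beta ->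
  (forall x, beta (W1 x) = W2 x) -> forall a, beta a = weyl_morphism a.
Proof.
intros Hb HbW; assert (Ha := weyl_morphism_star_morphism).
assert (Hg := HW1); destruct Hg as [_ [_ [_ Hgen]]].
apply (Hgen (fun a => beta a = weyl_morphism a)).
- apply cs_closed; intros a H; apply cs_norm_minus_small_eq; intros eps He.
  destruct (H (eps / 2) ltac:(lra)) as [u [Hu Hn]].
  eapply Rle_trans; [apply (cs_norm_minus_trans (beta u))|].
  rewrite Hu at 2; rewrite <- !morphism_minus by assumption.
  assert (H1 := morphism_contractive beta Hb (cs_minus a u)).
  assert (H2 := morphism_contractive weyl_morphism Ha (cs_minus u a)).
  rewrite cs_norm_minus_sym in Hn.
  rewrite (cs_norm_minus_sym u a) in H2; lra.
- destruct Hb as [B1 [B2 [B3 [B4 B5]]]], Ha as [A1 [A2 [A3 [A4 A5]]]].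
  repeat split; intros; rewrite ?B1, ?B2, ?B3, ?B4, ?B5, ?A1, ?A2, ?A3, ?A4, ?A5; congruence.
- intros x; now rewrite HbW, weyl_morphism_W.
Qed.

End WeylUniqueness.

(** Linearity of [T] and invariance of the forms make W'(T x) a Weyl system for [rho] in [B], to
    which the preceding construction applies. *)
Lemma symplectic_map_induces {V V' : ModuleSpace R_Ring} (rho : V -> V -> R)
  (rho' : V' -> V' -> R) (T : V -> V') (A B : CStarAlgebra) (W : V -> A) (W' : V' -> B) :
  symplectic_form rho -> symplectic_map rho rho' T ->
  weyl_algebra rho A W -> weyl_algebra rho' B W' ->
  induces_unique_injective_morphism T A B W W'.
Proof.
intros Hrho [[Tp Ts] HT] HW HW'.
assert (T0 : T vzero = vzero).
{ transitivity (T (vscal 0 vzero)).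
  - f_equal; symmetry; exact (scal_zero_r (K := R_Ring) (V := V) 0).
  - rewrite Ts by exact I; exact (scal_zero_l (K := R_Ring) (T vzero)). }
assert (To : forall x, T (vopp x) = vopp (T x)).
{ intros x; transitivity (T (vscal (opp (one : R)) x)).
  - f_equal; symmetry; exact (scal_opp_one (K := R_Ring) x).
  - rewrite Ts by exact I; exact (scal_opp_one (K := R_Ring) (T x)). }
assert (HW2 : weyl_system rho B (fun x => W' (T x))).
{ destruct HW' as [H0 [H1 [H2 _]]]; split; [now rewrite T0|]; split.
  - intros x; now rewrite To, H1.
  - intros x y; rewrite H2, HT; f_equal; f_equal; symmetry; now apply Tp. }
exists (weyl_morphism rho Hrho W (fun x => W' (T x)) HW HW2); split; [split|split].
- apply weyl_morphism_star_morphism.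
- apply weyl_morphism_W.
- apply weyl_morphism_injective.
- apply weyl_morphism_unique.
Qed.

(** * Integrals depending on a parameter *)

Ltac ring_R := match goal with |- @eq _ ?x ?y => change (@eq R x y) end; ring.

Ltac field_R := match goal with |- @eq _ ?x ?y => change (@eq R x y) end; field.

Lemma differentiable_continuous (f : R -> R) x : ex_derive f x -> continuous f x.
Proof. apply (ex_derive_continuous (K := R_AbsRing) (V := R_NormedModule)). Qed.

Lemma continuous_Rmult (f g : R -> R) x :
  continuous f x -> continuous g x -> continuous (fun x => f x * g x) x.
Proof. apply (continuous_mult (K := R_AbsRing)). Qed.

Lemma continuous_Rplus (f g : R -> R) x :
  continuous f x -> continuous g x -> continuous (fun x => f x + g x) x.
Proof. apply (continuous_plus (V := R_NormedModule)). Qed.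

Lemma continuous_Rminus (f g : R -> R) x :
  continuous f x -> continuous g x -> continuous (fun x => f x - g x) x.
Proof. apply (continuous_minus (V := R_NormedModule)). Qed.

Lemma continuity_2d_comp (f g h : R -> R -> R) x y :
  continuity_2d_pt f (g x y) (h x y) -> continuity_2d_pt g x y -> continuity_2d_pt h x y ->
  continuity_2d_pt (fun s r => f (g s r) (h s r)) x y.
Proof.
intros Hf Hg Hh eps; destruct (Hf eps) as [d Hd].
destruct (Hg d) as [d1 H1], (Hh d) as [d2 H2].
assert (Hm : 0 < Rmin d1 d2) by (apply Rmin_glb_lt; apply cond_pos).
exists (mkposreal _ Hm); simpl; intros s r Hs Hr.
assert (A := Rmin_l d1 d2); assert (B := Rmin_r d1 d2).
apply Hd; [apply H1|apply H2]; lra.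
Qed.

Lemma continuity_2d_section (f : R -> R -> R) x y :
  continuity_2d_pt f x y -> continuous (f x) y.
Proof.
intros H; apply continuity_pt_filterlim; apply continuity_pt_locally.
intros eps; destruct (H eps) as [d Hd]; exists d; intros z Hz; apply Hd; [|exact Hz].
rewrite Rminus_diag, Rabs_R0; apply cond_pos.
Qed.

Lemma continuity_2d_section_l (f : R -> R -> R) x y :
  continuity_2d_pt f x y -> continuous (fun s => f s y) x.
Proof.
intros H; apply continuity_pt_filterlim; apply continuity_pt_locally.
intros eps; destruct (H eps) as [d Hd]; exists d; intros z Hz; apply Hd; [exact Hz|].
rewrite Rminus_diag, Rabs_R0; apply cond_pos.
Qed.

Lemma continuous_2d_fst (f : R -> R) x y : continuous f x -> continuity_2d_pt (fun s _ => f s) x y.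
Proof.
intros H; apply (continuity_1d_2d_pt_comp f (fun s _ => s)).
- now apply continuity_pt_filterlim.
- apply continuity_2d_pt_id1.
Qed.

Lemma continuous_2d_snd (f : R -> R) x y : continuous f y -> continuity_2d_pt (fun _ s => f s) x y.
Proof.
intros H; apply (continuity_1d_2d_pt_comp f (fun _ s => s)).
- now apply continuity_pt_filterlim.
- apply continuity_2d_pt_id2.
Qed.

Lemma ex_RInt_cont (f : R -> R) a b : (forall x, continuous f x) -> ex_RInt f a b.
Proof. intros H; apply (ex_RInt_continuous (V := R_CompleteNormedModule)); auto. Qed.

Lemma ex_RInt_cont_le (f : R -> R) a b : a <= b ->
  (forall x, a <= x <= b -> continuous f x) -> ex_RInt f a b.
Proof.
intros Hab H; apply (ex_RInt_continuous (V := R_CompleteNormedModule)).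
intros z; rewrite Rmin_left, Rmax_right by assumption; auto.
Qed.

Lemma RInt_ext_all (f g : R -> R) a b : (forall x, f x = g x) -> RInt f a b = RInt g a b.
Proof. intros H; apply RInt_ext; auto. Qed.

Lemma RInt_zero a b : RInt (fun _ => 0) a b = 0.
Proof. rewrite RInt_const; apply Rmult_0_r. Qed.

Lemma RInt_Rplus (f g : R -> R) a b : ex_RInt f a b -> ex_RInt g a b ->
  RInt (fun x => f x + g x) a b = RInt f a b + RInt g a b.
Proof. apply (RInt_plus (V := R_CompleteNormedModule)). Qed.

Lemma RInt_Rmult_l (f : R -> R) k a b : ex_RInt f a b ->
  RInt (fun x => k * f x) a b = k * RInt f a b.
Proof. apply (RInt_scal (V := R_CompleteNormedModule)). Qed.

Lemma RInt_param_continuous (f : R -> R -> R) a b x : a <= b ->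
  (forall y, a <= y <= b -> continuity_2d_pt f x y) ->
  locally x (fun s => ex_RInt (f s) a b) ->
  continuous (fun s => RInt (f s) a b) x.
Proof.
intros Hab Hf Hex; apply continuity_pt_filterlim; apply continuity_pt_locally; intros eps.
assert (He : 0 < eps / (b - a + 1)) by (apply Rdiv_lt_0_compat; [apply cond_pos|lra]).
destruct (uniform_continuity_2d_1d' f a b x Hf (mkposreal _ He)) as [d Hd]; simpl in Hd.
destruct Hex as [d' Hd'].
assert (Hm : 0 < Rmin d d') by (apply Rmin_glb_lt; apply cond_pos).
exists (mkposreal _ Hm); intros s Hs.
assert (A := Rmin_l d d'); assert (B := Rmin_r d d').
assert (Hs' : Rabs (s - x) < Rmin d d') by exact Hs.
assert (E1 : ex_RInt (f s) a b).
{ apply Hd'; change (Rabs (s - x) < d'); lra. }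
assert (E2 : ex_RInt (f x) a b).
{ apply Hd'; change (Rabs (x - x) < d'); rewrite Rminus_diag, Rabs_R0; apply cond_pos. }
replace (RInt (f s) a b - RInt (f x) a b) with (RInt (fun y => minus (f s y) (f x y)) a b).
2:{ apply (RInt_minus (V := R_CompleteNormedModule)); assumption. }
eapply Rle_lt_trans; [apply (abs_RInt_le_const _ a b (eps / (b - a + 1)) Hab)|].
- now apply (ex_RInt_minus (V := R_NormedModule)).
- intros y Hy; apply Rlt_le.
  apply (Hd y x y s); try assumption.
  + assert (H := cond_pos d); lra.
  + apply Rabs_le_between'; lra.
  + rewrite Rminus_diag, Rabs_R0; apply cond_pos.
- replace (pos eps) with (eps / (b - a + 1) * (b - a + 1)) at 2 by (field; lra).
  rewrite Rmult_comm; apply Rmult_lt_compat_l; lra.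
Qed.

Lemma RInt_section_continuous (f : R -> R -> R) a b : a <= b ->
  (forall x y, continuity_2d_pt f x y) -> forall x, continuous (fun s => RInt (f s) a b) x.
Proof.
intros Hab Hf x; apply RInt_param_continuous; auto.
apply filter_forall; intros s; apply ex_RInt_cont; intros y; now apply continuity_2d_section.
Qed.

Lemma is_derive_RInt_upper (f : R -> R) a x : (forall y, continuous f y) ->
  is_derive (fun z => RInt f a z) x (f x).
Proof.
intros H; apply (is_derive_RInt f (fun z => RInt f a z) a x); [|apply H].
apply filter_forall; intros z; apply (RInt_correct (V := R_CompleteNormedModule)).
now apply ex_RInt_cont.
Qed.

Lemma continuity_2d_swap (f : R -> R -> R) x y :
  continuity_2d_pt f x y -> continuity_2d_pt (fun s r => f r s) y x.
Proof.
intros H; apply (continuity_2d_comp f (fun _ r => r) (fun s _ => s)); auto.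
- apply continuity_2d_pt_id2.
- apply continuity_2d_pt_id1.
Qed.

(* Both sides have the same derivative with respect to the upper bound b. *)
Lemma RInt_fubini (f : R -> R -> R) a b c d : a <= b -> c <= d ->
  (forall x y, continuity_2d_pt f x y) ->
  RInt (fun x => RInt (fun y => f x y) c d) a b = RInt (fun y => RInt (fun x => f x y) a b) c d.
Proof.
intros Hab Hcd Hf.
assert (C1 : forall x y, continuous (fun s => f s y) x)
  by (intros; now apply continuity_2d_section_l).
set (F z := RInt (fun x => RInt (fun y => f x y) c d) a z).
set (G z := RInt (fun y => RInt (fun x => f x y) a z) c d).
assert (DF : forall z, is_derive F z (RInt (fun y => f z y) c d)).
{ intros z; apply (is_derive_RInt_upper (fun x => RInt (fun y => f x y) c d)).
  intros y; now apply RInt_section_continuous. }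
assert (E : forall z y, Derive (fun u => RInt (fun x => f x y) a u) z = f z y).
{ intros z y; apply is_derive_unique, (is_derive_RInt_upper (fun x => f x y)); auto. }
assert (DG : forall z, is_derive G z (RInt (fun y => f z y) c d)).
{ intros z; unfold G.
  replace (RInt (fun y => f z y) c d)
    with (RInt (fun y => Derive (fun u => RInt (fun x => f x y) a u) z) c d)
    by (apply RInt_ext; intros; apply E).
  apply (is_derive_RInt_param (fun z y => RInt (fun x => f x y) a z)).
  - apply filter_forall; intros u t _; eexists.
    apply (is_derive_RInt_upper (fun x => f x t)); auto.
  - intros t _; apply (continuity_2d_pt_ext f); [intros; now rewrite E|apply Hf].
  - apply filter_forall; intros u; apply ex_RInt_cont.
    intros y; destruct (Rle_dec a u) as [H|H].
    + apply (RInt_section_continuous (fun y x => f x y)); [assumption|].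
      intros; apply continuity_2d_swap, Hf.
    + apply (continuous_ext (fun y => opp (RInt (fun x => f x y) u a))).
      * intros; apply (opp_RInt_swap (V := R_CompleteNormedModule)).
        apply ex_RInt_cont; auto.
      * apply (continuous_opp (V := R_NormedModule)).
        apply (RInt_section_continuous (fun y x => f x y)); [lra|].
        intros; apply continuity_2d_swap, Hf. }
assert (H := eq_is_derive (V := R_NormedModule) (fun z => minus (F z) (G z)) a b).
assert (H0 : F a = 0) by apply (RInt_point (V := R_CompleteNormedModule)).
assert (H0' : G a = 0).
{ unfold G; rewrite (RInt_ext _ (fun _ => 0)).
  - apply RInt_zero.
  - intros; apply (RInt_point (V := R_CompleteNormedModule)). }
change (F b = G b).
destruct (Req_dec a b) as [<-|Hne]; [lra|].
assert (H1 : minus (F a) (G a) = minus (F b) (G b)).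
{ apply H; [|lra]; intros t _.
  assert (DD := is_derive_minus (K := R_AbsRing) (V := R_NormedModule) F G t _ _ (DF t) (DG t)).
  replace (minus _ _) with (zero : R_NormedModule) in DD; [exact DD|].
  symmetry; apply (minus_eq_zero (G := R_AbelianGroup)). }
unfold minus, plus, opp in H1; simpl in H1; lra.
Qed.

Lemma RInt_affine (f : R -> R) u v a b : (forall x, continuous f x) ->
  RInt (fun y => u * f (u * y + v)) a b = RInt f (u * a + v) (u * b + v).
Proof.
intros H; exact (RInt_comp_lin (V := R_CompleteNormedModule) f u v a b (ex_RInt_cont _ _ _ H)).
Qed.

Lemma RInt_Chasles_cont (f : R -> R) a b c : (forall x, continuous f x) ->
  RInt f a b + RInt f b c = RInt f a c.
Proof.
intros H; exact (RInt_Chasles (V := R_CompleteNormedModule) f a b c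
  (ex_RInt_cont _ _ _ H) (ex_RInt_cont _ _ _ H)).
Qed.

Section Periodic.
Variables (p : R -> R).
Hypotheses (Hp : forall x, continuous p x) (Hper : forall x, p (x + 2 * PI) = p x).

Lemma RInt_periodic_window c : RInt p c (c + 2 * PI) = RInt p 0 (2 * PI).
Proof.
assert (E : RInt p (2 * PI) (c + 2 * PI) = RInt p 0 c).
{ transitivity (RInt (fun y => 1 * p (1 * y + 2 * PI)) 0 c).
  - rewrite (RInt_affine p 1 (2 * PI) 0 c) by assumption; f_equal; ring.
  - apply RInt_ext; intros y _; rewrite !Rmult_1_l; apply Hper. }
assert (C1 := RInt_Chasles_cont p c 0 (2 * PI) Hp).
assert (C2 := RInt_Chasles_cont p c (2 * PI) (c + 2 * PI) Hp).
assert (C3 := RInt_Chasles_cont p c 0 c Hp).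
assert (C4 : RInt p c c = 0) by apply (RInt_point (V := R_CompleteNormedModule)).
lra.
Qed.

Lemma RInt_periodic_shift c : RInt (fun x => p (c + x)) 0 (2 * PI) = RInt p 0 (2 * PI).
Proof.
transitivity (RInt (fun y => 1 * p (1 * y + c)) 0 (2 * PI)).
- apply RInt_ext; intros y _; rewrite Rmult_1_l; f_equal; ring.
- rewrite (RInt_affine p 1 c 0 (2 * PI)), <- (RInt_periodic_window c) by assumption.
  f_equal; ring.
Qed.

Lemma RInt_periodic_reflect c : RInt (fun x => p (c - x)) 0 (2 * PI) = RInt p 0 (2 * PI).
Proof.
transitivity (- RInt (fun y => (-1) * p ((-1) * y + c)) 0 (2 * PI)).
- transitivity (RInt (fun y => opp ((-1) * p ((-1) * y + c))) 0 (2 * PI)).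
  + apply RInt_ext; intros y _; unfold opp; simpl.
    replace (-1 * y + c) with (c - y) by ring; ring.
  + apply (RInt_opp (V := R_CompleteNormedModule)).
    exact (ex_RInt_comp_lin (V := R_NormedModule) p (-1) c 0 (2 * PI)
      (ex_RInt_cont _ _ _ Hp)).
- rewrite (RInt_affine p (-1) c 0 (2 * PI)) by assumption.
  rewrite <- (RInt_periodic_window (c - 2 * PI)).
  assert (C1 := RInt_Chasles_cont p (-1 * 0 + c) (-1 * (2 * PI) + c) (-1 * 0 + c) Hp).
  assert (C4 : RInt p (-1 * 0 + c) (-1 * 0 + c) = 0)
    by apply (RInt_point (V := R_CompleteNormedModule)).
  replace (c - 2 * PI) with (-1 * (2 * PI) + c) by ring.
  replace (-1 * (2 * PI) + c + 2 * PI) with (-1 * 0 + c) by ring.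
  lra.
Qed.

End Periodic.

(** The partial integrals from [a] are squeezed between 0 and the total integral 0; their derivative
    at an interior point is both [g x] and 0. *)
Lemma RInt_ge0_eq0 (g : R -> R) a b : a <= b -> (forall x, a <= x <= b -> continuous g x) ->
  (forall x, a <= x <= b -> 0 <= g x) -> RInt g a b = 0 -> forall x, a < x < b -> g x = 0.
Proof.
intros Hab Hc Hg H0 x Hx.
assert (X : forall u v, a <= u -> u <= v -> v <= b -> ex_RInt g u v).
{ intros u v H1 H2 H3; apply ex_RInt_cont_le; [assumption|]; intros; apply Hc; lra. }
assert (Z : forall z, a < z < b -> RInt g a z = 0).
{ intros z Hz.
  assert (P1 : 0 <= RInt g a z) by (apply RInt_ge_0; [lra|apply X; lra|intros; apply Hg; lra]).
  assert (P2 : 0 <= RInt g z b) by (apply RInt_ge_0; [lra|apply X; lra|intros; apply Hg; lra]).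
  assert (C := RInt_Chasles (V := R_CompleteNormedModule) g a z b
    (X a z ltac:(lra) ltac:(lra) ltac:(lra)) (X z b ltac:(lra) ltac:(lra) ltac:(lra))).
  unfold plus in C; simpl in C; lra. }
assert (L : locally x (fun z => a < z < b)).
{ apply (locally_interval _ x a b); simpl; intros; tauto. }
assert (D1 : is_derive (fun z => RInt g a z) x (g x)).
{ apply (is_derive_RInt g (fun z => RInt g a z) a x); [|apply Hc; lra].
  revert L; apply filter_imp; intros z Hz.
  apply (RInt_correct (V := R_CompleteNormedModule)), X; lra. }
assert (D2 : is_derive (fun z => RInt g a z) x 0).
{ apply (is_derive_ext_loc (fun _ => 0)); [|apply (is_derive_const (V := R_NormedModule))].
  revert L; apply filter_imp; intros z Hz; now rewrite Z. }
now rewrite <- (is_derive_unique _ _ _ D1), (is_derive_unique _ _ _ D2).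
Qed.

(** * Smooth functions *)

(** The functions x^(-k) exp(-1/x), extended by 0. The derivative of one is a combination of the
    next two, so smoothness follows by one induction with [k] left general. *)
Definition flat (k : nat) (x : R) : R := if Rlt_dec 0 x then (/ x) ^ k * exp (- / x) else 0.

Lemma flat_pos k x : 0 < x -> 0 < flat k x.
Proof.
intros Hx; unfold flat; destruct (Rlt_dec 0 x) as [_|]; [|lra].
apply Rmult_lt_0_compat; [apply pow_lt; now apply Rinv_0_lt_compat|apply exp_pos].
Qed.

Lemma flat_nonpos k x : x <= 0 -> flat k x = 0.
Proof. intros Hx; unfold flat; destruct (Rlt_dec 0 x); [lra|reflexivity]. Qed.

Lemma pow_le_exp (n : nat) (y : R) : (1 <= n)%nat -> 0 <= y -> y ^ n <= INR n ^ n * exp y.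
Proof.
intros Hn Hy; assert (Hn' : 0 < INR n) by (apply lt_0_INR; lia).
assert (H : y / INR n <= exp (y / INR n)).
{ assert (H := exp_ineq1_le (y / INR n)); lra. }
replace y with (INR n * (y / INR n)) at 1 by (field; lra).
rewrite Rpow_mult_distr; apply Rmult_le_compat_l; [apply pow_le; lra|].
replace (exp y) with (exp (y / INR n) ^ n).
- apply pow_incr; split; [|assumption]; apply Rdiv_le_0_compat; lra.
- rewrite <- Rpower_pow by apply exp_pos; unfold Rpower; rewrite ln_exp; f_equal; field; lra.
Qed.

(** The quadratic bound makes the derivative at 0 vanish; it comes from y^n <= n^n exp y with n = k
    + 2 and y = 1/x. *)
Lemma flat_quadratic k x : 0 <= flat k x <= INR (k + 2) ^ (k + 2) * x ^ 2.
Proof.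
destruct (Rlt_dec 0 x) as [Hx|Hx].
- split; [left; now apply flat_pos|].
  unfold flat; destruct (Rlt_dec 0 x) as [_|]; [|lra].
  assert (Hy : 0 < / x) by now apply Rinv_0_lt_compat.
  assert (H := pow_le_exp (k + 2) (/ x) ltac:(lia) ltac:(lra)).
  set (y := / x) in *; replace (x ^ 2) with (/ y ^ 2) by (unfold y; field; lra).
  rewrite exp_Ropp; assert (He := exp_pos y).
  assert (Hy2 : 0 < y ^ 2) by now apply pow_lt.
  apply Rmult_le_reg_r with (exp y * y ^ 2); [nra|].
  rewrite pow_add in H.
  replace (y ^ k * / exp y * (exp y * y ^ 2)) with (y ^ k * y ^ 2) by (field; lra).
  replace (INR (k + 2) ^ (k + 2) * / y ^ 2 * (exp y * y ^ 2))
    with (INR (k + 2) ^ (k + 2) * exp y) by (field; lra).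
  exact H.
- rewrite flat_nonpos by lra; split; [lra|].
  apply Rmult_le_pos; [apply pow_le, pos_INR|apply pow2_ge_0].
Qed.

Lemma flat_derive k x : is_derive (flat k) x (- INR k * flat (k + 1) x + flat (k + 2) x).
Proof.
destruct (Rtotal_order x 0) as [Hx|[->|Hx]].
- rewrite !flat_nonpos by lra.
  apply (is_derive_ext_loc (fun _ => 0)).
  + generalize (open_lt 0 x Hx); apply filter_imp; intros y Hy; now rewrite flat_nonpos by lra.
  + replace (- INR k * 0 + 0) with 0 by ring; apply (is_derive_const (V := R_NormedModule)).
- rewrite !flat_nonpos by lra; replace (- INR k * 0 + 0) with 0 by ring.
  apply is_derive_Reals; intros eps He.
  set (M := INR (k + 2) ^ (k + 2)).
  assert (HM : 0 <= M) by (apply pow_le, pos_INR).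
  assert (Hd : 0 < eps / (M + 1)) by (apply Rdiv_lt_0_compat; lra).
  exists (mkposreal _ Hd); intros h Hh0 Hh; simpl in Hh.
  rewrite Rplus_0_l, (flat_nonpos k 0) by lra.
  replace ((flat k h - 0) / h - 0) with (flat k h / h) by (field; assumption).
  destruct (flat_quadratic k h) as [H1 H2]; fold M in H2.
  unfold Rdiv; rewrite Rabs_mult, Rabs_inv, Rabs_pos_eq by assumption.
  assert (Ha : 0 < Rabs h) by now apply Rabs_pos_lt.
  apply Rmult_lt_reg_r with (Rabs h); [assumption|].
  rewrite Rmult_assoc, Rinv_l, Rmult_1_r by lra.
  apply (Rmult_lt_compat_r (M + 1)) in Hh; [|lra].
  replace (eps / (M + 1) * (M + 1)) with eps in Hh by (field; lra).
  rewrite <- (pow2_abs h) in H2; nra.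
- apply (is_derive_ext_loc (fun x => (/ x) ^ k * exp (- / x))).
  + generalize (open_gt 0 x Hx); apply filter_imp; intros y Hy.
    unfold flat; destruct (Rlt_dec 0 y); [reflexivity|lra].
  + unfold flat; destruct (Rlt_dec 0 x) as [_|]; [|lra].
    auto_derive; [lra|].
    destruct k as [|k]; [simpl; field; lra|].
    simpl pred; rewrite !pow_add; simpl; field; lra.
Qed.

Lemma flat_smooth_n n k c d : smooth_n n (fun t _ => flat k (c * t + d)).
Proof.
revert k; induction n as [|n IH]; intros k.
- intros t phi _; split; [|exact I].
  apply (continuous_2d_fst (fun t => flat k (c * t + d))).
  apply differentiable_continuous.
  auto_derive; repeat split; eexists; apply flat_derive.
- assert (D : forall t, is_derive (fun t => flat k (c * t + d)) t
    (c * (- INR k * flat (k + 1) (c * t + d) + flat (k + 2) (c * t + d)))).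
  { intros t; evar_last.
    - apply (is_derive_comp (flat k) (fun t => c * t + d)); [apply flat_derive|].
      auto_derive; [exact I|reflexivity].
    - unfold scal; simpl; unfold mult; simpl; ring. }
  apply smooth_n_step.
  + intros t phi _; apply (continuous_2d_fst (fun t => flat k (c * t + d))).
    apply differentiable_continuous; eexists; apply D.
  + intros t phi _; eexists; apply D.
  + intros; apply ex_derive_const.
  + apply (smooth_n_ext n (fun t _ =>
      c * (- INR k * flat (k + 1) (c * t + d) + flat (k + 2) (c * t + d)))).
    * intros; symmetry; apply is_derive_unique, D.
    * apply smooth_n_mult; [apply smooth_n_const|].
      apply smooth_n_plus; [|apply IH].
      apply smooth_n_mult; [apply smooth_n_const|apply IH].
  + apply (smooth_n_ext n (fun _ _ => 0)); [|apply smooth_n_const].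
    intros; symmetry; unfold pd; apply Derive_const.
Qed.

Definition bump (a b : R) (t : R) : R := flat 0 (1 * t + - a) * flat 0 ((-1) * t + b).

Lemma bump_smooth a b : smooth (fun t _ => bump a b t).
Proof. intros n; apply smooth_n_mult; apply flat_smooth_n. Qed.

Lemma bump_pos a b t : a < t < b -> 0 < bump a b t.
Proof. intros H; apply Rmult_lt_0_compat; apply flat_pos; lra. Qed.

Lemma bump_ge0 a b t : 0 <= bump a b t.
Proof. apply Rmult_le_pos; apply flat_quadratic. Qed.

Lemma bump_tsupp a b : tsupp a b (fun t _ => bump a b t).
Proof.
intros t _ [H|H]; unfold bump.
- rewrite (flat_nonpos 0 (1 * t + - a)) by lra; ring.
- rewrite (flat_nonpos 0 (-1 * t + b)) by lra; ring.
Qed.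

Lemma smooth_n_inv_comp n u : (forall t phi, 0 < t -> u t phi <> 0) ->
  smooth_n n u -> smooth_n n (fun t phi => / u t phi).
Proof.
intros H0; induction n as [|n IH]; intros Hu.
- intros t phi Ht; split; [|exact I]; apply continuity_2d_pt_inv; [now apply Hu|now apply H0].
- assert (Hi := IH (smooth_n_S n u Hu)).
  assert (C := fun t phi (Ht : 0 < t) => smooth_n_cont _ _ t phi Hu Ht).
  assert (DT := fun t phi (Ht : 0 < t) => smooth_n_ex_T n u t phi Hu Ht).
  assert (DA := fun t phi (Ht : 0 < t) => smooth_n_ex_A n u t phi Hu Ht).
  apply smooth_n_step.
  + intros t phi Ht; apply continuity_2d_pt_inv; auto.
  + intros t phi Ht; apply (ex_derive_inv (fun s => u s phi)); auto.
  + intros t phi Ht; apply (ex_derive_inv (u t)); auto.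
  + apply (smooth_n_ext n (fun t phi => (-1) * pd Time u t phi * (/ u t phi * / u t phi))).
    * intros t phi Ht; unfold pd; rewrite Derive_inv by auto; cbv beta; field; auto.
    * apply smooth_n_mult; [apply smooth_n_mult|apply smooth_n_mult]; auto using smooth_n_const.
      now apply smooth_n_pd.
  + apply (smooth_n_ext n (fun t phi => (-1) * pd Angle u t phi * (/ u t phi * / u t phi))).
    * intros t phi Ht; unfold pd; rewrite Derive_inv by auto; change (fun s : R => u t s) with (u t); field; auto.
    * apply smooth_n_mult; [apply smooth_n_mult|apply smooth_n_mult]; auto using smooth_n_const.
      now apply smooth_n_pd.
Qed.

Lemma smooth_n_trig n : smooth_n n (fun _ phi => cos phi) /\ smooth_n n (fun _ phi => sin phi).
Proof.
assert (Cc : forall t phi, continuity_2d_pt (fun _ phi => cos phi) t phi).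
{ intros; apply (continuous_2d_snd cos), continuous_cos. }
assert (Cs : forall t phi, continuity_2d_pt (fun _ phi => sin phi) t phi).
{ intros; apply (continuous_2d_snd sin), continuous_sin. }
induction n as [|n [IH1 IH2]].
- split; intros t phi _; split; try exact I; [apply Cc|apply Cs].
- assert (Z : forall w : R -> R, smooth_n n (pd Time (fun _ phi => w phi))).
  { intros w; apply (smooth_n_ext n (fun _ _ => 0)); [|apply smooth_n_const].
    intros; symmetry; unfold pd; apply Derive_const. }
  split; apply smooth_n_step.
  + intros t phi _; apply Cc.
  + intros; apply ex_derive_const.
  + intros; auto_derive; exact I.
  + apply Z.
  + apply (smooth_n_ext n (fun _ phi => (-1) * sin phi)).
    * intros; symmetry; apply is_derive_unique; auto_derive; [exact I|ring].
    * apply smooth_n_mult; [apply smooth_n_const|exact IH2].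
  + intros t phi _; apply Cs.
  + intros; apply ex_derive_const.
  + intros; auto_derive; exact I.
  + apply Z.
  + apply (smooth_n_ext n (fun _ phi => cos phi)); [|exact IH1].
    intros; symmetry; apply is_derive_unique; auto_derive; [exact I|ring].
Qed.

(** * Convolution on the circle *)

Section MTest.
Variables (a : nat -> R -> R) (m : nat -> R).
Hypotheses (Hm : ex_series m).

Lemma ex_series_dominated x : (forall j, Rabs (a j x) <= m j) -> ex_series (fun j => a j x).
Proof. intros H; now apply (ex_series_le (K := R_AbsRing) (V := R_CompleteNormedModule) _ m). Qed.

Lemma series_tail x n : (forall j, Rabs (a j x) <= m j) ->
  Rabs (Series (fun j => a j x) - sum_n (fun j => a j x) n) <= Series m - sum_n m n.
Proof.
intros H; assert (Ha := ex_series_dominated x H).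
rewrite (Series_incr_n (fun j => a j x) (S n)), (Series_incr_n m (S n)) by (auto; lia).
rewrite !sum_n_Reals; simpl pred.
replace (_ + _ - _) with (Series (fun k => a (S n + k)%nat x)) by ring.
replace (_ + _ - _) with (Series (fun k => m (S n + k)%nat)) by ring.
assert (Hm' : ex_series (fun k => m (S n + k)%nat)) by now apply ex_series_incr_n.
eapply Rle_trans; [apply Series_Rabs|apply Series_le; auto].
- apply (ex_series_le (K := R_AbsRing) (V := R_CompleteNormedModule) _ (fun k => m (S n + k)%nat));
    [|assumption].
  intros k; unfold norm; simpl; unfold abs; simpl; rewrite Rabs_Rabsolu; apply H.
- intros k; split; [apply Rabs_pos|apply H].
Qed.

Lemma series_tail_small eps : 0 < eps ->
  exists N, forall n, (N <= n)%nat -> Series m - sum_n m n < eps.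
Proof.
intros He; assert (H := Series_correct m Hm).
destruct (proj2 (is_lim_seq_spec (sum_n m) (Series m)) H (mkposreal eps He)) as [N HN].
exists N; intros n Hn; specialize (HN n Hn); simpl in HN; apply Rabs_def2 in HN; lra.
Qed.

Lemma sum_n_continuous n x : (forall j, continuous (a j) x) ->
  continuous (fun y => sum_n (fun j => a j y) n) x.
Proof.
intros H; induction n as [|n IH].
- apply (continuous_ext (a 0%nat)); [|apply H]; intros y; now rewrite sum_O.
- apply (continuous_ext (fun y => plus (sum_n (fun j => a j y) n) (a (S n) y))).
  + intros y; now rewrite sum_Sn.
  + now apply continuous_Rplus.
Qed.

Lemma series_continuous x : (forall j y, Rabs (a j y) <= m j) ->
  (forall j, continuous (a j) x) -> continuous (fun y => Series (fun j => a j y)) x.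
Proof.
intros Hb Hc; apply continuity_pt_filterlim, continuity_pt_locally; intros eps.
destruct (series_tail_small (eps / 3)) as [N HN]; [assert (H := cond_pos eps); lra|].
specialize (HN N (Nat.le_refl _)).
assert (He : 0 < eps / 3) by (assert (H := cond_pos eps); lra).
assert (C := proj2 (continuity_pt_filterlim _ _) (sum_n_continuous N x Hc)).
generalize (proj1 (continuity_pt_locally (fun y => sum_n (fun j => a j y) N : R) x) C
  (mkposreal _ He)); apply filter_imp.
simpl; intros y Hy; apply Rabs_def2 in Hy.
assert (T1 := series_tail x N (fun j => Hb j x)); assert (T2 := series_tail y N (fun j => Hb j y)).
apply Rabs_le_between in T1; apply Rabs_le_between in T2; apply Rabs_def1; lra.
Qed.

Lemma RInt_sum_n c d n : (forall j, ex_RInt (a j) c d) ->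
  ex_RInt (fun x => sum_n (fun j => a j x) n) c d /\
  sum_n (fun j => RInt (a j) c d) n = RInt (fun x => sum_n (fun j => a j x) n) c d.
Proof.
intros Hi; induction n as [|n [IH1 IH2]].
- split.
  + apply (ex_RInt_ext (a 0%nat)); [|apply Hi]; intros; now rewrite sum_O.
  + rewrite sum_O; apply RInt_ext; intros; now rewrite sum_O.
- split.
  + apply (ex_RInt_ext (fun x => plus (sum_n (fun j => a j x) n) (a (S n) x))).
    * intros; now rewrite sum_Sn.
    * now apply (ex_RInt_plus (V := R_NormedModule)).
  + rewrite sum_Sn, IH2; symmetry.
    rewrite (RInt_ext _ (fun x => plus (sum_n (fun j => a j x) n) (a (S n) x)))
      by (intros; now rewrite sum_Sn).
    now apply (RInt_plus (V := R_CompleteNormedModule)).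
Qed.

Lemma series_RInt c d : c <= d -> (forall j, ex_RInt (a j) c d) ->
  ex_RInt (fun x => Series (fun j => a j x)) c d ->
  (forall j x, c <= x <= d -> Rabs (a j x) <= m j) ->
  is_series (fun j => RInt (a j) c d) (RInt (fun x => Series (fun j => a j x)) c d).
Proof.
intros Hcd Hi HS Hb.
change (is_lim_seq (sum_n (fun j => RInt (a j) c d)) (RInt (fun x => Series (fun j => a j x)) c d)).
apply is_lim_seq_spec; intros eps.
destruct (series_tail_small (eps / (d - c + 1))) as [N HN].
{ apply Rdiv_lt_0_compat; [apply cond_pos|lra]. }
exists N; intros n Hn; specialize (HN n Hn).
destruct (RInt_sum_n c d n Hi) as [X ->].
rewrite Rabs_minus_sym.
replace (_ - _) with (RInt (fun x => minus (Series (fun j => a j x)) (sum_n (fun j => a j x) n)) c d)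
  by now apply (RInt_minus (V := R_CompleteNormedModule)).
eapply Rle_lt_trans; [apply (abs_RInt_le_const _ c d (Series m - sum_n m n) Hcd)|].
- now apply (ex_RInt_minus (V := R_NormedModule)).
- intros x Hx; apply series_tail; intros j; now apply Hb.
- assert (He := cond_pos eps).
  apply Rle_lt_trans with ((d - c) * (eps / (d - c + 1))).
  + apply Rmult_le_compat_l; lra.
  + replace (pos eps) with ((d - c + 1) * (eps / (d - c + 1))) at 2 by (field; lra).
    apply Rmult_lt_compat_r; [apply Rdiv_lt_0_compat; lra|lra].
Qed.

End MTest.

Lemma is_series_delta (n : nat) (x : R) :
  is_series (fun j => if Nat.eq_dec j n then x else 0) x.
Proof.
assert (H : forall N, sum_n (fun j => if Nat.eq_dec j n then x else 0) N
  = if le_dec n N then x else 0).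
{ induction N as [|N IH].
  - rewrite sum_O; destruct (Nat.eq_dec 0 n), (le_dec n 0); try lia; reflexivity.
  - rewrite sum_Sn, IH.
    destruct (Nat.eq_dec (S N) n), (le_dec n N), (le_dec n (S N)); try lia; [exact (Rplus_0_l x)|exact (Rplus_0_r x)|exact (Rplus_0_l 0)]. }
change (is_lim_seq (sum_n (fun j => if Nat.eq_dec j n then x else 0)) x).
apply is_lim_seq_spec; intros eps; exists n; intros N HN; rewrite H.
destruct (le_dec n N); [|lia]; rewrite Rminus_diag, Rabs_R0; apply cond_pos.
Qed.

Lemma continuous_bounded (f : R -> R) a b : a <= b -> (forall x, continuous f x) ->
  exists M, 0 <= M /\ forall x, a <= x <= b -> Rabs (f x) <= M.
Proof.
intros Hab Hf; destruct (continuity_ab_maj (fun x => Rabs (f x)) a b Hab) as [x0 [H _]].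
- intros c _; apply continuity_pt_filterlim; apply (continuous_comp f Rabs); [apply Hf|].
  apply continuous_Rabs.
- exists (Rabs (f x0)); split; [apply Rabs_pos|assumption].
Qed.

Lemma two_PI_pos : 0 < 2 * PI.
Proof. assert (H := PI_RGT_0); lra. Qed.

Section Convolution.
Variable k : R -> R.
Hypotheses (Hk : forall x, continuous k x) (Hkper : forall x, k (x + 2 * PI) = k x)
  (Hkeven : forall x, k (- x) = k x).

(** The shift falls on [u], so that derivatives pass to [u] while [k] is merely continuous;
    [conv_alt] moves the shift to [k], as symmetry and the series of the kernel require. *)
Definition conv (u : R -> R) (phi : R) : R := RInt (fun th => k th * u (phi - th)) 0 (2 * PI).

Lemma continuous_reflect (u : R -> R) phi th :
  (forall x, continuous u x) -> continuous (fun th => u (phi - th)) th.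
Proof.
intros H; apply (continuous_comp (fun th => phi - th) u); [|apply H].
apply differentiable_continuous; auto_derive; exact I.
Qed.

Lemma conv_integrand_continuous (u : R -> R) phi th :
  (forall x, continuous u x) -> continuous (fun th => k th * u (phi - th)) th.
Proof.
intros H; apply continuous_Rmult; [apply Hk|now apply continuous_reflect].
Qed.

Lemma conv_alt u phi : (forall x, continuous u x) -> (forall x, u (x + 2 * PI) = u x) ->
  conv u phi = RInt (fun psi => k (phi - psi) * u psi) 0 (2 * PI).
Proof.
intros Hu Hper; unfold conv.
rewrite <- (RInt_periodic_reflect (fun th => k th * u (phi - th))) with (c := phi).
- apply RInt_ext; intros x _; do 2 f_equal; ring.
- intros; now apply conv_integrand_continuous.
- intros x; rewrite Hkper; f_equal.
  rewrite <- (Hper (phi - (x + 2 * PI))); f_equal; ring.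
Qed.

Lemma conv_continuous u phi : (forall x, continuous u x) -> continuous (conv u) phi.
Proof.
intros Hu; apply (RInt_section_continuous (fun phi th => k th * u (phi - th)));
  [assert (H := two_PI_pos); lra|].
intros x y; apply continuity_2d_pt_mult; [now apply (continuous_2d_snd k)|].
apply (continuity_1d_2d_pt_comp u (fun x y => x - y)).
- apply continuity_pt_filterlim, Hu.
- apply continuity_2d_pt_minus; [apply continuity_2d_pt_id1|apply continuity_2d_pt_id2].
Qed.

(** Exchanging the integrals puts the kernel at x - y on one side and at y - x on the other;
    evenness identifies them. *)
Lemma conv_symmetric u v : (forall x, continuous u x) -> (forall x, u (x + 2 * PI) = u x) ->
  (forall x, continuous v x) -> (forall x, v (x + 2 * PI) = v x) ->
  RInt (fun x => v x * conv u x) 0 (2 * PI) = RInt (fun x => conv v x * u x) 0 (2 * PI).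
Proof.
intros Hu Pu Hv Pv; assert (HP := two_PI_pos).
assert (X : forall (g h : R -> R) c, (forall x, continuous g x) -> (forall x, continuous h x) ->
  ex_RInt (fun y => g (c - y) * h y) 0 (2 * PI)).
{ intros g h c Hg Hh; apply ex_RInt_cont; intros y.
  apply continuous_Rmult; [now apply continuous_reflect|apply Hh]. }
transitivity (RInt (fun x => RInt (fun y => v x * k (x - y) * u y) 0 (2 * PI)) 0 (2 * PI)).
- apply RInt_ext; intros x _; rewrite conv_alt by assumption.
  rewrite <- RInt_Rmult_l by now apply X.
  apply RInt_ext_all; intros y; ring.
- rewrite RInt_fubini; try lra.
  + apply RInt_ext; intros y _; rewrite conv_alt by assumption.
    rewrite (Rmult_comm (RInt _ _ _)), <- RInt_Rmult_l by now apply X.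
    apply RInt_ext_all; intros x; rewrite <- (Hkeven (x - y)).
    replace (- (x - y)) with (y - x) by ring; ring.
  + intros x y; apply continuity_2d_pt_mult; [apply continuity_2d_pt_mult|].
    * now apply continuous_2d_fst.
    * apply (continuity_1d_2d_pt_comp k (fun x y => x - y)).
      -- apply continuity_pt_filterlim, Hk.
      -- apply continuity_2d_pt_minus; [apply continuity_2d_pt_id1|apply continuity_2d_pt_id2].
    * now apply continuous_2d_snd.
Qed.

Lemma RInt_odd_sin n : RInt (fun th => k th * sin (INR n * th)) 0 (2 * PI) = 0.
Proof.
set (p th := k th * sin (INR n * th)).
assert (Hp : forall x, continuous p x).
{ intros x; apply continuous_Rmult; [apply Hk|].
  apply differentiable_continuous; auto_derive; exact I. }
assert (E := RInt_periodic_reflect p Hp).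
assert (Hper : forall x, p (x + 2 * PI) = p x).
{ intros x; unfold p; rewrite Hkper.
  replace (INR n * (x + 2 * PI)) with (INR n * x + 2 * INR n * PI) by ring.
  now rewrite sin_period. }
specialize (E Hper 0).
assert (E2 : RInt (fun x => p (0 - x)) 0 (2 * PI) = - RInt p 0 (2 * PI)).
{ transitivity (RInt (fun x => opp (p x)) 0 (2 * PI)).
  - apply RInt_ext; intros x _; unfold p, opp; simpl.
    replace (0 - x) with (- x) by ring; rewrite Hkeven.
    replace (INR n * - x) with (- (INR n * x)) by ring; rewrite sin_neg; ring.
  - apply (RInt_opp (V := R_CompleteNormedModule)); now apply ex_RInt_cont. }
change (RInt p 0 (2 * PI) = 0); lra.
Qed.

Lemma conv_cos_sin n phi :
  conv (fun x => cos (INR n * x)) phi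
    = RInt (fun th => k th * cos (INR n * th)) 0 (2 * PI) * cos (INR n * phi) /\
  conv (fun x => sin (INR n * x)) phi
    = RInt (fun th => k th * cos (INR n * th)) 0 (2 * PI) * sin (INR n * phi).
Proof.
assert (Xc : ex_RInt (fun th => k th * cos (INR n * th)) 0 (2 * PI)).
{ apply ex_RInt_cont; intros x; apply continuous_Rmult; [apply Hk|].
  apply differentiable_continuous; auto_derive; exact I. }
assert (Xs : ex_RInt (fun th => k th * sin (INR n * th)) 0 (2 * PI)).
{ apply ex_RInt_cont; intros x; apply continuous_Rmult; [apply Hk|].
  apply differentiable_continuous; auto_derive; exact I. }
assert (L : forall a b, RInt (fun th => a * (k th * cos (INR n * th))
    + b * (k th * sin (INR n * th))) 0 (2 * PI)
  = a * RInt (fun th => k th * cos (INR n * th)) 0 (2 * PI)).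
{ intros a b; rewrite RInt_Rplus by now apply (ex_RInt_scal (V := R_NormedModule)).
  rewrite !RInt_Rmult_l, RInt_odd_sin by assumption; ring_R. }
split; rewrite Rmult_comm.
- rewrite <- (L _ (sin (INR n * phi))); apply RInt_ext_all; intros th.
  rewrite Rmult_minus_distr_l, cos_minus; ring.
- rewrite <- (L _ (- cos (INR n * phi))); apply RInt_ext_all; intros th.
  rewrite Rmult_minus_distr_l, sin_minus; ring.
Qed.

End Convolution.

(** * Uniqueness of Fourier coefficients *)

Lemma continuous_cos_n n x : continuous (fun x => cos (INR n * x)) x.
Proof.
apply differentiable_continuous; auto_derive; exact I.
Qed.

Lemma continuous_sin_n n x : continuous (fun x => sin (INR n * x)) x.
Proof.
apply differentiable_continuous; auto_derive; exact I.
Qed.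

Lemma cos_n_periodic n x : cos (INR n * (x + 2 * PI)) = cos (INR n * x).
Proof.
replace (INR n * (x + 2 * PI)) with (INR n * x + 2 * INR n * PI) by ring; apply cos_period.
Qed.

Lemma sin_n_periodic n x : sin (INR n * (x + 2 * PI)) = sin (INR n * x).
Proof.
replace (INR n * (x + 2 * PI)) with (INR n * x + 2 * INR n * PI) by ring; apply sin_period.
Qed.

Lemma RInt_lincomb (a b : R) (f g : R -> R) c d :
  (forall x, continuous f x) -> (forall x, continuous g x) ->
  RInt (fun x => a * f x + b * g x) c d = a * RInt f c d + b * RInt g c d.
Proof.
intros Hf Hg; rewrite RInt_Rplus, !RInt_Rmult_l; auto using ex_RInt_cont.
- apply ex_RInt_cont; intros; apply continuous_Rmult; auto using continuous_const.
- apply ex_RInt_cont; intros; apply continuous_Rmult; auto using continuous_const.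
Qed.

Lemma RInt_ge_const (f : R -> R) a b m : a <= b -> (forall x, continuous f x) ->
  (forall x, a < x < b -> m <= f x) -> m * (b - a) <= RInt f a b.
Proof.
intros Hab Hf Hm.
replace (m * (b - a)) with (RInt (fun _ => m) a b).
- apply RInt_le; auto; [apply ex_RInt_const|now apply ex_RInt_cont].
- rewrite RInt_const; unfold scal; simpl; unfold mult; simpl; ring.
Qed.

Definition fourier_null (g : R -> R) : Prop :=
  (forall x, continuous g x) /\ (forall x, g (x + 2 * PI) = g x) /\
  forall n, RInt (fun x => g x * cos (INR n * x)) 0 (2 * PI) = 0 /\
            RInt (fun x => g x * sin (INR n * x)) 0 (2 * PI) = 0.

Lemma fourier_null_lincomb a b f g : fourier_null f -> fourier_null g ->
  fourier_null (fun x => a * f x + b * g x).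
Proof.
intros [F1 [F2 F3]] [G1 [G2 G3]]; split; [|split].
- intros x; apply continuous_Rplus;
    apply continuous_Rmult; auto; apply continuous_const.
- intros x; now rewrite F2, G2.
- intros n; destruct (F3 n) as [A1 A2], (G3 n) as [B1 B2]; split.
  + rewrite (RInt_ext_all _ (fun x => a * (f x * cos (INR n * x)) + b * (g x * cos (INR n * x))))
      by (intros; ring).
    rewrite RInt_lincomb, A1, B1; [ring_R| |]; intros x;
      apply continuous_Rmult; auto; apply continuous_cos_n.
  + rewrite (RInt_ext_all _ (fun x => a * (f x * sin (INR n * x)) + b * (g x * sin (INR n * x))))
      by (intros; ring).
    rewrite RInt_lincomb, A2, B2; [ring_R| |]; intros x;
      apply continuous_Rmult; auto; apply continuous_sin_n.
Qed.

(** Product-to-sum formulas express the coefficients of cos x g(x) at n + 1 by those of g at n and n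
    + 2. By iteration, g multiplied by any polynomial in cos x keeps vanishing coefficients. *)
Lemma fourier_null_cos g : fourier_null g -> fourier_null (fun x => cos x * g x).
Proof.
intros [G1 [G2 G3]]; split; [|split].
- intros x; apply continuous_Rmult; [apply continuous_cos|apply G1].
- intros x; rewrite G2; f_equal; replace (x + 2 * PI) with (x + 2 * INR 1 * PI) by (simpl; ring).
  apply cos_period.
- assert (Cc : forall m x, continuous (fun x => g x * cos (INR m * x)) x).
  { intros m x; apply continuous_Rmult; [apply G1|apply continuous_cos_n]. }
  assert (Cs : forall m x, continuous (fun x => g x * sin (INR m * x)) x).
  { intros m x; apply continuous_Rmult; [apply G1|apply continuous_sin_n]. }
  intros n; destruct n as [|n].
  + split.
    * rewrite (RInt_ext_all _ (fun x => g x * cos (INR 1 * x))); [exact (proj1 (G3 1%nat))|].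
      intros; simpl; rewrite Rmult_0_l, cos_0, Rmult_1_l; ring.
    * rewrite (RInt_ext_all _ (fun x => g x * sin (INR 0 * x))); [exact (proj2 (G3 0%nat))|].
      intros; simpl; rewrite Rmult_0_l, sin_0; ring.
  + destruct (G3 n) as [A1 A2], (G3 (S (S n))) as [B1 B2]; split.
    * rewrite (RInt_ext_all _ (fun x =>
        /2 * (g x * cos (INR n * x)) + /2 * (g x * cos (INR (S (S n)) * x)))).
      { rewrite RInt_lincomb, A1, B1 by auto; ring_R. }
      intros x; rewrite !S_INR.
      replace (INR n * x) with ((INR n + 1) * x - x) by ring.
      replace ((INR n + 1 + 1) * x) with ((INR n + 1) * x + x) by ring.
      rewrite cos_minus, cos_plus; field.
    * rewrite (RInt_ext_all _ (fun x =>
        /2 * (g x * sin (INR n * x)) + /2 * (g x * sin (INR (S (S n)) * x)))).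
      { rewrite RInt_lincomb, A2, B2 by auto; ring_R. }
      intros x; rewrite !S_INR.
      replace (INR n * x) with ((INR n + 1) * x - x) by ring.
      replace ((INR n + 1 + 1) * x) with ((INR n + 1) * x + x) by ring.
      rewrite sin_minus, sin_plus; field.
Qed.

Lemma fourier_null_shift g c : fourier_null g -> fourier_null (fun x => g (c + x)).
Proof.
intros [G1 [G2 G3]].
assert (Cs : forall h : R -> R, (forall x, continuous h x) -> forall x,
  continuous (fun x => h (c + x)) x).
{ intros h Hh x; apply (continuous_comp (fun x => c + x) h); [|apply Hh].
  apply differentiable_continuous; auto_derive; exact I. }
split; [|split].
- now apply Cs.
- intros x; rewrite <- (G2 (c + x)); f_equal; ring.
- intros n; destruct (G3 n) as [A1 A2].
  assert (Xc : forall x, continuous (fun x => g x * cos (INR n * x)) x).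
  { intros x; apply continuous_Rmult; [apply G1|apply continuous_cos_n]. }
  assert (Xs : forall x, continuous (fun x => g x * sin (INR n * x)) x).
  { intros x; apply continuous_Rmult; [apply G1|apply continuous_sin_n]. }
  assert (P : forall a b, RInt (fun x => a * (g (c + x) * cos (INR n * (c + x)))
      + b * (g (c + x) * sin (INR n * (c + x)))) 0 (2 * PI) = 0).
  { intros a b.
    rewrite (RInt_periodic_shift (fun y => a * (g y * cos (INR n * y)) + b * (g y * sin (INR n * y)))).
    - rewrite RInt_lincomb, A1, A2 by auto; ring_R.
    - intros x; apply continuous_Rplus;
        apply continuous_Rmult; auto; apply continuous_const.
    - intros x; now rewrite G2, cos_n_periodic, sin_n_periodic. }
  split.
  + etransitivity; [|exact (P (cos (INR n * c)) (sin (INR n * c)))]; apply RInt_ext_all; intros x.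
    replace (INR n * x) with (INR n * (c + x) - INR n * c) by ring; rewrite cos_minus; ring.
  + etransitivity; [|exact (P (- sin (INR n * c)) (cos (INR n * c)))]; apply RInt_ext_all; intros x.
    replace (INR n * x) with (INR n * (c + x) - INR n * c) by ring; rewrite sin_minus; ring.
Qed.

(* The powers of 1 + cos x - cos d concentrate at 0: the base exceeds 1 for |x| < d and
   has modulus at most 1 for d <= |x| <= pi. *)
Lemma fourier_null_not_pos g : fourier_null g -> g 0 <= 0.
Proof.
intros Hg; apply Rnot_lt_le; intros H0.
assert (Hg' := Hg); destruct Hg' as [Gc [Gp _]].
assert (HPI := PI_RGT_0).
assert (Hd : exists d, 0 < d < PI / 2 /\ forall x, Rabs x <= d -> g 0 / 2 <= g x).
{ assert (C := proj2 (continuity_pt_filterlim _ _) (Gc 0)).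
  assert (He : 0 < g 0 / 2) by lra.
  destruct (proj1 (continuity_pt_locally g 0) C (mkposreal _ He)) as [e He'].
  exists (Rmin (e / 2) (PI / 4)); assert (A := Rmin_l (e / 2) (PI / 4)).
  assert (B := Rmin_r (e / 2) (PI / 4)); assert (Ee := cond_pos e).
  assert (0 < Rmin (e / 2) (PI / 4)) by (apply Rmin_glb_lt; lra).
  split; [lra|]; intros x Hx.
  assert (Hb : ball 0 e x) by (change (Rabs (x - 0) < e); rewrite Rminus_0_r; lra).
  specialize (He' x Hb); simpl in He'; apply Rabs_def2 in He'; lra. }
destruct Hd as [d [Hd Hgd]].
set (T x := 1 + cos x - cos d).
assert (Cabs : forall x, cos x = cos (Rabs x)).
{ intros x; unfold Rabs; destruct (Rcase_abs x); [now rewrite cos_neg|reflexivity]. }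
assert (Hcd : 0 <= cos d) by (apply cos_ge_0; lra).
(* On |x| <= d / 2 the base is at least 1 + eta, a gap above 1 that is lost at |x| = d. *)
set (eta := cos (d / 2) - cos d).
assert (Heta : 0 < eta) by (assert (H := cos_decreasing_1 (d / 2) d); unfold eta; lra).
assert (T1 : forall x, Rabs x <= d -> 1 <= T x).
{ intros x Hx; unfold T; rewrite Cabs.
  assert (H := cos_decr_1 (Rabs x) d); assert (Hp := Rabs_pos x); lra. }
assert (T2 : forall x, Rabs x <= d / 2 -> 1 + eta <= T x).
{ intros x Hx; unfold T, eta; rewrite (Cabs x).
  assert (H := cos_decr_1 (Rabs x) (d / 2)); assert (Hp := Rabs_pos x); lra. }
assert (T3 : forall x, d <= Rabs x <= PI -> Rabs (T x) <= 1).
{ intros x Hx; unfold T; rewrite (Cabs x).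
  assert (H := cos_decr_1 d (Rabs x)); assert (Hb := COS_bound (Rabs x)).
  assert (Hb' := COS_bound d); apply Rabs_le; lra. }
assert (N : forall j, fourier_null (fun x => T x ^ j * g x)).
{ induction j as [|j IH].
  - assert (H := fourier_null_lincomb 1 0 g g Hg Hg).
    replace (fun x => T x ^ 0 * g x) with (fun x => 1 * g x + 0 * g x); [assumption|].
    apply functional_extensionality; intros x; simpl; ring.
  - assert (H := fourier_null_lincomb (1 - cos d) 1 _ _ IH (fourier_null_cos _ IH)).
    replace (fun x => T x ^ S j * g x)
      with (fun x => (1 - cos d) * (T x ^ j * g x) + 1 * (cos x * (T x ^ j * g x))); [assumption|].
    apply functional_extensionality; intros x; simpl; unfold T; ring. }
destruct (continuous_bounded g (- PI) PI ltac:(lra) Gc) as [M [HM Hgm]].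
(* The integral of T^j g over a period vanishes. The middle interval of length d contributes at
   least the left side, the far part at least -2 pi M and the rest is nonnegative. Bernoulli's
   inequality then contradicts this bound for large j. *)
assert (B : forall j, g 0 / 2 * (1 + eta) ^ j * d <= 2 * PI * M).
{ intros j; destruct (N j) as [Nc [Np N0]].
  set (f x := T x ^ j * g x) in *.
  assert (I0 : RInt f (- PI) PI = 0).
  { destruct (N0 0%nat) as [I1 _].
    assert (I2 := RInt_periodic_window f Nc Np (- PI)).
    replace (- PI + 2 * PI) with PI in I2 by ring; rewrite I2; etransitivity; [|exact I1].
    apply RInt_ext_all; intros x; change (INR 0) with 0; rewrite Rmult_0_l, cos_0, Rmult_1_r; reflexivity. }
  assert (Far : forall x, d <= Rabs x <= PI -> - M <= f x).
  { intros x Hx; specialize (T3 x Hx).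
    assert (Hx' : - PI <= x <= PI) by (destruct Hx as [_ Hx]; apply Rabs_le_between in Hx; lra).
    specialize (Hgm x Hx').
    assert (H : Rabs (f x) <= M).
    { unfold f; rewrite Rabs_mult, <- RPow_abs.
      assert (H1 : Rabs (T x) ^ j <= 1).
      { rewrite <- (pow1 j); apply pow_incr; split; [apply Rabs_pos|assumption]. }
      assert (H2 := pow_le (Rabs (T x)) j (Rabs_pos _)); assert (H3 := Rabs_pos (g x)); nra. }
    apply Rabs_le_between in H; lra. }
  assert (Near : forall x, Rabs x <= d -> 0 <= f x).
  { intros x Hx; specialize (T1 x Hx); specialize (Hgd x Hx).
    apply Rmult_le_pos; [apply pow_le|]; lra. }
  assert (Mid : forall x, Rabs x <= d / 2 -> g 0 / 2 * (1 + eta) ^ j <= f x).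
  { intros x Hx; specialize (T2 x Hx); specialize (Hgd x ltac:(lra)).
    unfold f; rewrite Rmult_comm; apply Rmult_le_compat; try lra; [apply pow_le; lra|].
    apply pow_incr; lra. }
  assert (L1 := RInt_ge_const f (- PI) (- d) (- M) ltac:(lra) Nc).
  assert (L2 := RInt_ge_const f (- d) (- (d / 2)) 0 ltac:(lra) Nc).
  assert (L3 := RInt_ge_const f (- (d / 2)) (d / 2) (g 0 / 2 * (1 + eta) ^ j) ltac:(lra) Nc).
  assert (L4 := RInt_ge_const f (d / 2) d 0 ltac:(lra) Nc).
  assert (L5 := RInt_ge_const f d PI (- M) ltac:(lra) Nc).
  assert (C1 := RInt_Chasles_cont f (- PI) (- d) (- (d / 2)) Nc).
  assert (C2 := RInt_Chasles_cont f (- PI) (- (d / 2)) (d / 2) Nc).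
  assert (C3 := RInt_Chasles_cont f (- PI) (d / 2) d Nc).
  assert (C4 := RInt_Chasles_cont f (- PI) d PI Nc).
  specialize (L1 ltac:(intros x Hx; apply Far; rewrite Rabs_left by lra; lra)).
  specialize (L2 ltac:(intros x Hx; apply Near; rewrite Rabs_left by lra; lra)).
  specialize (L3 ltac:(intros x Hx; apply Mid; apply Rabs_le; lra)).
  specialize (L4 ltac:(intros x Hx; apply Near; apply Rabs_le; lra)).
  specialize (L5 ltac:(intros x Hx; apply Far; rewrite Rabs_pos_eq by lra; lra)).
  assert (HMd : 0 <= M * d) by (apply Rmult_le_pos; lra).
  set (q := g 0 / 2 * (1 + eta) ^ j) in *.
  replace (q * (d / 2 - - (d / 2))) with (q * d) in L3 by field.
  replace (- M * (- d - - PI)) with (M * d - PI * M) in L1 by ring.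
  replace (- M * (PI - d)) with (M * d - PI * M) in L5 by ring.
  lra. }
destruct (INR_unbounded (2 * PI * M / (g 0 / 2 * d * eta))) as [j Hj].
specialize (B j); assert (Hp := poly j eta Heta).
assert (Hpos : 0 < g 0 / 2 * d * eta) by (repeat apply Rmult_lt_0_compat; lra).
apply (Rmult_lt_compat_r (g 0 / 2 * d * eta)) in Hj; [|assumption].
replace (2 * PI * M / (g 0 / 2 * d * eta) * (g 0 / 2 * d * eta)) with (2 * PI * M) in Hj
  by (field; repeat split; lra).
assert (H : g 0 / 2 * d * (1 + INR j * eta) <= g 0 / 2 * d * (1 + eta) ^ j).
{ apply Rmult_le_compat_l; [apply Rmult_le_pos; lra|assumption]. }
replace (g 0 / 2 * d * (1 + INR j * eta))
  with (g 0 / 2 * d + INR j * (g 0 / 2 * d * eta)) in H by ring.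
replace (g 0 / 2 * (1 + eta) ^ j * d) with (g 0 / 2 * d * (1 + eta) ^ j) in B by ring.
assert (0 < g 0 / 2 * d) by (apply Rmult_lt_0_compat; lra).
lra.
Qed.

(** The bound at 0 is applied to the translates by [x] of g and of -g. *)
Lemma fourier_null_zero g x : fourier_null g -> g x = 0.
Proof.
intros Hg.
assert (H1 := fourier_null_not_pos _ (fourier_null_shift g x Hg)).
assert (H2 := fourier_null_not_pos _
  (fourier_null_lincomb (-1) 0 _ _ (fourier_null_shift g x Hg) (fourier_null_shift g x Hg))).
cbv beta in H1, H2; rewrite Rplus_0_r in H1, H2; lra.
Qed.

(** * The kernel of S *)

Section Kernel.
Variables (lambda : R) (Hl : 0 < lambda).

Definition coef (j : nat) : R := S_coef lambda (Z.of_nat j).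

(** The modes n and -n have equal coefficients and combine to a cosine, which turns the weight coef
    / (2 pi) into coef / pi; the index [S j] leaves out the mode 0. *)
Definition kernel_term (j : nat) (x : R) : R := coef (S j) / PI * cos (INR (S j) * x).

(* S is the convolution with the real, even function whose Fourier coefficients are
   cosh(3 lambda n)^(-1/2). *)
Definition kernel (x : R) : R := coef 0 / (2 * PI) + Series (fun j => kernel_term j x).

Definition majorant (j : nat) : R := coef (S j) / PI.

Lemma S_coef_pos n : 0 < S_coef lambda n.
Proof.
unfold S_coef; apply Rinv_0_lt_compat, sqrt_lt_R0; unfold cosh.
assert (H1 := exp_pos (3 * lambda * IZR n)); assert (H2 := exp_pos (- (3 * lambda * IZR n))); lra.
Qed.

Lemma S_coef_opp n : S_coef lambda (- n) = S_coef lambda n.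
Proof.
unfold S_coef, cosh; do 3 f_equal; rewrite opp_IZR.
replace (3 * lambda * - IZR n) with (- (3 * lambda * IZR n)) by ring.
rewrite Ropp_involutive, Rplus_comm; reflexivity.
Qed.

Lemma coef_pos j : 0 < coef j.
Proof. apply S_coef_pos. Qed.

Lemma majorant_ge0 j : 0 <= majorant j.
Proof. apply Rdiv_le_0_compat; [left; apply coef_pos|apply PI_RGT_0]. Qed.

Lemma ex_series_majorant : ex_series majorant.
Proof.
set (q := exp (- (3 * lambda / 2))).
assert (Hq : 0 < q < 1).
{ split; [apply exp_pos|]; rewrite <- exp_0; apply exp_increasing; lra. }
apply (ex_series_le (K := R_AbsRing) (V := R_CompleteNormedModule) _
  (fun k => (2 * q / PI) * q ^ k)).
- intros j; change (Rabs (majorant j) <= 2 * q / PI * q ^ j).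
  rewrite Rabs_pos_eq by apply majorant_ge0.
  destruct (S_coef_bound lambda j (Z.of_nat (S j)) Hl (or_introl eq_refl)) as [_ H].
  unfold majorant, coef; fold q in H; assert (HP := PI_RGT_0).
  replace (2 * q / PI * q ^ j) with (2 * q ^ S j / PI) by (simpl; field; lra).
  apply Rmult_le_compat_r; [left; now apply Rinv_0_lt_compat|exact H].
- apply (ex_series_scal (V := R_NormedModule) (2 * q / PI) (fun k => q ^ k)), ex_series_geom.
  rewrite Rabs_pos_eq; lra.
Qed.

Lemma kernel_term_bound j x : Rabs (kernel_term j x) <= majorant j.
Proof.
unfold kernel_term; rewrite Rabs_mult; fold (majorant j).
rewrite (Rabs_pos_eq (majorant j)) by apply majorant_ge0.
assert (H := majorant_ge0 j); assert (Hc := Rabs_le _ _ (COS_bound (INR (S j) * x))).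
rewrite <- (Rmult_1_r (majorant j)) at 2; apply Rmult_le_compat_l; assumption.
Qed.

Lemma kernel_term_continuous j x : continuous (kernel_term j) x.
Proof.
apply continuous_Rmult; [apply continuous_const|apply continuous_cos_n].
Qed.

Lemma kernel_series_continuous x : continuous (fun x => Series (fun j => kernel_term j x)) x.
Proof.
apply (series_continuous kernel_term majorant ex_series_majorant x kernel_term_bound).
intros j; apply kernel_term_continuous.
Qed.

Lemma kernel_continuous x : continuous kernel x.
Proof.
apply continuous_Rplus; [apply continuous_const|].
apply kernel_series_continuous.
Qed.

Lemma kernel_periodic x : kernel (x + 2 * PI) = kernel x.
Proof.
unfold kernel; f_equal; apply Series_ext; intros j; unfold kernel_term.
now rewrite cos_n_periodic.
Qed.

Lemma kernel_even x : kernel (- x) = kernel x.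
Proof.
unfold kernel; f_equal; apply Series_ext; intros j; unfold kernel_term.
replace (INR (S j) * - x) with (- (INR (S j) * x)) by ring; now rewrite cos_neg.
Qed.

(** Termwise integration by the M-test. The point [c] is kept general: c = phi gives the
    convolution, c = 0 the Fourier coefficients of the kernel itself. *)
Lemma RInt_kernel (g : R -> R) c : (forall x, continuous g x) ->
  RInt (fun x => kernel (c - x) * g x) 0 (2 * PI)
  = coef 0 / (2 * PI) * RInt g 0 (2 * PI)
    + Series (fun j => RInt (fun x => kernel_term j (c - x) * g x) 0 (2 * PI)).
Proof.
intros Hg; assert (HP := two_PI_pos).
destruct (continuous_bounded g 0 (2 * PI) ltac:(lra) Hg) as [M [HM Hgm]].
set (ser x := Series (fun j => kernel_term j x)).
assert (E : forall x, Series (fun j => kernel_term j (c - x) * g x) = ser (c - x) * g x).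
{ intros x; apply Series_scal_r. }
assert (C : forall x, continuous (fun x => ser (c - x) * g x) x).
{ intros x; apply continuous_Rmult; [|apply Hg].
  apply continuous_reflect, kernel_series_continuous. }
assert (I : is_series (fun j => RInt (fun x => kernel_term j (c - x) * g x) 0 (2 * PI))
  (RInt (fun x => Series (fun j => kernel_term j (c - x) * g x)) 0 (2 * PI))).
{ apply (series_RInt (fun j x => kernel_term j (c - x) * g x) (fun j => majorant j * M)).
  - apply ex_series_scal_r, ex_series_majorant.
  - lra.
  - intros j; apply ex_RInt_cont; intros x; apply continuous_Rmult; [|apply Hg].
    apply continuous_reflect, kernel_term_continuous.
  - apply (ex_RInt_ext (fun x => ser (c - x) * g x)); [intros; symmetry; apply E|].
    now apply ex_RInt_cont.
  - intros j x Hx; rewrite Rabs_mult; apply Rmult_le_compat; try apply Rabs_pos; auto.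
    apply kernel_term_bound. }
rewrite (is_series_unique _ _ I), (RInt_ext_all _ _ _ _ E).
rewrite <- (Rmult_1_l (RInt (fun x => ser (c - x) * g x) 0 (2 * PI))).
rewrite <- RInt_lincomb by assumption.
apply RInt_ext_all; intros x; unfold kernel; fold (ser (c - x)); ring.
Qed.

Lemma RInt_cos_n n : RInt (fun x => cos (INR n * x)) 0 (2 * PI)
  = if Nat.eq_dec n 0 then 2 * PI else 0.
Proof.
destruct (Nat.eq_dec n 0) as [->|Hn].
- rewrite (RInt_ext_all _ (fun _ => 1)) by (intros; simpl; rewrite Rmult_0_l; apply cos_0).
  rewrite RInt_const; unfold scal; simpl; unfold mult; simpl; ring_R.
- assert (Hn' : INR n <> 0) by now apply not_0_INR.
  apply is_RInt_unique.
  replace 0 with (minus (sin (INR n * (2 * PI)) / INR n) (sin (INR n * 0) / INR n)) at 2.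
  + apply (is_RInt_derive (V := R_CompleteNormedModule) (fun x => sin (INR n * x) / INR n)).
    * intros x _; auto_derive; [exact I|]; field; assumption.
    * intros x _; apply continuous_cos_n.
  + replace (INR n * (2 * PI)) with (0 + 2 * INR n * PI) by ring; rewrite sin_period, Rmult_0_r.
    rewrite sin_0; unfold minus, plus, opp; simpl; ring_R.
Qed.

Lemma RInt_cos_cos m n : RInt (fun x => cos (INR (S m) * x) * cos (INR n * x)) 0 (2 * PI)
  = if Nat.eq_dec (S m) n then PI else 0.
Proof.
assert (H : forall a b : nat, (a <= b)%nat ->
  RInt (fun x => cos (INR b * x) * cos (INR a * x)) 0 (2 * PI)
  = / 2 * RInt (fun x => cos (INR (b - a) * x)) 0 (2 * PI)
    + / 2 * RInt (fun x => cos (INR (b + a) * x)) 0 (2 * PI)).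
{ intros a b Hab; rewrite <- RInt_lincomb by (intros; apply continuous_cos_n).
  apply RInt_ext_all; intros x; rewrite minus_INR, plus_INR by assumption.
  rewrite Rmult_minus_distr_r, Rmult_plus_distr_r, cos_minus, cos_plus; field. }
destruct (Nat.le_ge_cases n (S m)) as [Hn|Hn].
- rewrite (H n (S m) Hn), !RInt_cos_n.
  destruct (Nat.eq_dec (S m) n), (Nat.eq_dec (S m - n) 0), (Nat.eq_dec (S m + n) 0);
    try lia; try field_R.
- rewrite (RInt_ext_all _ (fun x => cos (INR n * x) * cos (INR (S m) * x))) by (intros; ring).
  rewrite (H (S m) n Hn), !RInt_cos_n.
  destruct (Nat.eq_dec (S m) n), (Nat.eq_dec (n - S m) 0), (Nat.eq_dec (n + S m) 0);
    try lia; try field_R.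
Qed.

Lemma kernel_fourier n : RInt (fun x => kernel x * cos (INR n * x)) 0 (2 * PI) = coef n.
Proof.
assert (HP := PI_RGT_0).
rewrite (RInt_ext_all _ (fun x => kernel (0 - x) * cos (INR n * x))).
2:{ intros x; rewrite <- kernel_even; do 2 f_equal; ring. }
rewrite RInt_kernel by (intros; apply continuous_cos_n).
rewrite RInt_cos_n.
assert (E : forall j, RInt (fun x => kernel_term j (0 - x) * cos (INR n * x)) 0 (2 * PI)
  = if Nat.eq_dec (S j) n then coef (S j) else 0).
{ intros j.
  rewrite (RInt_ext_all _ (fun x => coef (S j) / PI * (cos (INR (S j) * x) * cos (INR n * x))
    + 0 * cos (INR n * x))).
  - rewrite RInt_lincomb, RInt_cos_cos.
    + destruct (Nat.eq_dec (S j) n); field_R; lra.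
    + intros x; apply continuous_Rmult; apply continuous_cos_n.
    + intros x; apply continuous_cos_n.
  - intros x; unfold kernel_term.
    replace (INR (S j) * (0 - x)) with (- (INR (S j) * x)) by ring; rewrite cos_neg; ring. }
rewrite (Series_ext _ _ E).
destruct n as [|n].
- assert (Z : Series (fun j => if Nat.eq_dec (S j) 0 then coef (S j) else 0) = 0).
  { etransitivity; [|exact (is_series_unique _ _ (is_series_delta 0 0))]; apply Series_ext.
    intros j; destruct (Nat.eq_dec (S j) 0), (Nat.eq_dec j 0); try lia; reflexivity. }
  replace (Series _) with 0 by (symmetry; exact Z); simpl; field_R; lra.
- assert (Z : Series (fun j => if Nat.eq_dec (S j) (S n) then coef (S j) else 0) = coef (S n)).
  { etransitivity; [|exact (is_series_unique _ _ (is_series_delta n (coef (S n))))].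
  apply Series_ext.
    intros j; destruct (Nat.eq_dec (S j) (S n)), (Nat.eq_dec j n); try lia; subst; reflexivity. }
  replace (Series _) with (coef (S n)) by (symmetry; exact Z); destruct (Nat.eq_dec (S n) 0); [lia|]; ring_R.
Qed.

Lemma kernel_conv_cos n phi :
  conv kernel (fun x => cos (INR n * x)) phi = coef n * cos (INR n * phi).
Proof.
destruct (conv_cos_sin kernel kernel_continuous kernel_periodic kernel_even n phi) as [E _].
now rewrite E, kernel_fourier.
Qed.

Lemma kernel_conv_sin n phi :
  conv kernel (fun x => sin (INR n * x)) phi = coef n * sin (INR n * phi).
Proof.
destruct (conv_cos_sin kernel kernel_continuous kernel_periodic kernel_even n phi) as [_ E].
now rewrite E, kernel_fourier.
Qed.

(** Symmetry moves the convolution onto cos(n x), an eigenfunction with eigenvalue [coef n]. The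
    zero term brings the integrand into the form of [RInt_lincomb]. *)
Lemma conv_fourier_cos u n : (forall x, continuous u x) -> (forall x, u (x + 2 * PI) = u x) ->
  RInt (fun x => conv kernel u x * cos (INR n * x)) 0 (2 * PI)
  = coef n * RInt (fun x => u x * cos (INR n * x)) 0 (2 * PI).
Proof.
intros Hu Pu.
rewrite <- (conv_symmetric kernel kernel_continuous kernel_periodic kernel_even
  (fun x => cos (INR n * x)) u); auto using continuous_cos_n, cos_n_periodic.
rewrite (RInt_ext_all _ (fun x => coef n * (u x * cos (INR n * x)) + 0 * u x)).
- rewrite RInt_lincomb; auto; [ring_R|].
  intros x; apply continuous_Rmult; auto using continuous_cos_n.
- intros x; rewrite kernel_conv_cos; ring.
Qed.

Lemma conv_fourier_sin u n : (forall x, continuous u x) -> (forall x, u (x + 2 * PI) = u x) ->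
  RInt (fun x => conv kernel u x * sin (INR n * x)) 0 (2 * PI)
  = coef n * RInt (fun x => u x * sin (INR n * x)) 0 (2 * PI).
Proof.
intros Hu Pu.
rewrite <- (conv_symmetric kernel kernel_continuous kernel_periodic kernel_even
  (fun x => sin (INR n * x)) u); auto using continuous_sin_n, sin_n_periodic.
rewrite (RInt_ext_all _ (fun x => coef n * (u x * sin (INR n * x)) + 0 * u x)).
- rewrite RInt_lincomb; auto; [ring_R|].
  intros x; apply continuous_Rmult; auto using continuous_sin_n.
- intros x; rewrite kernel_conv_sin; ring.
Qed.

Lemma conv_kernel_injective u : (forall x, continuous u x) -> (forall x, u (x + 2 * PI) = u x) ->
  (forall x, conv kernel u x = 0) -> forall x, u x = 0.
Proof.
intros Hu Pu H0 x; apply fourier_null_zero; split; [assumption|split; [assumption|]].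
intros n; assert (Hc := coef_pos n).
assert (Z : forall h : R -> R, RInt (fun x => conv kernel u x * h x) 0 (2 * PI) = 0).
{ intros h; rewrite (RInt_ext_all _ (fun _ => 0)) by (intros y; rewrite H0; ring).
  apply RInt_zero. }
split; apply (Rmult_eq_reg_l (coef n)); try lra; rewrite Rmult_0_r.
- now rewrite <- conv_fourier_cos.
- now rewrite <- conv_fourier_sin.
Qed.

End Kernel.

(** * Complex Fourier coefficients, and [S] as a convolution *)

Lemma RInt_C (F : R -> C) (a b : R) :
  ex_RInt (fun x => Re (F x)) a b -> ex_RInt (fun x => Im (F x)) a b ->
  RInt (V := C_R_CompleteNormedModule) F a b
  = (RInt (fun x => Re (F x)) a b, RInt (fun x => Im (F x)) a b).
Proof.
intros H1 H2; apply (is_RInt_unique (V := C_R_CompleteNormedModule)).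
apply (is_RInt_fct_extend_pair (U := R_NormedModule) (V := R_NormedModule));
  now apply (RInt_correct (V := R_CompleteNormedModule)).
Qed.

Lemma Ccomp_continuous f t : Ccomp f ->
  (forall x, continuous (re_part f t) x) /\ (forall x, continuous (im_part f t) x).
Proof.
intros Hf; split; intros x;
  apply differentiable_continuous;
  apply (Ccomp_ex_derive f t x Hf).
Qed.

Lemma Ccomp_periodic f t phi : Ccomp f -> f t (phi + 2 * PI) = f t phi.
Proof.
intros [[H _] [a [b [Ha H0]]]]; destruct (Rlt_dec 0 t) as [Ht|Ht]; [now apply H|].
now rewrite !H0 by lra.
Qed.

Definition fcos (u : R -> R) (n : nat) : R := RInt (fun x => u x * cos (INR n * x)) 0 (2 * PI).
Definition fsin (u : R -> R) (n : nat) : R := RInt (fun x => u x * sin (INR n * x)) 0 (2 * PI).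

(** Expansion of the exponential at n = s |n|. The sign [s] is a parameter so that one computation
    covers both modes of a pair; for n = 0 either sign is admissible. *)
Lemma fourier_real_form f t n s : Ccomp f -> (s = 1 \/ s = -1) ->
  IZR n = s * INR (Z.abs_nat n) ->
  let a := re_part f t in let b := im_part f t in let k := Z.abs_nat n in
  fourier f t n = (/ (2 * PI) * (fcos a k + s * fsin b k),
    / (2 * PI) * (fcos b k - s * fsin a k)).
Proof.
intros Hf Hs Hn a b k; destruct (Ccomp_continuous f t Hf) as [Ca Cb].
assert (Cac : forall x, continuous (fun x => a x * cos (INR k * x)) x)
  by (intros x; apply continuous_Rmult; [apply Ca|apply continuous_cos_n]).
assert (Cas : forall x, continuous (fun x => a x * sin (INR k * x)) x)
  by (intros x; apply continuous_Rmult; [apply Ca|apply continuous_sin_n]).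
assert (Cbc : forall x, continuous (fun x => b x * cos (INR k * x)) x)
  by (intros x; apply continuous_Rmult; [apply Cb|apply continuous_cos_n]).
assert (Cbs : forall x, continuous (fun x => b x * sin (INR k * x)) x)
  by (intros x; apply continuous_Rmult; [apply Cb|apply continuous_sin_n]).
assert (ER : forall x, Re (Cmult (f t x) (expi (- (IZR n * x))))
  = 1 * (a x * cos (INR k * x)) + s * (b x * sin (INR k * x))).
{ intros x; unfold expi; rewrite cos_neg, sin_neg, Hn; fold k.
  unfold a, b, re_part, im_part; simpl; unfold Re, Im.
  destruct Hs as [-> | ->].
  - rewrite !Rmult_1_l; ring.
  - replace (-1 * INR k * x) with (- (INR k * x)) by ring; rewrite cos_neg, sin_neg; ring. }
assert (EI : forall x, Im (Cmult (f t x) (expi (- (IZR n * x))))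
  = 1 * (b x * cos (INR k * x)) + (- s) * (a x * sin (INR k * x))).
{ intros x; unfold expi; rewrite cos_neg, sin_neg, Hn; fold k.
  unfold a, b, re_part, im_part; simpl; unfold Re, Im.
  destruct Hs as [-> | ->].
  - rewrite !Rmult_1_l; ring.
  - replace (-1 * INR k * x) with (- (INR k * x)) by ring; rewrite cos_neg, sin_neg; ring. }
unfold fourier; rewrite RInt_C.
- rewrite (RInt_ext_all _ _ _ _ ER), (RInt_ext_all _ _ _ _ EI), !RInt_lincomb by assumption.
  apply injective_projections; simpl; unfold fcos, fsin; ring.
- apply (ex_RInt_ext (fun x => 1 * (a x * cos (INR k * x)) + s * (b x * sin (INR k * x)))).
  + intros; symmetry; apply ER.
  + apply ex_RInt_cont; intros x; apply continuous_Rplus;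
      apply continuous_Rmult; auto; apply continuous_const.
- apply (ex_RInt_ext (fun x => 1 * (b x * cos (INR k * x)) + (- s) * (a x * sin (INR k * x)))).
  + intros; symmetry; apply EI.
  + apply ex_RInt_cont; intros x; apply continuous_Rplus;
      apply continuous_Rmult; auto; apply continuous_const.
Qed.

Lemma IZR_sign n : exists s, (s = 1 \/ s = -1) /\ IZR n = s * INR (Z.abs_nat n).
Proof.
destruct (Z.le_ge_cases 0 n) as [H|H].
- exists 1; split; [now left|]; rewrite INR_IZR_INZ, Nat2Z.inj_abs_nat, Z.abs_eq by assumption; ring.
- exists (-1); split; [now right|].
  rewrite INR_IZR_INZ, Nat2Z.inj_abs_nat, Z.abs_neq by assumption; rewrite opp_IZR; ring.
Qed.

Lemma S_coef_abs lambda n : S_coef lambda n = coef lambda (Z.abs_nat n).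
Proof.
unfold coef; rewrite Nat2Z.inj_abs_nat; destruct (Z.abs_spec n) as [[_ ->]|[_ ->]]; [reflexivity|].
symmetry; apply S_coef_opp.
Qed.

Lemma RInt_kernel_term (u : R -> R) lambda j phi : (forall x, continuous u x) ->
  RInt (fun x => kernel_term lambda j (phi - x) * u x) 0 (2 * PI)
  = coef lambda (S j) / PI * (fcos u (S j) * cos (INR (S j) * phi)
      + fsin u (S j) * sin (INR (S j) * phi)).
Proof.
intros Hu.
rewrite (RInt_ext_all _ (fun x =>
  (coef lambda (S j) / PI * cos (INR (S j) * phi)) * (u x * cos (INR (S j) * x))
  + (coef lambda (S j) / PI * sin (INR (S j) * phi)) * (u x * sin (INR (S j) * x)))).
- rewrite RInt_lincomb; [unfold fcos, fsin; ring_R| |];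
    intros x; apply continuous_Rmult;
    auto using continuous_sin_n, continuous_cos_n.
- intros x; unfold kernel_term; rewrite Rmult_minus_distr_l, cos_minus; ring.
Qed.

(** The two modes of index j + 1 in the series of [S] add up to the integral of the j-th kernel term
    against the field, so both sides agree term by term. *)
Lemma S_op_conv lambda f t phi : 0 < lambda -> Ccomp f ->
  S_op lambda f t phi
  = (conv (kernel lambda) (re_part f t) phi, conv (kernel lambda) (im_part f t) phi).
Proof.
intros Hl Hf; destruct (Ccomp_continuous f t Hf) as [Ca Cb].
assert (Pa : forall x, re_part f t (x + 2 * PI) = re_part f t x)
  by (intros; unfold re_part; now rewrite Ccomp_periodic).
assert (Pb : forall x, im_part f t (x + 2 * PI) = im_part f t x)
  by (intros; unfold im_part; now rewrite Ccomp_periodic).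
rewrite !(conv_alt (kernel lambda)); auto using kernel_continuous, kernel_periodic.
rewrite !RInt_kernel by assumption.
change (S_op lambda f t phi) with (Cplus (S_term lambda f t phi 0%Z)
    (CSeries (S_pair lambda f t phi))).
assert (E0 : S_term lambda f t phi 0%Z
  = (coef lambda 0 / (2 * PI) * RInt (re_part f t) 0 (2 * PI),
     coef lambda 0 / (2 * PI) * RInt (im_part f t) 0 (2 * PI))).
{ unfold S_term.
  rewrite (fourier_real_form f t 0 1 Hf (or_introl eq_refl)) by (simpl; ring).
  assert (Z1 : forall u, fcos u (Z.abs_nat 0) = RInt u 0 (2 * PI)).
  { intros u; apply RInt_ext_all; intros x; simpl; rewrite Rmult_0_l, cos_0; ring. }
  assert (Z2 : forall u, fsin u (Z.abs_nat 0) = 0).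
  { intros u; transitivity (RInt (fun _ => 0) 0 (2 * PI)).
    - apply RInt_ext_all; intros x; simpl; rewrite Rmult_0_l, sin_0; ring.
    - apply RInt_zero. }
  rewrite !Z1, !Z2, Rmult_0_l, expi_0.
  apply injective_projections; simpl; unfold coef; simpl; field; apply PI_neq0. }
assert (EP : forall j, S_pair lambda f t phi j
  = (RInt (fun x => kernel_term lambda j (phi - x) * re_part f t x) 0 (2 * PI),
     RInt (fun x => kernel_term lambda j (phi - x) * im_part f t x) 0 (2 * PI))).
{ intros j; rewrite !RInt_kernel_term by assumption.
  unfold S_pair, S_term; rewrite S_coef_opp; fold (coef lambda (S j)).
  assert (A1 : Z.abs_nat (Z.of_nat (S j)) = S j) by lia.
  assert (A2 : Z.abs_nat (- Z.of_nat (S j)) = S j) by lia.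
  rewrite (fourier_real_form f t (Z.of_nat (S j)) 1 Hf (or_introl eq_refl))
    by (rewrite A1, <- INR_IZR_INZ; ring).
  rewrite (fourier_real_form f t (- Z.of_nat (S j)) (-1) Hf (or_intror eq_refl))
    by (rewrite A2, opp_IZR, <- INR_IZR_INZ; ring).
  rewrite A1, A2, opp_IZR, <- INR_IZR_INZ; unfold expi.
  replace (- INR (S j) * phi) with (- (INR (S j) * phi)) by ring; rewrite cos_neg, sin_neg.
  apply injective_projections; simpl fst; simpl snd; field; apply PI_neq0. }
rewrite E0; unfold CSeries.
rewrite (Series_ext _ _ (fun j => f_equal Re (EP j))),
  (Series_ext _ _ (fun j => f_equal Im (EP j))).
reflexivity.
Qed.

(** * S on smooth functions *)

(** Acts on functions of the spacetime slice by slice. Besides real and imaginary parts of fields it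
    is applied to solutions such as [Delta f], whose support is not compact. *)
Definition convM (k : R -> R) (u : R -> R -> R) : R -> R -> R := fun t phi => conv k (u t) phi.

Definition angle_periodic (u : R -> R -> R) : Prop :=
  forall t phi, 0 < t -> u t (phi + 2 * PI) = u t phi.

Section ConvSmooth.
Variable k : R -> R.
Hypothesis Hk : forall x, continuous k x.

Lemma continuity_2d_reflect u t phi th : continuity_2d_pt u t (phi - th) ->
  continuity_2d_pt (fun s r => u s (phi - r)) t th.
Proof.
intros H; apply (continuity_2d_comp u (fun s _ => s) (fun _ r => phi - r)); auto.
- apply continuity_2d_pt_id1.
- apply continuity_2d_pt_minus; [apply continuity_2d_pt_const|apply continuity_2d_pt_id2].
Qed.

Lemma ex_RInt_convM u t phi : (forall phi, continuity_2d_pt u t phi) ->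
  ex_RInt (fun th => k th * u t (phi - th)) 0 (2 * PI).
Proof.
intros Hu; apply ex_RInt_cont; intros x; apply conv_integrand_continuous; auto.
intros y; now apply continuity_2d_section.
Qed.

Lemma convM_continuous u : (forall t phi, 0 < t -> continuity_2d_pt u t phi) ->
  forall t phi, 0 < t -> continuity_2d_pt (convM k u) t phi.
Proof.
intros Hu t phi Ht eps; assert (HP := two_PI_pos).
destruct (continuous_bounded k 0 (2 * PI) ltac:(lra) Hk) as [M [HM Hb]].
assert (He : 0 < eps / (2 * PI * (M + 1))).
{ apply Rdiv_lt_0_compat; [apply cond_pos|]; apply Rmult_lt_0_compat; lra. }
(* The rectangle contains every point (s, r - th) with th in [0, 2 pi], |s - t| <= t / 2 and |r -
   phi| <= 1, and it stays inside t > 0. *)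
destruct (uniform_continuity_2d u (t / 2) (2 * t) (phi - 2 * PI - 1) (phi + 1)) with
  (eps := mkposreal _ He) as [d Hd]; [intros; apply Hu; lra|simpl in Hd].
set (m := Rmin d (Rmin (t / 2) 1)).
assert (Hm : 0 < m) by (repeat apply Rmin_glb_lt; [apply cond_pos|lra|lra]).
assert (M1 : m <= d) by apply Rmin_l.
assert (M2 : m <= t / 2) by (eapply Rle_trans; [apply Rmin_r|apply Rmin_l]).
assert (M3 : m <= 1) by (eapply Rle_trans; [apply Rmin_r|apply Rmin_r]).
exists (mkposreal m Hm); simpl; intros s r Hs Hr.
assert (Hs' := Rabs_def2 _ _ Hs); assert (Hr' := Rabs_def2 _ _ Hr).
assert (X1 : ex_RInt (fun th => k th * u s (r - th)) 0 (2 * PI))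
  by (apply ex_RInt_convM; intros; apply Hu; lra).
assert (X2 : ex_RInt (fun th => k th * u t (phi - th)) 0 (2 * PI))
  by (apply ex_RInt_convM; intros; apply Hu; lra).
unfold convM, conv.
replace (_ - _) with (RInt (fun th => minus (k th * u s (r - th)) (k th * u t (phi - th))) 0 (2 * PI))
  by now apply (RInt_minus (V := R_CompleteNormedModule)).
eapply Rle_lt_trans.
- apply (abs_RInt_le_const _ 0 (2 * PI) (M * (eps / (2 * PI * (M + 1))))); [lra| |].
  + now apply (ex_RInt_minus (V := R_NormedModule)).
  + intros th Hth; unfold minus, plus, opp; simpl.
    replace (k th * u s (r - th) + - (k th * u t (phi - th)))
      with (k th * (u s (r - th) - u t (phi - th))) by ring.
    rewrite Rabs_mult; apply Rmult_le_compat; try apply Rabs_pos; [now apply Hb|].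
    apply Rlt_le, Hd; try lra.
    replace (r - th - (phi - th)) with (r - phi) by ring; lra.
- assert (Hp := cond_pos eps).
  replace ((2 * PI - 0) * (M * (eps / (2 * PI * (M + 1))))) with (eps * (M / (M + 1)))
    by (field; split; lra).
  assert (M / (M + 1) < 1).
  { apply Rmult_lt_reg_r with (M + 1); [lra|]; unfold Rdiv.
    rewrite Rmult_assoc, Rinv_l by lra; lra. }
  rewrite <- (Rmult_1_r eps) at 2; apply Rmult_lt_compat_l; assumption.
Qed.

(** Differentiation under the integral sign; since the shift is carried by [u], the angular
    derivative falls on [u] just as the time derivative does. *)
Lemma is_derive_convM n u i t phi : smooth_n (S n) u -> 0 < t ->
  is_derive (match i with Time => fun s => convM k u s phi | Angle => convM k u t end)
    (match i with Time => t | Angle => phi end) (convM k (pd i u) t phi).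
Proof.
intros Hu Ht; assert (HP := two_PI_pos).
assert (Cu := fun t phi H => smooth_n_cont _ u t phi Hu H).
assert (CT := fun t phi H => smooth_n_cont n (pd Time u) t phi (smooth_n_pd n u Time Hu) H).
assert (CA := fun t phi H => smooth_n_cont n (pd Angle u) t phi (smooth_n_pd n u Angle Hu) H).
destruct i.
- assert (E : forall s th, Derive (fun z => k th * u z (phi - th)) s = k th * pd Time u s (phi - th)).
  { intros s th; apply Derive_scal. }
  unfold convM at 2; unfold conv.
  rewrite (RInt_ext_all (fun th => k th * pd Time u t (phi - th)) _ _ _ (fun th => eq_sym (E t th))).
  apply (is_derive_RInt_param (fun s th => k th * u s (phi - th))).
  + generalize (pos_locally t Ht); apply filter_imp; intros s Hs th _.
    apply (ex_derive_scal (fun z => u z (phi - th))).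
    now apply (smooth_n_ex_T n).
  + intros th _; apply (continuity_2d_pt_ext (fun s th => k th * pd Time u s (phi - th))).
    * intros; symmetry; apply E.
    * apply continuity_2d_pt_mult; [now apply (continuous_2d_snd k)|].
      apply continuity_2d_reflect; auto.
  + generalize (pos_locally t Ht); apply filter_imp; intros s Hs.
    apply ex_RInt_convM; auto.
- assert (E : forall r th, Derive (fun z => k th * u t (z - th)) r = k th * pd Angle u t (r - th)).
  { intros r th; rewrite Derive_scal; f_equal.
    apply is_derive_unique; unfold pd.
    replace (Derive (fun s => u t s) (r - th)) with (scal 1 (Derive (fun s => u t s) (r - th)))
      by apply Rmult_1_l.
    apply (is_derive_comp (fun s => u t s) (fun z => z - th)).
    - apply Derive_correct; now apply (smooth_n_ex_A n).
    - auto_derive; [exact I|ring]. }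
  unfold convM at 2; unfold conv.
  rewrite (RInt_ext_all (fun th => k th * pd Angle u t (phi - th)) _ _ _
    (fun th => eq_sym (E phi th))).
  apply (is_derive_RInt_param (fun r th => k th * u t (r - th))).
  + apply filter_forall; intros r th _; apply (ex_derive_scal (fun z => u t (z - th))).
    apply (ex_derive_comp (fun s => u t s) (fun z => z - th)).
    * now apply (smooth_n_ex_A n).
    * auto_derive; exact I.
  + intros th _; apply (continuity_2d_pt_ext (fun r th => k th * pd Angle u t (r - th))).
    * intros; symmetry; apply E.
    * apply continuity_2d_pt_mult; [now apply (continuous_2d_snd k)|].
      apply (continuity_2d_comp (pd Angle u) (fun _ _ => t) (fun r th => r - th)); auto.
      -- apply continuity_2d_pt_const.
      -- apply continuity_2d_pt_minus; [apply continuity_2d_pt_id1|apply continuity_2d_pt_id2].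
  + apply filter_forall; intros r; apply ex_RInt_convM; auto.
Qed.

Lemma pd_convM n u i t phi : smooth_n (S n) u -> 0 < t ->
  pd i (convM k u) t phi = convM k (pd i u) t phi.
Proof.
intros Hu Ht; assert (H := is_derive_convM n u i t phi Hu Ht).
destruct i; now apply is_derive_unique in H.
Qed.

Lemma convM_smooth_n n u : smooth_n n u -> smooth_n n (convM k u).
Proof.
revert u; induction n as [|n IH]; intros u Hu.
- intros t phi Ht; split; [|exact I]; apply convM_continuous; auto.
  intros; now apply (smooth_n_cont 0 u).
- apply smooth_n_step.
  + intros t phi Ht; apply convM_continuous; auto.
    intros; now apply (smooth_n_cont (S n) u).
  + intros t phi Ht; eexists; now apply (is_derive_convM n u Time).
  + intros t phi Ht; eexists; now apply (is_derive_convM n u Angle).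
  + apply (smooth_n_ext n (convM k (pd Time u))).
    * intros; symmetry; now apply (pd_convM n).
    * now apply IH, smooth_n_pd.
  + apply (smooth_n_ext n (convM k (pd Angle u))).
    * intros; symmetry; now apply (pd_convM n).
    * now apply IH, smooth_n_pd.
Qed.

Lemma convM_smooth u : smooth u -> smooth (convM k u).
Proof. intros H n; exact (convM_smooth_n n u (H n)). Qed.

Lemma convM_periodic u : angle_periodic u -> angle_periodic (convM k u).
Proof.
intros Hu t phi Ht; apply RInt_ext_all; intros th; f_equal.
rewrite <- (Hu t (phi - th)) by assumption; f_equal; ring.
Qed.

Lemma convM_zero u t phi : (forall phi, u t phi = 0) -> convM k u t phi = 0.
Proof.
intros H; unfold convM, conv; rewrite (RInt_ext_all _ (fun _ => 0)) by (intros; rewrite H; ring).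
apply RInt_zero.
Qed.

Lemma convM_tsupp a b u : tsupp a b u -> tsupp a b (convM k u).
Proof. intros H t phi Ht; apply convM_zero; auto. Qed.

End ConvSmooth.

Lemma S_op_convM lambda f : 0 < lambda -> Ccomp f ->
  re_part (S_op lambda f) = convM (kernel lambda) (re_part f) /\
  im_part (S_op lambda f) = convM (kernel lambda) (im_part f).
Proof.
intros Hl Hf; split; apply functional_extensionality; intros t;
  apply functional_extensionality; intros phi.
- change (fst (S_op lambda f t phi) = conv (kernel lambda) (re_part f t) phi).
  now rewrite S_op_conv.
- change (snd (S_op lambda f t phi) = conv (kernel lambda) (im_part f t) phi).
  now rewrite S_op_conv.
Qed.

Lemma S_op_Ccomp lambda f : 0 < lambda -> Ccomp f -> Ccomp (S_op lambda f).
Proof.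
intros Hl Hf; destruct (S_op_convM lambda f Hl Hf) as [Er Ei].
assert (Hc := kernel_continuous lambda Hl).
assert (Hf' := Hf); apply Ccomp_split in Hf'; destruct Hf' as [H1 [H2 [H3 [a [b [Ha [H4 H5]]]]]]].
apply Ccomp_split; rewrite Er, Ei; split; [|split; [|split]].
- intros t phi Ht; rewrite !S_op_conv by assumption; f_equal;
    apply (convM_periodic (kernel lambda)); auto; intros s r Hs;
    unfold re_part, im_part; now rewrite H1.
- now apply convM_smooth.
- now apply convM_smooth.
- exists a, b; split; [assumption|]; split; now apply convM_tsupp.
Qed.

Lemma S_op_Ccomp_real lambda f : 0 < lambda -> Ccomp_real f -> Ccomp_real (S_op lambda f).
Proof.
intros Hl [Hf Hi]; split; [now apply S_op_Ccomp|]; intros t phi.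
rewrite S_op_conv by assumption; apply (convM_zero (kernel lambda) (im_part f) t phi).
intros; apply Hi.
Qed.

Lemma S_op_fourier lambda f t n : 0 < lambda -> Ccomp f ->
  fourier (S_op lambda f) t n = Cmult (RtoC (S_coef lambda n)) (fourier f t n).
Proof.
intros Hl Hf; assert (HS := S_op_Ccomp lambda f Hl Hf).
destruct (IZR_sign n) as [s [Hs Hn]]; destruct (S_op_convM lambda f Hl Hf) as [Er Ei].
rewrite (fourier_real_form _ t n s HS Hs Hn), (fourier_real_form _ t n s Hf Hs Hn), Er, Ei.
destruct (Ccomp_continuous f t Hf) as [Ca Cb].
assert (Pa : forall x, re_part f t (x + 2 * PI) = re_part f t x)
  by (intros; unfold re_part; now rewrite Ccomp_periodic).
assert (Pb : forall x, im_part f t (x + 2 * PI) = im_part f t x)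
  by (intros; unfold im_part; now rewrite Ccomp_periodic).
assert (C1 := fun u Cu Pu => conv_fourier_cos lambda Hl u (Z.abs_nat n) Cu Pu).
assert (C2 := fun u Cu Pu => conv_fourier_sin lambda Hl u (Z.abs_nat n) Cu Pu).
unfold fcos, fsin, convM; rewrite !C1, !C2, S_coef_abs by assumption.
apply injective_projections; simpl; ring_R.
Qed.

Lemma conv_lincomb k a b u v phi : (forall x, continuous k x) ->
  (forall x, continuous u x) -> (forall x, continuous v x) ->
  conv k (fun x => a * u x + b * v x) phi = a * conv k u phi + b * conv k v phi.
Proof.
intros Hk Hu Hv; unfold conv; rewrite <- RInt_lincomb;
  try (intros; now apply conv_integrand_continuous).
apply RInt_ext_all; intros; ring.
Qed.

Lemma Ccomp_fscal c f : Ccomp f -> Ccomp (fscal c f).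
Proof.
intros Hf; apply Ccomp_split in Hf; destruct Hf as [H1 [H2 [H3 [a [b [Ha [H4 H5]]]]]]].
assert (Sm : forall p q, smooth (fun t phi => p * re_part f t phi + q * im_part f t phi))
  by (intros; apply smooth_plus; now apply smooth_scal).
apply Ccomp_split; split; [|split; [|split]].
- intros t phi Ht; unfold fscal; now rewrite H1.
- apply (smooth_ext (fun t phi => fst c * re_part f t phi + - snd c * im_part f t phi)); auto.
  intros t phi _; unfold re_part, im_part, fscal, Re, Im; simpl; ring.
- apply (smooth_ext (fun t phi => snd c * re_part f t phi + fst c * im_part f t phi)); auto.
  intros t phi _; unfold re_part, im_part, fscal, Re, Im; simpl; ring.
- exists a, b; split; [assumption|]; split; intros t phi Ht;
    specialize (H4 t phi Ht); specialize (H5 t phi Ht);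
    unfold re_part, im_part, fscal, Re, Im in *; simpl; rewrite H4, H5; ring.
Qed.

Lemma S_op_scal_C lambda c f : 0 < lambda -> Ccomp f ->
  S_op lambda (fscal c f) = fscal c (S_op lambda f).
Proof.
intros Hl Hf; apply field_ext; intros t phi; destruct (Ccomp_continuous f t Hf) as [Ca Cb].
assert (Hk := kernel_continuous lambda Hl).
unfold fscal at 2; rewrite !S_op_conv by auto using Ccomp_fscal.
apply injective_projections; cbn [fst snd Cmult].
- transitivity (fst c * conv (kernel lambda) (re_part f t) phi
    + - snd c * conv (kernel lambda) (im_part f t) phi); [|ring].
  rewrite <- conv_lincomb by assumption; apply RInt_ext_all; intros th.
  unfold re_part, im_part, fscal, Re, Im; simpl; ring.
- transitivity (snd c * conv (kernel lambda) (re_part f t) phi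
    + fst c * conv (kernel lambda) (im_part f t) phi); [|ring].
  rewrite <- conv_lincomb by assumption; apply RInt_ext_all; intros th.
  unfold re_part, im_part, fscal, Re, Im; simpl; ring.
Qed.

Lemma S_op_injective lambda f g : 0 < lambda -> Ccomp f -> Ccomp g ->
  S_op lambda f = S_op lambda g -> f = g.
Proof.
intros Hl Hf Hg H; apply field_ext; intros t phi.
destruct (Ccomp_continuous f t Hf) as [Fa Fb], (Ccomp_continuous g t Hg) as [Ga Gb].
assert (K : forall u v, (forall x, continuous u x) -> (forall x, continuous v x) ->
  (forall x, u (x + 2 * PI) = u x) -> (forall x, v (x + 2 * PI) = v x) ->
  (forall x, conv (kernel lambda) u x = conv (kernel lambda) v x) -> u phi = v phi).
{ intros u v Cu Cv Pu Pv E.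
  assert (Z := conv_kernel_injective lambda Hl (fun x => 1 * u x + (-1) * v x)).
  cbv beta in Z.
  assert (Z' : 1 * u phi + -1 * v phi = 0); [|lra].
  apply Z.
  - intros x; apply continuous_Rplus;
      apply continuous_Rmult; auto; apply continuous_const.
  - intros x; now rewrite Pu, Pv.
  - intros x; rewrite conv_lincomb, E; auto using kernel_continuous; ring. }
assert (E : forall x, S_op lambda f t x = S_op lambda g t x) by (intros; now rewrite H).
apply injective_projections.
- apply (K (re_part f t) (re_part g t)); auto.
  + intros; unfold re_part; now rewrite Ccomp_periodic.
  + intros; unfold re_part; now rewrite Ccomp_periodic.
  + intros x; assert (E' := f_equal fst (E x)); now rewrite !S_op_conv in E'.
- apply (K (im_part f t) (im_part g t)); auto.
  + intros; unfold im_part; now rewrite Ccomp_periodic.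
  + intros; unfold im_part; now rewrite Ccomp_periodic.
  + intros x; assert (E' := f_equal snd (E x)); now rewrite !S_op_conv in E'.
Qed.

(** * S is not surjective *)

Lemma pow_bounded_le_1 x C : 0 <= C -> (forall n, x ^ n <= C) -> x <= 1.
Proof.
intros HC H; apply Rnot_lt_le; intros Hx.
destruct (INR_unbounded (C / (x - 1))) as [n Hn].
assert (Hp := poly n (x - 1) ltac:(lra)); specialize (H n).
replace (1 + (x - 1)) with x in Hp by ring.
apply (Rmult_lt_compat_r (x - 1)) in Hn; [|lra].
replace (C / (x - 1) * (x - 1)) with C in Hn by (field; lra); lra.
Qed.

Lemma fcos_bound u : (forall x, continuous u x) ->
  exists M, 0 <= M /\ forall n, Rabs (fcos u n) <= M.
Proof.
intros Hu; assert (HP := two_PI_pos).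
destruct (continuous_bounded u 0 (2 * PI) ltac:(lra) Hu) as [M [HM Hb]].
exists ((2 * PI - 0) * M); split; [apply Rmult_le_pos; lra|]; intros n.
apply abs_RInt_le_const; [lra| |].
- apply ex_RInt_cont; intros x; apply continuous_Rmult; auto using continuous_cos_n.
- intros x Hx; rewrite Rabs_mult, <- (Rmult_1_r M).
  apply Rmult_le_compat; try apply Rabs_pos; auto; apply Rabs_le, COS_bound.
Qed.

Section Poisson.
Variable r : R.
Hypothesis Hr : 0 < r < 1.

(* A multiple of the Poisson kernel: its n-th Fourier coefficient is a multiple of r^|n|. *)
Definition poisson (x : R) : R := / ((r + / r) / 2 - cos x).

Lemma poisson_denominator x : 0 < (r + / r) / 2 - cos x.
Proof.
assert (H : 1 < (r + / r) / 2).
{ assert (H : 2 * r < r * r + 1) by nra.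
  apply Rmult_lt_reg_r with r; [lra|]; field_simplify; [|lra].
  apply Rmult_lt_reg_r with 2; [lra|]; field_simplify; lra. }
assert (Hb := COS_bound x); lra.
Qed.

Lemma poisson_pos x : 0 < poisson x.
Proof. apply Rinv_0_lt_compat, poisson_denominator. Qed.

Lemma poisson_smooth : smooth (fun _ x => poisson x).
Proof.
intros n; apply (smooth_n_inv_comp n (fun _ x => (r + / r) / 2 - cos x)).
- intros _ x _; assert (H := poisson_denominator x); lra.
- apply (smooth_n_ext n (fun _ x => (r + / r) / 2 + (-1) * cos x)); [intros; ring|].
  apply smooth_n_plus; [apply smooth_n_const|]; apply smooth_n_mult; [apply smooth_n_const|].
  apply smooth_n_trig.
Qed.

Lemma poisson_continuous x : continuous poisson x.
Proof.
apply differentiable_continuous.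
exact (smooth_ex_A (fun _ x => poisson x) 1 x poisson_smooth ltac:(lra)).
Qed.

Lemma poisson_periodic x : poisson (x + 2 * PI) = poisson x.
Proof.
unfold poisson; do 2 f_equal; replace (x + 2 * PI) with (x + 2 * INR 1 * PI) by (simpl; ring).
apply cos_period.
Qed.

(** [poisson] times its denominator is 1, whose coefficient at n + 1 vanishes, and multiplication by
    cos x averages the two neighbouring coefficients. *)
Lemma poisson_recurrence n :
  fcos poisson (S (S n)) + fcos poisson n = (r + / r) * fcos poisson (S n).
Proof.
assert (C : forall m x, continuous (fun x => poisson x * cos (INR m * x)) x).
{ intros m x; apply continuous_Rmult;
    [apply poisson_continuous|apply continuous_cos_n]. }
assert (E : RInt (fun x => cos (INR (S n) * x)) 0 (2 * PI)
  = (r + / r) / 2 * fcos poisson (S n)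
    + (-1) * (/ 2 * fcos poisson (S (S n)) + / 2 * fcos poisson n)).
{ unfold fcos; rewrite <- RInt_lincomb by auto.
  rewrite <- RInt_lincomb; auto.
  - apply RInt_ext_all; intros x; rewrite !S_INR.
    replace ((INR n + 1 + 1) * x) with ((INR n + 1) * x + x) by ring.
    replace (INR n * x) with ((INR n + 1) * x - x) by ring.
    rewrite cos_minus, cos_plus; unfold poisson.
    assert (H := poisson_denominator x).
    set (a := (r + / r) / 2) in *.
    transitivity ((a - cos x) * / (a - cos x) * cos ((INR n + 1) * x)).
    + rewrite Rinv_r by lra; ring.
    + generalize (/ (a - cos x)); intros w; field.
  - intros x; apply continuous_Rplus;
      apply continuous_Rmult; auto; apply continuous_const. }
rewrite RInt_cos_n in E; destruct (Nat.eq_dec (S n) 0); [lia|]; lra.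
Qed.

(* The recurrence has the solutions r^n and r^-n; boundedness excludes the second. *)
Lemma poisson_fcos n : fcos poisson n = r ^ n * fcos poisson 0.
Proof.
(* [d] annihilates the solution r^n and so isolates the component along r^(-n). *)
set (d n := fcos poisson (S n) - r * fcos poisson n).
assert (Hr' : 0 < / r) by (apply Rinv_0_lt_compat; lra).
assert (D : forall j, d j = (/ r) ^ j * d 0%nat).
{ intros j; induction j as [|m IH]; [simpl; ring|].
  simpl; rewrite Rmult_assoc, <- IH; unfold d.
  assert (H := poisson_recurrence m).
  replace (fcos poisson (S (S m))) with ((r + / r) * fcos poisson (S m) - fcos poisson m) by lra.
  field; lra. }
destruct (fcos_bound poisson poisson_continuous) as [M [HM Hb]].
assert (D0 : d 0%nat = 0).
{ destruct (Req_dec (d 0%nat) 0) as [H|H]; [assumption|exfalso].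
  assert (Hd : 0 < Rabs (d 0%nat)) by now apply Rabs_pos_lt.
  assert (/ r <= 1).
  { apply (pow_bounded_le_1 _ (2 * M / Rabs (d 0%nat))).
    - apply Rdiv_le_0_compat; lra.
    - intros m; apply Rmult_le_reg_r with (Rabs (d 0%nat)); [assumption|].
      replace (2 * M / Rabs (d 0%nat) * Rabs (d 0%nat)) with (2 * M) by (field; lra).
      rewrite <- (Rabs_pos_eq ((/ r) ^ m)) by (apply pow_le; lra).
      rewrite <- Rabs_mult, <- D; unfold d.
      assert (H1 := Hb (S m)); assert (H2 := Hb m).
      eapply Rle_trans; [apply Rabs_triang|].
      rewrite Rabs_Ropp, Rabs_mult, (Rabs_pos_eq r) by lra.
      assert (H3 := Rabs_pos (fcos poisson m)); nra. }
  assert (1 < / r) by (rewrite <- Rinv_1 at 1; apply Rinv_lt_contravar; lra); lra. }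
induction n as [|m IH]; [simpl; ring|].
assert (E := D m); rewrite D0, Rmult_0_r in E; unfold d in E.
simpl; rewrite Rmult_assoc, <- IH; lra.
Qed.

Lemma poisson_fcos_0 : 0 < fcos poisson 0.
Proof.
unfold fcos; rewrite (RInt_ext_all _ poisson)
  by (intros; simpl; rewrite Rmult_0_l, cos_0; ring).
apply RInt_gt_0; [apply two_PI_pos|intros; apply poisson_pos|].
intros; apply poisson_continuous.
Qed.

End Poisson.

(** The example is a time cut-off times the Poisson kernel. At t = 2 a preimage would have cosine
    coefficients r^n c / [coef n], at least (r / q)^n c / 2 for n >= 1, although those of a
    continuous function are bounded. *)
Lemma S_op_not_surjective lambda : 0 < lambda ->
  exists g, Ccomp g /\ ~ image_pred (S_op lambda) Ccomp g.
Proof.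
intros Hl; set (q := exp (- (3 * lambda / 2))).
assert (Hq : 0 < q < 1).
{ split; [apply exp_pos|]; rewrite <- exp_0; apply exp_increasing; lra. }
(* Between q and 1: below 1 so that the kernel is smooth, above q so that its coefficients outgrow
   the multipliers. *)
set (r := (1 + q) / 2); assert (Hr : 0 < r < 1) by (unfold r; lra).
set (g := (fun t x => (bump 1 3 t * poisson r x, 0)) : field).
assert (Hg : Ccomp g).
{ apply Ccomp_split; split; [|split; [|split]].
  - intros t x Ht; unfold g; now rewrite poisson_periodic.
  - apply smooth_mult; [apply bump_smooth|now apply poisson_smooth].
  - intros n; exact (smooth_n_const n 0).
  - exists 1, 3; split; [lra|]; split; intros t x Ht; unfold g, re_part, im_part; simpl.
    + rewrite (bump_tsupp 1 3 t 0 Ht); ring.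
    + reflexivity. }
exists g; split; [assumption|]; intros [f [Hf E]].
destruct (S_op_convM lambda f Hl Hf) as [Er _]; rewrite <- E in Er.
destruct (Ccomp_continuous f 2 Hf) as [Ca _].
assert (Pa : forall x, re_part f 2 (x + 2 * PI) = re_part f 2 x)
  by (intros; unfold re_part; now rewrite Ccomp_periodic).
destruct (fcos_bound (re_part f 2) Ca) as [M [HM Hb]].
set (c := bump 1 3 2 * fcos (poisson r) 0).
assert (Hc : 0 < c) by (apply Rmult_lt_0_compat; [apply bump_pos; lra|now apply poisson_fcos_0]).
assert (K : forall n, coef lambda n * fcos (re_part f 2) n = r ^ n * c).
{ intros n; unfold fcos; rewrite <- conv_fourier_cos by assumption.
  change (conv (kernel lambda) (re_part f 2)) with (convM (kernel lambda) (re_part f) 2).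
  rewrite <- Er; unfold c.
  transitivity (bump 1 3 2 * fcos (poisson r) n); [|rewrite (poisson_fcos r Hr n); ring].
  transitivity (bump 1 3 2 * fcos (poisson r) n + 0 * fcos (poisson r) n); [|ring].
  unfold fcos; rewrite <- RInt_lincomb.
  - apply RInt_ext_all; intros x; unfold g, re_part; simpl; ring.
  - intros x; apply continuous_Rmult;
      [now apply poisson_continuous|apply continuous_cos_n].
  - intros x; apply continuous_Rmult;
      [now apply poisson_continuous|apply continuous_cos_n]. }
assert (r / q <= 1).
{ apply (pow_bounded_le_1 _ (1 + 2 * M / c)).
  - assert (0 <= 2 * M / c) by (apply Rdiv_le_0_compat; lra); lra.
  - intros [|n].
    + simpl; assert (0 <= 2 * M / c) by (apply Rdiv_le_0_compat; lra); lra.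
    + destruct (S_coef_bound lambda n (Z.of_nat (S n)) Hl (or_introl eq_refl)) as [_ H].
      fold q in H; fold (coef lambda (S n)) in H.
      specialize (K (S n)); specialize (Hb (S n)).
      assert (Hk := coef_pos lambda (S n)).
      assert (Hqn : 0 < q ^ S n) by (apply pow_lt; lra).
      assert (H1 : r ^ S n * c <= 2 * q ^ S n * M).
      { rewrite <- K; apply Rle_trans with (coef lambda (S n) * M).
        - apply Rmult_le_compat_l; [lra|]; eapply Rle_trans; [apply Rle_abs|exact Hb].
        - apply Rmult_le_compat_r; assumption. }
      unfold Rdiv at 1; rewrite Rpow_mult_distr, pow_inv.
      apply Rle_trans with (2 * M / c); [|lra].
      apply Rmult_le_reg_r with (c * q ^ S n); [now apply Rmult_lt_0_compat|].
      replace (r ^ S n * / q ^ S n * (c * q ^ S n)) with (r ^ S n * c) by (field; lra).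
      replace (2 * M / c * (c * q ^ S n)) with (2 * q ^ S n * M) by (field; lra).
      exact H1. }
assert (1 < r / q).
{ apply Rmult_lt_reg_r with q; [lra|]; unfold Rdiv; rewrite Rmult_assoc, Rinv_l by lra.
  unfold r; lra. }
lra.
Qed.

(** * Green's identity *)

Definition sper (u : R -> R -> R) : Prop := smooth u /\ angle_periodic u.
(** Past compact support, as [late] is future compact support: on a compact circle these are
    conditions on time alone. The bound 0 < t leaves free the values outside the spacetime. *)
Definition early (u : R -> R -> R) : Prop :=
  exists a, 0 < a /\ forall t phi, 0 < t < a -> u t phi = 0.
Definition late (u : R -> R -> R) : Prop := exists b, forall t phi, b < t -> u t phi = 0.
Definition null (u : R -> R -> R) : Prop := forall t phi, 0 < t -> u t phi = 0.
Definition compact_time (w : R -> R -> R) : Prop := smooth w /\ early w /\ late w.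

Definition mul (u v : R -> R -> R) : R -> R -> R := fun t phi => u t phi * v t phi.
Definition lin (a b : R) (u v : R -> R -> R) : R -> R -> R :=
  fun t phi => a * u t phi + b * v t phi.

Lemma smooth_const c : smooth (fun _ _ => c).
Proof. intros n; exact (smooth_n_const n c). Qed.

Lemma smooth_lin a b u v : smooth u -> smooth v -> smooth (lin a b u v).
Proof.
intros Hu Hv; exact (smooth_plus _ _ (smooth_scal a u Hu) (smooth_scal b v Hv)).
Qed.

Lemma sper_lin a b u v : sper u -> sper v -> sper (lin a b u v).
Proof.
intros [Hu Pu] [Hv Pv]; split; [now apply smooth_lin|].
intros t phi Ht; unfold lin; now rewrite Pu, Pv.
Qed.

Lemma smooth_time : smooth (fun t _ => t).
Proof.
apply (smooth_ext (fun t _ => / / t)); [intros; field; lra|].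
intros n; apply (smooth_n_inv_comp n (fun t _ => / t)); [|apply smooth_n_inv].
intros t _ Ht H; assert (H' := Rinv_0_lt_compat t Ht); lra.
Qed.

Lemma smooth_section u t phi : smooth u -> 0 < t -> continuous (u t) phi.
Proof. intros H Ht; exact (continuity_2d_section u t phi (smooth_n_cont 0 u t phi (H 0%nat) Ht)). Qed.

Lemma early_mul_l u v : early u -> early (mul u v).
Proof. intros [a [Ha H]]; exists a; split; auto; intros; unfold mul; rewrite H by auto; ring. Qed.
Lemma early_mul_r u v : early v -> early (mul u v).
Proof. intros [a [Ha H]]; exists a; split; auto; intros; unfold mul; rewrite H by auto; ring. Qed.
Lemma late_mul_l u v : late u -> late (mul u v).
Proof. intros [b H]; exists b; intros; unfold mul; rewrite H by auto; ring. Qed.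
Lemma late_mul_r u v : late v -> late (mul u v).
Proof. intros [b H]; exists b; intros; unfold mul; rewrite H by auto; ring. Qed.

Lemma early_lin a b u v : early u -> early v -> early (lin a b u v).
Proof.
intros [c [Hc H]] [d [Hd H']]; exists (Rmin c d); split; [now apply Rmin_glb_lt|].
intros t phi Ht; assert (A := Rmin_l c d); assert (B := Rmin_r c d).
unfold lin; rewrite H, H' by lra; ring.
Qed.

Lemma late_lin a b u v : late u -> late v -> late (lin a b u v).
Proof.
intros [c H] [d H']; exists (Rmax c d).
intros t phi Ht; assert (A := Rmax_l c d); assert (B := Rmax_r c d).
unfold lin; rewrite H, H' by lra; ring.
Qed.

Lemma compact_time_lin a b u v :
  compact_time u -> compact_time v -> compact_time (lin a b u v).
Proof.
intros [H1 [H2 H3]] [H1' [H2' H3']]; split; [now apply smooth_lin|].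
split; [now apply early_lin|now apply late_lin].
Qed.

(** The factor [t] is the density |g|^(1/2) of the volume form. *)
Definition slice (w : R -> R -> R) (t : R) : R := RInt (fun phi => t * w t phi) 0 (2 * PI).
Definition Iab (a b : R) (w : R -> R -> R) : R := RInt (slice w) a b.

Lemma is_derive_RInt_slice F t : smooth F -> 0 < t ->
  is_derive (fun t => RInt (F t) 0 (2 * PI)) t (RInt (pd Time F t) 0 (2 * PI)).
Proof.
intros HF Ht; apply (is_derive_RInt_param F).
- generalize (pos_locally t Ht); apply filter_imp; intros s Hs phi _; now apply smooth_ex_T.
- intros phi _; exact (smooth_n_cont 0 (pd Time F) t phi (smooth_pd F Time HF 0%nat) Ht).
- generalize (pos_locally t Ht); apply filter_imp; intros s Hs.
  apply ex_RInt_cont; intros; now apply smooth_section.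
Qed.

Lemma slice_continuous w t : smooth w -> 0 < t -> continuous (slice w) t.
Proof.
intros Hw Ht; apply differentiable_continuous; eexists.
apply (is_derive_RInt_slice (fun t phi => t * w t phi)); [|assumption].
apply smooth_mult; [apply smooth_time|assumption].
Qed.

Lemma slice_zero u t : (forall phi, u t phi = 0) -> slice u t = 0.
Proof.
intros H; unfold slice; rewrite (RInt_ext_all _ (fun _ => 0)) by (intros; rewrite H; ring).
apply RInt_zero.
Qed.

Lemma slice_lin a b u v t : smooth u -> smooth v -> 0 < t ->
  slice (lin a b u v) t = a * slice u t + b * slice v t.
Proof.
intros Hu Hv Ht; unfold slice.
rewrite <- RInt_lincomb.
- apply RInt_ext_all; intros; unfold lin; ring.
- intros x; apply continuous_Rmult; [apply continuous_const|].
  now apply smooth_section.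
- intros x; apply continuous_Rmult; [apply continuous_const|].
  now apply smooth_section.
Qed.

Lemma ex_RInt_slice w a b : smooth w -> 0 < a -> a <= b -> ex_RInt (slice w) a b.
Proof.
intros Hw Ha Hab; apply ex_RInt_cont_le; [assumption|]; intros; apply slice_continuous; auto; lra.
Qed.

Lemma Iab_lin a b c d u v : smooth u -> smooth v -> 0 < a -> a <= b ->
  Iab a b (lin c d u v) = c * Iab a b u + d * Iab a b v.
Proof.
intros Hu Hv Ha Hab; unfold Iab.
transitivity (RInt (fun t => c * slice u t + d * slice v t) a b).
- apply RInt_ext; intros t; rewrite Rmin_left, Rmax_right by assumption; intros Ht.
  apply slice_lin; auto; lra.
- assert (X := ex_RInt_slice u a b Hu Ha Hab); assert (Y := ex_RInt_slice v a b Hv Ha Hab).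
  rewrite RInt_Rplus by (now apply (ex_RInt_scal (V := R_NormedModule))).
  now rewrite !RInt_Rmult_l by assumption.
Qed.

(* The derivative of W(t) = int t (u v_t - v u_t) dphi is int t (v Pu - u Pv) dphi: the
   angular terms integrate to zero by periodicity. *)
Lemma green_Iab xi u v a b : sper u -> sper v -> 0 < a -> a <= b ->
  (forall phi, u a phi = 0 /\ pd Time u a phi = 0) ->
  (forall phi, v b phi = 0 /\ pd Time v b phi = 0) ->
  Iab a b (mul u (P_real xi v)) = Iab a b (mul v (P_real xi u)).
Proof.
intros [Hu Pu] [Hv Pv] Ha Hab Bu Bv.
set (F := fun t phi => t * lin 1 (-1) (mul u (pd Time v)) (mul v (pd Time u)) t phi).
assert (HF : smooth F).
{ apply smooth_mult; [apply smooth_time|]; apply smooth_lin; apply smooth_mult;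
    auto using smooth_pd. }
set (Wr t := RInt (F t) 0 (2 * PI)).
assert (DW : forall t, 0 < t -> is_derive Wr t (RInt (pd Time F t) 0 (2 * PI)))
  by (intros; now apply is_derive_RInt_slice).
set (Q := lin 1 (-1) (mul v (P_real xi u)) (mul u (P_real xi v))).
assert (HQ : smooth Q).
{ apply smooth_lin; apply smooth_mult; auto; now apply smooth_P. }
assert (E : forall t, 0 < t -> RInt (pd Time F t) 0 (2 * PI) = slice Q t).
{ intros t Ht.
  set (A phi := u t phi * pd Angle v t phi - v t phi * pd Angle u t phi).
  assert (DA : forall phi, is_derive A phi
    (u t phi * pd Angle (pd Angle v) t phi - v t phi * pd Angle (pd Angle u) t phi)).
  { intros phi.
    assert (D1 := Derive_correct _ _ (smooth_ex_A u t phi Hu Ht)).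
    assert (D2 := Derive_correct _ _ (smooth_ex_A v t phi Hv Ht)).
    assert (D3 := Derive_correct _ _ (smooth_ex_A _ t phi (smooth_pd u Angle Hu) Ht)).
    assert (D4 := Derive_correct _ _ (smooth_ex_A _ t phi (smooth_pd v Angle Hv) Ht)).
    assert (G1 := is_derive_mult _ _ phi _ _ D1 D4 Rmult_comm).
    assert (G2 := is_derive_mult _ _ phi _ _ D2 D3 Rmult_comm).
    assert (G := is_derive_minus (K := R_AbsRing) (V := R_NormedModule) _ _ phi _ _ G1 G2).
    evar_last; [exact G|].
    unfold minus, plus, opp, mult; simpl; unfold pd; ring. }
  assert (IA : RInt (fun phi => u t phi * pd Angle (pd Angle v) t phi
      - v t phi * pd Angle (pd Angle u) t phi) 0 (2 * PI) = 0).
  { apply is_RInt_unique.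
    replace 0 with (minus (A (2 * PI)) (A 0)) at 2.
    - apply (is_RInt_derive (V := R_CompleteNormedModule) A).
      + intros; apply DA.
      + intros phi _; apply continuous_Rminus;
          apply continuous_Rmult; apply smooth_section; auto using smooth_pd.
    - unfold minus, plus, opp; simpl; unfold A.
      rewrite <- (Rplus_0_l (2 * PI)), Pu, Pv by assumption.
      rewrite (pd_periodic v Angle Pv), (pd_periodic u Angle Pu) by assumption; ring. }
  (* Differentiating the weight [t] supplies the first order terms of P; what is left over is the
     angular term, with the factor t * t^(-2). *)
  assert (EF : forall phi, pd Time F t phi = 1 * (t * Q t phi)
    + / t * (u t phi * pd Angle (pd Angle v) t phi - v t phi * pd Angle (pd Angle u) t phi)).
  { intros phi; unfold Q, lin, mul; rewrite !P_real_pos by assumption.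
    unfold pd at 1; apply is_derive_unique.
    assert (D1 := Derive_correct _ _ (smooth_ex_T u t phi Hu Ht)).
    assert (D2 := Derive_correct _ _ (smooth_ex_T v t phi Hv Ht)).
    assert (D3 := Derive_correct _ _ (smooth_ex_T _ t phi (smooth_pd u Time Hu) Ht)).
    assert (D4 := Derive_correct _ _ (smooth_ex_T _ t phi (smooth_pd v Time Hv) Ht)).
    assert (G1 := is_derive_mult _ _ t _ _ D1 D4 Rmult_comm).
    assert (G2 := is_derive_mult _ _ t _ _ D2 D3 Rmult_comm).
    assert (G := is_derive_minus (K := R_AbsRing) (V := R_NormedModule) _ _ t _ _ G1 G2).
    assert (G3 := is_derive_mult _ _ t _ _ (is_derive_id (K := R_AbsRing) t) G Rmult_comm).
    apply (is_derive_ext (fun s => mult s (minus (mult (u s phi) (pd Time v s phi))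
      (mult (v s phi) (pd Time u s phi))))).
    - intros s; unfold F, lin, mul, minus, plus, opp, mult; simpl; ring.
    - evar_last; [exact G3|].
      unfold minus, plus, opp, mult, one; simpl; unfold pd; field; lra. }
  rewrite (RInt_ext_all _ _ _ _ EF), RInt_lincomb, IA.
  - unfold slice; ring_R.
  - intros x; apply continuous_Rmult; [apply continuous_const|].
    now apply smooth_section.
  - intros x; apply continuous_Rminus;
      apply continuous_Rmult; apply smooth_section; auto using smooth_pd. }
assert (Z : forall t, (forall phi, F t phi = 0) -> Wr t = 0).
{ intros t H; unfold Wr; rewrite (RInt_ext_all _ (fun _ => 0)) by assumption.
  apply RInt_zero. }
assert (IQ : Iab a b Q = 0).
{ apply is_RInt_unique.
  replace 0 with (minus (Wr b) (Wr a)).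
  - apply (is_RInt_ext (fun t => RInt (pd Time F t) 0 (2 * PI))).
    + intros t; rewrite Rmin_left, Rmax_right by assumption; intros Ht; apply E; lra.
    + apply (is_RInt_derive (V := R_CompleteNormedModule) Wr);
        intros t; rewrite Rmin_left, Rmax_right by assumption; intros Ht; [apply DW; lra|].
      apply differentiable_continuous; eexists.
      apply (is_derive_RInt_slice (pd Time F)); [now apply smooth_pd|lra].
  - rewrite !Z; [unfold minus, plus, opp; simpl; ring_R| |].
    + intros phi; unfold F, lin, mul; destruct (Bu phi) as [B1 B2]; rewrite B1, B2; ring.
    + intros phi; unfold F, lin, mul; destruct (Bv phi) as [B1 B2]; rewrite B1, B2; ring. }
unfold Q in IQ; rewrite Iab_lin in IQ; auto.
- lra.
- apply smooth_mult; auto; now apply smooth_P.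
- apply smooth_mult; auto; now apply smooth_P.
Qed.

(** * Integration over the spacetime of functions with compact time support *)

Lemma integral_M_Iab (h : field) w a b : smooth w -> 0 < a -> a <= b ->
  (forall t phi, 0 < t < a \/ b < t -> w t phi = 0) ->
  (forall t phi, 0 < t -> h t phi = (w t phi, 0)) ->
  integral_M h = RtoC (Iab a b w).
Proof.
intros Hw Ha Hab H0 Hh.
set (G := fun t => RInt (V := C_R_CompleteNormedModule)
       (fun phi => Cmult (RtoC (sqrt_det t phi)) (h t phi)) 0 (2 * PI)).
assert (EG : forall t, 0 < t -> G t = (slice w t, 0)).
{ intros t Ht; unfold G.
  rewrite (RInt_ext (V := C_R_CompleteNormedModule) _ (fun phi => (t * w t phi, 0))).
  - rewrite RInt_C.
    + f_equal; etransitivity; [exact (RInt_const (V := R_CompleteNormedModule) 0 (2 * PI) 0)|apply Rmult_0_r].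
    + apply (ex_RInt_cont (fun phi => t * w t phi)); intros x.
      apply continuous_Rmult; [apply continuous_const|now apply smooth_section].
    + exact (ex_RInt_const (V := R_NormedModule) 0 (2 * PI) 0).
  - intros phi _; rewrite sqrt_det_pos, Hh by assumption.
    apply injective_projections; simpl; ring. }
(* Outside [a, b] the slices vanish, so the improper integral is constant once its bounds have
   passed a and b. *)
assert (Zero : forall x y, 0 < x -> x <= y -> y <= a \/ b <= x ->
  is_RInt (V := C_R_NormedModule) G x y (RtoC 0)).
{ intros x y Hx Hxy Ho.
  apply (is_RInt_ext (V := C_R_NormedModule) (fun _ => RtoC 0)).
  - intros t; rewrite Rmin_left, Rmax_right by assumption; intros Ht.
    rewrite EG, slice_zero by (try lra; intros; apply H0; lra); reflexivity.
  - assert (K := is_RInt_const (V := C_R_NormedModule) x y (RtoC 0)).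
    replace (scal (y - x) (RtoC 0 : C_R_NormedModule)) with (RtoC 0) in K; [exact K|].
    apply injective_projections; symmetry; apply Rmult_0_r. }
assert (Mid : is_RInt (V := C_R_NormedModule) G a b (RtoC (Iab a b w))).
{ apply (is_RInt_ext (V := C_R_NormedModule) (fun t => (slice w t, 0))).
  - intros t; rewrite Rmin_left, Rmax_right by assumption; intros Ht; rewrite EG by lra; reflexivity.
  - apply (is_RInt_fct_extend_pair (U := R_NormedModule) (V := R_NormedModule)).
    + apply (RInt_correct (V := R_CompleteNormedModule)); now apply ex_RInt_slice.
    + assert (K := is_RInt_const (V := R_NormedModule) a b 0).
      replace (scal (b - a) (0 : R_NormedModule)) with 0 in K; [exact K|].
      symmetry; apply Rmult_0_r. }
assert (X : is_RInt_gen (V := C_R_NormedModule) G (at_right 0) (Rbar_locally p_infty)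
  (RtoC (Iab a b w))); [|exact (is_RInt_gen_unique (V := C_R_CompleteNormedModule) G _ X)].
intros P HP; apply (Filter_prod _ _ _ (fun x => 0 < x < a) (fun y => b < y)).
- exists (mkposreal a Ha); intros y Hy Hy0; split; [assumption|].
  change (Rabs (y - 0) < a) in Hy; apply Rabs_def2 in Hy; lra.
- now exists b.
- intros x y Hx Hy; exists (RtoC (Iab a b w)); split; [|now apply locally_singleton].
  assert (Z1 := Zero x a ltac:(lra) ltac:(lra) ltac:(lra)).
  assert (Z2 := Zero b y ltac:(lra) ltac:(lra) ltac:(lra)).
  assert (K := is_RInt_Chasles (V := C_R_NormedModule) G x a y _ _ Z1
    (is_RInt_Chasles (V := C_R_NormedModule) G a b y _ _ Mid Z2)).
  rewrite (plus_zero_l (G := C_R_NormedModule)), (plus_zero_r (G := C_R_NormedModule)) in K.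
  exact K.
Qed.

Definition emb (w : R -> R -> R) : field := fun t phi => (w t phi, 0).
Definition Mint (w : R -> R -> R) : R := Re (integral_M (emb w)).

(** Every window containing [a0, b0] gives the integral, so that several integrals can be compared
    on a common window. *)
Lemma compact_time_Mint w : compact_time w -> exists a0 b0, 0 < a0 /\ a0 <= b0 /\
  forall a b, 0 < a -> a <= a0 -> b0 <= b -> forall h : field,
    (forall t phi, 0 < t -> h t phi = (w t phi, 0)) -> integral_M h = RtoC (Iab a b w).
Proof.
intros [Hw [[a0 [Ha0 H1]] [b0 H2]]]; exists a0, (Rmax a0 b0).
assert (A := Rmax_l a0 b0); assert (B := Rmax_r a0 b0).
split; [assumption|split; [assumption|]]; intros a b Ha Ha' Hb h Hh.
apply integral_M_Iab; auto; try lra.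
intros t phi [Ht|Ht]; [apply H1|apply H2]; lra.
Qed.

Lemma integral_M_Mint w (h : field) : compact_time w ->
  (forall t phi, 0 < t -> h t phi = (w t phi, 0)) -> integral_M h = RtoC (Mint w).
Proof.
intros Hw Hh; destruct (compact_time_Mint w Hw) as [a [b [Ha [Hab H]]]].
unfold Mint; rewrite (H a b Ha (Rle_refl _) (Rle_refl _) h Hh).
now rewrite (H a b Ha (Rle_refl _) (Rle_refl _) (emb w)).
Qed.

Lemma Mint_common u v : compact_time u -> compact_time v ->
  exists a0 b0, 0 < a0 /\ a0 <= b0 /\ forall a b, 0 < a -> a <= a0 -> b0 <= b ->
    Mint u = Iab a b u /\ Mint v = Iab a b v.
Proof.
intros Hu Hv.
destruct (compact_time_Mint u Hu) as [a [b [Ha [Hab H]]]].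
destruct (compact_time_Mint v Hv) as [a' [b' [Ha' [Hab' H']]]].
exists (Rmin a a'), (Rmax b b').
assert (A1 := Rmin_l a a'); assert (A2 := Rmin_r a a').
assert (B1 := Rmax_l b b'); assert (B2 := Rmax_r b b').
split; [now apply Rmin_glb_lt|split; [lra|]]; intros c d Hc Hc' Hd; split; unfold Mint.
- rewrite (H c d) by (auto; lra); reflexivity.
- rewrite (H' c d) by (auto; lra); reflexivity.
Qed.

Lemma Mint_lin a b u v : compact_time u -> compact_time v ->
  Mint (lin a b u v) = a * Mint u + b * Mint v.
Proof.
intros Hu Hv; destruct (Mint_common u v Hu Hv) as [c [d [Hc [Hcd H]]]].
destruct (Mint_common u _ Hu (compact_time_lin a b u v Hu Hv)) as [c' [d' [Hc' [Hcd' H']]]].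
assert (A1 := Rmin_l c c'); assert (A2 := Rmin_r c c').
assert (B1 := Rmax_l d d'); assert (B2 := Rmax_r d d').
assert (Hm : 0 < Rmin c c') by now apply Rmin_glb_lt.
destruct (H (Rmin c c') (Rmax d d')) as [E1 E2]; try lra.
destruct (H' (Rmin c c') (Rmax d d')) as [_ E3]; try lra.
destruct Hu as [Hu _], Hv as [Hv _].
rewrite E3, E1, E2; apply Iab_lin; auto; lra.
Qed.

Lemma Mint_ext u v : compact_time u -> (forall t phi, 0 < t -> u t phi = v t phi) ->
  Mint u = Mint v.
Proof.
intros Hu H; assert (E : integral_M (emb v) = RtoC (Mint u)).
{ apply integral_M_Mint; [assumption|]; intros t phi Ht; unfold emb; now rewrite H. }
unfold Mint at 2; now rewrite E.
Qed.

Lemma Mint_null u : null u -> Mint u = 0.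
Proof.
intros H; assert (Hu : compact_time u).
{ split; [|split].
  - apply (smooth_ext (fun _ _ => 0)); [|apply smooth_const]; intros; now rewrite H.
  - exists 1; split; [lra|]; intros; apply H; lra.
  - exists 1; intros; apply H; lra. }
assert (E := Mint_lin 0 0 u u Hu Hu); rewrite <- (Mint_ext u) in E; [lra|assumption|].
intros t phi Ht; unfold lin; rewrite H by assumption; ring.
Qed.

Lemma early_pd u a : (forall t phi, 0 < t < a -> u t phi = 0) ->
  forall t phi, 0 < t < a -> pd Time u t phi = 0.
Proof.
intros H t phi Ht; unfold pd; rewrite (Derive_ext_loc _ (fun _ => 0)); [apply Derive_const|].
apply (locally_interval _ t 0 a); simpl; try tauto; intros; now apply H.
Qed.

Lemma late_pd u b : (forall t phi, b < t -> u t phi = 0) ->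
  forall t phi, b < t -> pd Time u t phi = 0.
Proof.
intros H t phi Ht; unfold pd; rewrite (Derive_ext_loc _ (fun _ => 0)); [apply Derive_const|].
generalize (open_gt b t Ht); apply filter_imp; intros; now apply H.
Qed.

Lemma early_P xi u : smooth u -> early u -> early (P_real xi u).
Proof.
intros Hu [a [Ha H]]; exists a; split; [assumption|]; intros t phi Ht.
rewrite P_real_pos by (auto; lra).
rewrite (early_pd _ a (early_pd u a H)), (early_pd u a H) by assumption.
assert (E : pd Angle (pd Angle u) t phi = 0).
{ unfold pd; rewrite (Derive_ext _ (fun _ => 0)); [apply Derive_const|].
  intros s; rewrite (Derive_ext _ (fun _ => 0)); [apply Derive_const|]; intros; now apply H. }
rewrite E; ring.
Qed.

Lemma late_P xi u : smooth u -> late u -> late (P_real xi u).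
Proof.
intros Hu [b H]; exists (Rmax b 0); intros t phi Ht.
assert (A := Rmax_l b 0); assert (B := Rmax_r b 0).
rewrite P_real_pos by (auto; lra).
rewrite (late_pd _ b (late_pd u b H)), (late_pd u b H) by lra.
assert (E : pd Angle (pd Angle u) t phi = 0).
{ unfold pd; rewrite (Derive_ext _ (fun _ => 0)); [apply Derive_const|].
  intros s; rewrite (Derive_ext _ (fun _ => 0)); [apply Derive_const|]; intros; apply H; lra. }
rewrite E; ring.
Qed.

(** The factors may have noncompact support: one vanishes near t = 0, the other for large t, [P]
    preserves both properties, and so the products have compact support in time. *)
Lemma green xi u v : sper u -> sper v -> early u -> late v ->
  Mint (mul u (P_real xi v)) = Mint (mul v (P_real xi u)).
Proof.
intros Su Sv Eu Lv.
assert (C1 : compact_time (mul u (P_real xi v))).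
{ destruct Su as [Hu _], Sv as [Hv _]; split; [|split].
  - apply smooth_mult; auto; now apply smooth_P.
  - now apply early_mul_l.
  - now apply late_mul_r, late_P. }
assert (C2 : compact_time (mul v (P_real xi u))).
{ destruct Su as [Hu _], Sv as [Hv _]; split; [|split].
  - apply smooth_mult; auto; now apply smooth_P.
  - now apply early_mul_r, early_P.
  - now apply late_mul_l. }
destruct (Mint_common _ _ C1 C2) as [a0 [b0 [Ha0 [Hab0 H]]]].
destruct Eu as [a1 [Ha1 H1]], Lv as [b1 H2].
(* [a1 / 2] and [b1 + 1] lie in the interior of the regions where [u] and [v] vanish, so the time
   derivatives vanish at the end points too. *)
set (a := Rmin a0 (a1 / 2)); set (b := Rmax b0 (b1 + 1)).
assert (Ha : 0 < a) by (apply Rmin_glb_lt; lra).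
assert (A1 : a <= a0) by apply Rmin_l; assert (A2 : a <= a1 / 2) by apply Rmin_r.
assert (B1 : b0 <= b) by apply Rmax_l; assert (B2 : b1 + 1 <= b) by apply Rmax_r.
destruct (H a b) as [-> ->]; try lra.
apply green_Iab; auto; try lra; intros phi; split.
- apply H1; lra.
- apply (early_pd u a1 H1); lra.
- apply H2; lra.
- apply (late_pd v b1 H2); lra.
Qed.

Definition test_fun (g : R -> R -> R) : Prop := Ccomp_real (emb g).

(** Tested against c u with a bump [c] around t0, the hypothesis makes the integral of c u^2 zero.
    Its integrand is continuous and nonnegative, so the slice at t0 vanishes and then the value at
    phi0. *)
Lemma sper_zero_of_orthogonal u : sper u ->
  (forall g, test_fun g -> Mint (mul g u) = 0) -> null u.
Proof.
intros [Hu Pu] H t0 phi0 Ht0.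
set (c := bump (t0 / 2) (2 * t0)).
set (g := fun t phi => c t * u t phi).
assert (Hg : smooth g) by (apply smooth_mult; [apply bump_smooth|assumption]).
assert (Sg : tsupp (t0 / 2) (2 * t0) g).
{ intros t phi Ht; unfold g, c; rewrite (bump_tsupp _ _ t phi Ht); ring. }
assert (Tg : test_fun g).
{ split; [|reflexivity]; apply Ccomp_split; split; [|split; [|split]].
  - intros t phi Ht; unfold emb, g; now rewrite Pu.
  - exact Hg.
  - exact (smooth_const 0).
  - exists (t0 / 2), (2 * t0); split; [lra|]; split; [exact Sg|]; intros t phi _; reflexivity. }
specialize (H g Tg).
assert (Hw : smooth (mul g u)) by now apply smooth_mult.
assert (I0 : Iab (t0 / 2) (2 * t0) (mul g u) = 0).
{ unfold Mint in H.
  rewrite (integral_M_Iab (emb (mul g u)) (mul g u) (t0 / 2) (2 * t0)) in H; auto; try lra.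
  intros t phi Ht; unfold mul; rewrite Sg by lra; ring. }
assert (HP := two_PI_pos).
assert (Pos : forall t phi, 0 < t -> 0 <= t * mul g u t phi).
{ intros t phi Ht; unfold mul, g.
  assert (H1 := bump_ge0 (t0 / 2) (2 * t0) t); fold c in H1.
  replace (t * (c t * u t phi * u t phi)) with (t * c t * (u t phi * u t phi)) by ring.
  apply Rmult_le_pos; [apply Rmult_le_pos; lra|apply Rle_0_sqr]. }
assert (J0 : slice (mul g u) t0 = 0).
{ apply (RInt_ge0_eq0 (slice (mul g u)) (t0 / 2) (2 * t0)); auto; try lra.
  - intros; apply slice_continuous; auto; lra.
  - intros t Ht; apply RInt_ge_0; [lra| |].
    + apply ex_RInt_cont; intros x; apply continuous_Rmult;
        [apply continuous_const|apply smooth_section; auto; lra].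
    + intros; apply Pos; lra. }
assert (Cw : forall x, continuous (fun phi => t0 * mul g u t0 phi) x).
{ intros x; apply continuous_Rmult;
    [apply continuous_const|apply smooth_section; auto; lra]. }
assert (K0 : t0 * mul g u t0 phi0 = 0).
(* The period is centred at [phi0], which makes it an interior point. *)
{ apply (RInt_ge0_eq0 (fun phi => t0 * mul g u t0 phi) (phi0 - PI) (phi0 - PI + 2 * PI));
    auto; try lra.
  rewrite RInt_periodic_window; auto.
  intros x; unfold mul, g; now rewrite Pu. }
unfold mul, g in K0.
assert (H1 := bump_pos (t0 / 2) (2 * t0) t0 ltac:(lra)); fold c in H1.
assert (K1 : u t0 phi0 * u t0 phi0 = 0).
{ apply (Rmult_eq_reg_l (t0 * c t0)); [|nra].
  rewrite Rmult_0_r, <- K0; ring. }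
now apply Rsqr_0_uniq.
Qed.

Lemma Mint_convM_symmetric lambda u v : 0 < lambda -> sper u -> sper v -> early v -> late v ->
  Mint (mul v (convM (kernel lambda) u)) = Mint (mul (convM (kernel lambda) v) u).
Proof.
intros Hl [Hu Pu] [Hv Pv] Ev Lv; set (k := kernel lambda).
assert (Hk : forall x, continuous k x) by now apply kernel_continuous.
assert (Hcv : smooth (convM k v)) by now apply convM_smooth.
assert (C1 : compact_time (mul v (convM k u))).
{ split; [apply smooth_mult; auto; now apply convM_smooth|].
  split; [now apply early_mul_l|now apply late_mul_l]. }
assert (C2 : compact_time (mul (convM k v) u)).
{ split; [now apply smooth_mult|]; split; [apply early_mul_l|apply late_mul_l].
  - destruct Ev as [a [Ha H]]; exists a; split; [assumption|]; intros; apply convM_zero; auto.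
  - destruct Lv as [b H]; exists b; intros; apply convM_zero; auto. }
destruct (Mint_common _ _ C1 C2) as [a [b [Ha [Hab H]]]].
destruct (H a b) as [-> ->]; try lra.
apply RInt_ext; intros t; rewrite Rmin_left, Rmax_right by assumption; intros Ht.
assert (Ht0 : 0 < t) by lra.
assert (Cu : forall x, continuous (u t) x) by (intros; now apply smooth_section).
assert (Cv : forall x, continuous (v t) x) by (intros; now apply smooth_section).
assert (S1 := conv_symmetric k Hk (kernel_periodic lambda) (kernel_even lambda) (u t) (v t)
  Cu (fun x => Pu t x Ht0) Cv (fun x => Pv t x Ht0)).
assert (Ccu : forall x, continuous (conv k (u t)) x) by (intros; now apply conv_continuous).
assert (Ccv : forall x, continuous (conv k (v t)) x) by (intros; now apply conv_continuous).
unfold slice, mul, convM.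
rewrite (RInt_ext_all _ (fun phi => t * (v t phi * conv k (u t) phi)
  + 0 * (v t phi * conv k (u t) phi))) by (intros; ring).
rewrite (RInt_ext_all (fun phi => t * (conv k (v t) phi * u t phi))
  (fun phi => t * (conv k (v t) phi * u t phi)
  + 0 * (conv k (v t) phi * u t phi))) by (intros; ring).
rewrite !RInt_lincomb;
  try (intros x; apply continuous_Rmult; auto).
rewrite S1; reflexivity.
Qed.

(** * The causal propagator *)

(** As g(d/dt, d/dt) = -1, the orientation condition says that the time component of the velocity is
    positive; the mean value theorem concludes. *)
Lemma causal_segment_time p q : causal_segment p q -> fst p <= fst q.
Proof.
intros [gamma [-> [-> H]]]; simpl.
destruct (MVT_gen (gamma Time) 0 1 (Derive (gamma Time))) as [c [Hc E]].
- intros x; rewrite Rmin_left, Rmax_right by lra; intros Hx; apply Derive_correct.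
  destruct (H x ltac:(lra)) as [_ [H1 _]]; apply (H1 Time).
- intros x; rewrite Rmin_left, Rmax_right by lra; intros Hx; apply continuity_pt_filterlim.
  destruct (H x ltac:(lra)) as [_ [H1 _]].
  apply differentiable_continuous, (H1 Time).
- rewrite Rmin_left, Rmax_right in Hc by lra.
  destruct (H c Hc) as [_ [_ [_ H1]]]; unfold sum_coord, metric in H1; lra.
Qed.

Lemma causal_time p q : causal p q -> fst p <= fst q.
Proof.
induction 1; [now apply causal_segment_time|lra|lra].
Qed.

Lemma supp_time_ge f p a : (forall t phi, t < a -> f t phi = RtoC 0) -> supp f p -> a <= fst p.
Proof.
intros H [_ Hs]; apply Rnot_lt_le; intros Hlt.
destruct (Hs (fun q => fst q < a)) as [q [Hq [_ Hq']]]; [|now apply Hq', H].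
destruct p as [t phi]; simpl in Hlt.
assert (Hd : 0 < a - t) by lra; exists (mkposreal _ Hd); intros [s r] [B _].
change (Rabs (s - t) < a - t) in B; apply Rabs_def2 in B; simpl; lra.
Qed.

Lemma supp_time_le f p b : (forall t phi, b < t -> f t phi = RtoC 0) -> supp f p -> fst p <= b.
Proof.
intros H [_ Hs]; apply Rnot_lt_le; intros Hlt.
destruct (Hs (fun q => b < fst q)) as [q [Hq [_ Hq']]]; [|now apply Hq', H].
destruct p as [t phi]; simpl in Hlt.
assert (Hd : 0 < t - b) by lra; exists (mkposreal _ Hd); intros [s r] [B _].
change (Rabs (s - t) < t - b) in B; apply Rabs_def2 in B; simpl; lra.
Qed.

Lemma supp_nonzero f t phi : 0 < t -> f t phi <> RtoC 0 -> supp f (t, phi).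
Proof.
intros Ht Hf; split; [assumption|]; intros D HD; exists (t, phi); split; [|now split].
now apply locally_singleton.
Qed.

Lemma pd_lin i a b u v t phi : smooth u -> smooth v -> 0 < t ->
  pd i (lin a b u v) t phi = a * pd i u t phi + b * pd i v t phi.
Proof.
intros Hu Hv Ht; unfold lin, pd; destruct i.
- rewrite Derive_plus, !Derive_scal; [reflexivity| |];
    apply ex_derive_scal; now apply smooth_ex_T.
- rewrite Derive_plus, !Derive_scal; [reflexivity| |];
    apply ex_derive_scal; now apply smooth_ex_A.
Qed.

Lemma P_real_lin xi a b u v t phi : smooth u -> smooth v -> 0 < t ->
  P_real xi (lin a b u v) t phi = a * P_real xi u t phi + b * P_real xi v t phi.
Proof.
intros Hu Hv Ht; assert (E := fun i t phi H => pd_lin i a b u v t phi Hu Hv H).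
rewrite !P_real_pos by auto using smooth_lin.
rewrite (pd_ext Time _ _ t phi (E Time) Ht), (pd_ext Angle _ _ t phi (E Angle) Ht).
rewrite (E Time) by assumption.
rewrite !(fun i => pd_lin i a b (pd i u) (pd i v) t phi (smooth_pd u i Hu) (smooth_pd v i Hv) Ht).
ring.
Qed.

(** The coefficients of P depend on t alone, so P commutes with convolution in the angle. *)
Lemma P_real_convM k xi u t phi : (forall x, continuous k x) -> smooth u -> 0 < t ->
  P_real xi (convM k u) t phi = convM k (P_real xi u) t phi.
Proof.
intros Hk Hu Ht; rewrite P_real_pos by (auto; now apply convM_smooth).
assert (E : forall i v, smooth v -> forall t phi, 0 < t ->
  pd i (convM k v) t phi = convM k (pd i v) t phi).
{ intros i v Hv s r Hs; exact (pd_convM k Hk 0 v i s r (Hv 1%nat) Hs). }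
rewrite (pd_ext Time _ _ t phi (E Time u Hu) Ht), (pd_ext Angle _ _ t phi (E Angle u Hu) Ht).
rewrite !E by auto using smooth_pd.
assert (C : forall v, smooth v -> forall x, continuous (v t) x) by (intros; now apply smooth_section).
unfold convM.
transitivity (conv k (fun phi => 1 * ((-1) * pd Time (pd Time u) t phi
    + (- / t) * pd Time u t phi) + (/ t * / t) * pd Angle (pd Angle u) t phi) phi).
- rewrite (conv_lincomb k 1), (conv_lincomb k (-1));
    try (apply C; auto using smooth_pd); auto.
  + ring.
  + intros x; apply continuous_Rplus;
      apply continuous_Rmult; try apply continuous_const;
      apply C; auto using smooth_pd.
- apply RInt_ext_all; intros th; rewrite P_real_pos by assumption; ring.
Qed.

Lemma Ccomp_real_parts f : Ccomp_real f ->
  sper (re_part f) /\ early (re_part f) /\ late (re_part f) /\ f = emb (re_part f).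
Proof.
intros [Hf Hi]; apply Ccomp_split in Hf; destruct Hf as [H1 [H2 [H3 [a [b [Ha [H4 H5]]]]]]].
split; [|split; [|split]].
- split; [assumption|]; intros t phi Ht; unfold re_part; now rewrite H1.
- exists a; split; [assumption|]; intros; apply H4; lra.
- exists b; intros; apply H4; lra.
- apply field_ext; intros t phi; apply injective_projections; [reflexivity|apply Hi].
Qed.

Section Green.
Variables (xi : R) (Dp Dm : field -> field).
Hypotheses (Hp : is_green xi J_plus Dp) (Hm : is_green xi J_minus Dm).

Lemma green_sper J D f : is_green xi J D -> Ccomp f ->
  sper (re_part (D f)) /\ sper (im_part (D f)).
Proof.
intros [H _] Hf; destruct (H f Hf) as [H1 [H2 H3]].
split; split; auto; intros t phi Ht; unfold re_part, im_part; now rewrite H1.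
Qed.

Lemma green_P J D f t phi : is_green xi J D -> Ccomp f -> 0 < t ->
  P_real xi (re_part (D f)) t phi = re_part f t phi /\
  P_real xi (im_part (D f)) t phi = im_part f t phi.
Proof.
intros [_ [_ [_ [H _]]]] Hf Ht; specialize (H f Hf t phi Ht).
split; [exact (f_equal Re H)|exact (f_equal Im H)].
Qed.

(** A point where [Dp f] is nonzero is in the causal future of the support of f, and time does not
    decrease along causal curves. *)
Lemma green_plus_zero f a t phi : Ccomp f -> (forall t phi, t < a -> f t phi = RtoC 0) ->
  0 < t < a -> Dp f t phi = RtoC 0.
Proof.
intros Hf H Ht; destruct Hp as [_ [_ [_ [_ [_ Hs]]]]].
apply NNPP; intros Hne; destruct (Hs f Hf (t, phi)) as [p [Sp Cp]].
- apply supp_nonzero; [lra|assumption].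
- apply (supp_time_ge f p a H) in Sp; apply causal_time in Cp; simpl in Cp; lra.
Qed.

Lemma green_minus_zero f b t phi : Ccomp f -> (forall t phi, b < t -> f t phi = RtoC 0) ->
  0 < t -> b < t -> Dm f t phi = RtoC 0.
Proof.
intros Hf H Ht Hb; destruct Hm as [_ [_ [_ [_ [_ Hs]]]]].
apply NNPP; intros Hne; destruct (Hs f Hf (t, phi)) as [p [Sp Cp]].
- now apply supp_nonzero.
- apply (supp_time_le f p b H) in Sp; apply causal_time in Cp; simpl in Cp; lra.
Qed.

Lemma green_plus_early f : Ccomp f -> early (re_part (Dp f)) /\ early (im_part (Dp f)).
Proof.
intros Hf; assert (Hf' := Hf); destruct Hf' as [_ [a [b [Ha H]]]].
assert (Z := fun t phi Ht => green_plus_zero f a t phi Hf (fun t phi Ht => H t phi (or_introl Ht)) Ht).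
split; exists a; split; auto; intros t phi Ht; unfold re_part, im_part; now rewrite Z.
Qed.

Lemma green_minus_late f : Ccomp f -> late (re_part (Dm f)) /\ late (im_part (Dm f)).
Proof.
intros Hf; assert (Hf' := Hf); destruct Hf' as [_ [a [b [Ha H]]]].
assert (Z := fun t phi Ht Hb =>
  green_minus_zero f b t phi Hf (fun t phi Ht => H t phi (or_intror Ht)) Ht Hb).
split; exists (Rmax b 0); intros t phi Ht; assert (A := Rmax_l b 0); assert (B := Rmax_r b 0);
  unfold re_part, im_part; rewrite Z by lra; reflexivity.
Qed.

(* A retarded solution of Pu = 0 is orthogonal to g = P(D_- g) for every test function g. *)
Lemma early_unique u : sper u -> null (P_real xi u) -> early u -> null u.
Proof.
intros Su H0 Eu; apply sper_zero_of_orthogonal; [assumption|]; intros g Tg.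
destruct (Ccomp_real_parts _ Tg) as [Sg [Eg [Lg _]]]; change (re_part (emb g)) with g in *.
destruct Tg as [Cg _].
set (v := re_part (Dm (emb g))).
assert (Sv : sper v) by (apply (green_sper J_minus); auto).
transitivity (Mint (mul u (P_real xi v))).
- apply Mint_ext.
  + destruct Su as [Hu _], Sg as [Hg _].
    split; [now apply smooth_mult|split; [now apply early_mul_l|now apply late_mul_l]].
  + intros t phi Ht; unfold mul, v.
    rewrite (proj1 (green_P J_minus Dm (emb g) t phi Hm Cg Ht)); unfold re_part, emb; simpl; ring.
- rewrite (green xi u v Su Sv Eu (proj1 (green_minus_late _ Cg))).
  apply Mint_null; intros t phi Ht; unfold mul; rewrite H0 by assumption; ring.
Qed.

(** The time reversal of the previous argument: g is written as P(D_+ g), and the two functions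
    exchange their places in Green's identity. *)
Lemma late_unique u : sper u -> null (P_real xi u) -> late u -> null u.
Proof.
intros Su H0 Lu; apply sper_zero_of_orthogonal; [assumption|]; intros g Tg.
destruct (Ccomp_real_parts _ Tg) as [Sg [Eg [Lg _]]]; change (re_part (emb g)) with g in *.
destruct Tg as [Cg _].
set (v := re_part (Dp (emb g))).
assert (Sv : sper v) by (apply (green_sper J_plus); auto).
transitivity (Mint (mul u (P_real xi v))).
- apply Mint_ext.
  + destruct Su as [Hu _], Sg as [Hg _].
    split; [now apply smooth_mult|split; [now apply early_mul_l|now apply late_mul_l]].
  + intros t phi Ht; unfold mul, v.
    rewrite (proj1 (green_P J_plus Dp (emb g) t phi Hp Cg Ht)); unfold re_part, emb; simpl; ring.
- rewrite <- (green xi v u Sv Su (proj1 (green_plus_early _ Cg)) Lu).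
  apply Mint_null; intros t phi Ht; unfold mul; rewrite H0 by assumption; ring.
Qed.

(** P is real, so the imaginary parts solve the homogeneous equation, one retarded and the other
    advanced. *)
Lemma green_real f : Ccomp_real f -> null (im_part (Dp f)) /\ null (im_part (Dm f)).
Proof.
intros [Hf Hi]; split.
- apply early_unique.
  + apply (green_sper J_plus); auto.
  + intros t phi Ht; rewrite (proj2 (green_P J_plus Dp f t phi Hp Hf Ht)); apply Hi.
  + now apply green_plus_early.
- apply late_unique.
  + apply (green_sper J_minus); auto.
  + intros t phi Ht; rewrite (proj2 (green_P J_minus Dm f t phi Hm Hf Ht)); apply Hi.
  + now apply green_minus_late.
Qed.

Definition propagator (f : field) : R -> R -> R :=
  lin 1 (-1) (re_part (Dp f)) (re_part (Dm f)).

Lemma propagator_sper f : Ccomp f -> sper (propagator f).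
Proof.
intros Hf; apply sper_lin; [now apply (green_sper J_plus)|now apply (green_sper J_minus)].
Qed.

(** The real number behind [omega] on real test functions: by [green_real] the imaginary part of
    [Delta g] vanishes, so the properties of the form can be proved with real integrals. *)
Definition pairing (f g : field) : R := Mint (mul (re_part f) (propagator g)).

Lemma compact_time_mul f u : Ccomp_real f -> sper u -> compact_time (mul (re_part f) u).
Proof.
intros Hf [Hu _]; destruct (Ccomp_real_parts f Hf) as [[Hs _] [He [Hl _]]].
split; [now apply smooth_mult|split; [now apply early_mul_l|now apply late_mul_l]].
Qed.

Lemma omega_pairing f g : Ccomp_real f -> Ccomp_real g ->
  omega (fun f => fminus (Dp f) (Dm f)) f g = RtoC (pairing f g).
Proof.
intros Hf Hg; unfold omega; apply integral_M_Mint.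
- apply compact_time_mul; [assumption|]; now apply propagator_sper, Hg.
- intros t phi Ht; destruct (green_real g Hg) as [H1 H2].
  specialize (H1 t phi Ht); specialize (H2 t phi Ht).
  destruct Hf as [_ Hi]; specialize (Hi t phi).
  unfold mul, propagator, lin, fminus, re_part, im_part, Re, Im in *.
  apply injective_projections; simpl; rewrite Hi, H1, H2; ring.
Qed.

Lemma pairing_plus_l f f' g : Ccomp_real f -> Ccomp_real f' -> Ccomp_real g ->
  pairing (fplus f f') g = pairing f g + pairing f' g.
Proof.
intros Hf Hf' Hg; assert (Sg := propagator_sper g (proj1 Hg)).
transitivity (1 * pairing f g + 1 * pairing f' g); [|ring]; unfold pairing.
rewrite <- Mint_lin by now apply compact_time_mul.
symmetry; apply Mint_ext.
- apply compact_time_lin; now apply compact_time_mul.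
- intros t phi Ht; unfold lin, mul, re_part, fplus, Re; simpl; ring.
Qed.

Lemma pairing_scal_l k f g : Ccomp_real f -> Ccomp_real g ->
  pairing (fscal (RtoC k) f) g = k * pairing f g.
Proof.
intros Hf Hg; assert (Sg := propagator_sper g (proj1 Hg)).
transitivity (k * pairing f g + 0 * pairing f g); [|ring]; unfold pairing.
rewrite <- Mint_lin by now apply compact_time_mul.
symmetry; apply Mint_ext.
- apply compact_time_lin; now apply compact_time_mul.
- intros t phi Ht; unfold lin, mul; rewrite re_part_scal; ring.
Qed.

(** Green's identity makes D_+ and D_- formal adjoints of each other; the two terms of Delta are
    exchanged with opposite signs. *)
Lemma pairing_antisymmetric f g : Ccomp_real f -> Ccomp_real g -> pairing f g = - pairing g f.
Proof.
assert (Split : forall f g, Ccomp_real f -> Ccomp_real g -> pairing f g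
  = Mint (mul (re_part f) (re_part (Dp g))) - Mint (mul (re_part f) (re_part (Dm g)))).
{ intros f' g' Hf Hg.
  assert (S1 := proj1 (green_sper J_plus Dp g' Hp (proj1 Hg))).
  assert (S2 := proj1 (green_sper J_minus Dm g' Hm (proj1 Hg))).
  transitivity (1 * Mint (mul (re_part f') (re_part (Dp g')))
    + (-1) * Mint (mul (re_part f') (re_part (Dm g')))); [|ring].
  rewrite <- Mint_lin by now apply compact_time_mul.
  symmetry; apply Mint_ext; [apply compact_time_lin; now apply compact_time_mul|].
  intros t phi Ht; unfold lin, mul, propagator, lin; ring. }
assert (Swap : forall f g, Ccomp_real f -> Ccomp_real g ->
  Mint (mul (re_part f) (re_part (Dp g))) = Mint (mul (re_part g) (re_part (Dm f)))).
{ intros f' g' Hf Hg.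
  assert (S1 := proj1 (green_sper J_plus Dp g' Hp (proj1 Hg))).
  assert (S2 := proj1 (green_sper J_minus Dm f' Hm (proj1 Hf))).
  transitivity (Mint (mul (re_part (Dp g')) (P_real xi (re_part (Dm f'))))).
  - apply Mint_ext; [now apply compact_time_mul|]; intros t phi Ht; unfold mul.
    rewrite (proj1 (green_P J_minus Dm f' t phi Hm (proj1 Hf) Ht)); ring.
  - rewrite (green xi _ _ S1 S2 (proj1 (green_plus_early _ (proj1 Hg)))
      (proj1 (green_minus_late _ (proj1 Hf)))).
    symmetry; apply Mint_ext; [now apply compact_time_mul|]; intros t phi Ht; unfold mul.
    rewrite (proj1 (green_P J_plus Dp g' t phi Hp (proj1 Hg) Ht)); ring. }
intros Hf Hg; rewrite !Split, (Swap f g), (Swap g f) by assumption; ring.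
Qed.

Lemma propagator_P h : Ccomp h -> null (propagator (P_op xi h)).
Proof.
intros Hh t phi Ht; destruct Hp as [_ [_ [_ [_ [E1 _]]]]], Hm as [_ [_ [_ [_ [E2 _]]]]].
unfold propagator, lin, re_part; rewrite (E1 h Hh t phi Ht), (E2 h Hh t phi Ht); ring.
Qed.

Lemma pairing_P f h : Ccomp h -> pairing f (P_op xi h) = 0.
Proof.
intros Hh; apply Mint_null; intros t phi Ht; unfold mul; rewrite propagator_P by assumption; ring.
Qed.

(* If D_+ f = D_- f then this common value has compact support. *)
Lemma propagator_null_P_image f : Ccomp_real f -> null (propagator f) -> P_image xi f.
Proof.
intros Hf H0; assert (Cf := proj1 Hf).
set (u := re_part (Dp f)).
(* Compactly supported functions are extended by 0 to t <= 0, whereas the values of [Dp f] there are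
   arbitrary; they are replaced by 0. *)
set (w := fun t phi => if Rlt_dec 0 t then u t phi else 0).
assert (Su : sper u) by (apply (green_sper J_plus); auto).
assert (Ew : forall t phi, 0 < t -> u t phi = w t phi).
{ intros t phi Ht; unfold w; destruct (Rlt_dec 0 t); [reflexivity|lra]. }
destruct Cf as [_ [a [b [Ha Sf]]]].
assert (Sw : tsupp a b w).
{ intros t phi Ht; unfold w; destruct (Rlt_dec 0 t) as [Ht0|]; [|reflexivity].
  destruct Ht as [Ht|Ht].
  - unfold u, re_part; rewrite (green_plus_zero f a t phi (proj1 Hf)); [reflexivity| |lra].
    intros; apply Sf; lra.
  - specialize (H0 t phi Ht0); unfold propagator, lin in H0; fold u in H0.
    assert (E : re_part (Dm f) t phi = 0).
    { unfold re_part; rewrite (green_minus_zero f b t phi (proj1 Hf)); auto. }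
    rewrite E in H0; lra. }
assert (Cw : smooth w) by (apply (smooth_ext u); [assumption|apply Su]).
assert (Hw : Ccomp_real (emb w)).
{ split; [|reflexivity]; apply Ccomp_split; split; [|split; [|split]].
  - intros t phi Ht; unfold emb; rewrite <- !Ew by assumption; f_equal; now apply Su.
  - exact Cw.
  - exact (smooth_const 0).
  - exists a, b; split; [assumption|]; split; [exact Sw|]; intros t phi _; reflexivity. }
exists (emb w); split; [exact Hw|].
apply field_ext; intros t phi; apply injective_projections.
- change (re_part f t phi = P_real xi w t phi).
  destruct (Rlt_dec 0 t) as [Ht|Ht].
  + rewrite <- (proj1 (green_P J_plus Dp f t phi Hp (proj1 Hf) Ht)); fold u.
    rewrite !P_real_pos by (auto; apply Su).
    assert (E : forall i t phi, 0 < t -> pd i u t phi = pd i w t phi)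
      by (intros; now apply pd_ext).
    rewrite (E Time), (pd_ext Time _ _ t phi (E Time)), (pd_ext Angle _ _ t phi (E Angle))
      by assumption; reflexivity.
  + rewrite (tsupp_P a b) by (auto; lra); unfold re_part; rewrite Sf by lra; reflexivity.
- destruct (P_op_Ccomp_real xi _ Hw) as [_ Hi'].
  transitivity 0; [apply Hf|symmetry; apply Hi'].
Qed.

Lemma pairing_nondegenerate f : Ccomp_real f ->
  (forall g, Ccomp_real g -> pairing g f = 0) -> P_image xi f.
Proof.
intros Hf H; apply propagator_null_P_image; [assumption|].
apply sper_zero_of_orthogonal; [apply propagator_sper, Hf|]; intros g Tg; exact (H (emb g) Tg).
Qed.

(** * [S] and the causal propagator *)

Section Smearing.
Variables (lambda : R) (Hl : 0 < lambda).

Lemma S_op_P f : Ccomp f -> S_op lambda (P_op xi f) = P_op xi (S_op lambda f).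
Proof.
intros Hf; assert (Hk := kernel_continuous lambda Hl).
assert (HPf := P_op_Ccomp xi f Hf).
destruct (S_op_convM lambda f Hl Hf) as [Er Ei].
assert (Hf' := Hf); apply Ccomp_split in Hf'; destruct Hf' as [_ [H2 [H3 [a [b [Ha [H4 H5]]]]]]].
assert (K : forall u, smooth u -> tsupp a b u -> forall t phi,
  convM (kernel lambda) (P_real xi u) t phi = P_real xi (convM (kernel lambda) u) t phi).
{ intros u Hu Su t phi; destruct (Rlt_dec 0 t) as [Ht|Ht].
  - symmetry; now apply P_real_convM.
  - rewrite (convM_tsupp _ a b), (tsupp_P a b); try lra; auto.
    + now apply convM_tsupp.
    + now apply tsupp_P. }
apply field_ext; intros t phi; rewrite (S_op_conv lambda _ t phi Hl HPf).
unfold P_op at 3; rewrite Er, Ei, <- !K by assumption; reflexivity.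
Qed.

(** D(S f) and S applied to D f both solve P u = S f and are both retarded, or both advanced, so
    uniqueness identifies them. As D f lacks compact support, [S] acts on it as [convM]. *)
Lemma propagator_S f : Ccomp f -> forall t phi, 0 < t ->
  propagator (S_op lambda f) t phi = convM (kernel lambda) (propagator f) t phi.
Proof.
intros Hf; assert (Hk := kernel_continuous lambda Hl).
assert (HS := S_op_Ccomp lambda f Hl Hf); destruct (S_op_convM lambda f Hl Hf) as [Er _].
assert (K : forall J D, is_green xi J D ->
  let d := lin 1 (-1) (re_part (D (S_op lambda f))) (convM (kernel lambda) (re_part (D f))) in
  sper d /\ null (P_real xi d)).
{ intros J D HD d.
  assert (S1 := proj1 (green_sper J D _ HD HS)); assert (S2 := proj1 (green_sper J D _ HD Hf)).
  assert (S3 : sper (convM (kernel lambda) (re_part (D f)))).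
  { split; [apply convM_smooth|apply convM_periodic]; auto; apply S2. }
  split; [now apply sper_lin|]; intros t phi Ht; unfold d.
  rewrite P_real_lin, P_real_convM by (auto; first [apply S1|apply S2|apply S3]).
  rewrite (proj1 (green_P J D _ t phi HD HS Ht)), Er.
  replace (convM (kernel lambda) (P_real xi (re_part (D f))) t phi)
    with (convM (kernel lambda) (re_part f) t phi); [ring|].
  apply RInt_ext_all; intros th; now rewrite (proj1 (green_P J D _ t _ HD Hf Ht)). }
assert (Np : null (lin 1 (-1) (re_part (Dp (S_op lambda f)))
  (convM (kernel lambda) (re_part (Dp f))))).
{ destruct (K J_plus Dp Hp) as [K1 K2]; apply early_unique; auto.
  apply early_lin; [now apply green_plus_early|].
  destruct (proj1 (green_plus_early f Hf)) as [a [Ha Hz]]; exists a; split; [assumption|].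
  intros; apply convM_zero; auto. }
assert (Nm : null (lin 1 (-1) (re_part (Dm (S_op lambda f)))
  (convM (kernel lambda) (re_part (Dm f))))).
{ destruct (K J_minus Dm Hm) as [K1 K2]; apply late_unique; auto.
  apply late_lin; [now apply green_minus_late|].
  destruct (proj1 (green_minus_late f Hf)) as [b Hz]; exists b; intros; apply convM_zero; auto. }
intros t phi Ht; specialize (Np t phi Ht); specialize (Nm t phi Ht).
assert (S1 := proj1 (green_sper J_plus Dp f Hp Hf)).
assert (S2 := proj1 (green_sper J_minus Dm f Hm Hf)).
unfold propagator at 2, convM, lin.
rewrite (conv_lincomb (kernel lambda)); auto;
  try (intros x; apply smooth_section; [first [apply S1|apply S2]|assumption]).
unfold propagator, lin, convM in *; lra.
Qed.

Lemma pairing_S_symmetric f g : Ccomp_real f -> Ccomp_real g ->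
  pairing f (S_op lambda g) = pairing (S_op lambda f) g.
Proof.
intros Hf Hg; assert (Sg := propagator_sper g (proj1 Hg)).
assert (HSg := S_op_Ccomp_real lambda g Hl Hg).
destruct (Ccomp_real_parts f Hf) as [Sf [Ef [Lf _]]].
unfold pairing.
rewrite (proj1 (S_op_convM lambda f Hl (proj1 Hf))).
rewrite <- (Mint_convM_symmetric lambda) by assumption.
apply Mint_ext.
- apply compact_time_mul; [assumption|]; now apply propagator_sper, HSg.
- intros t phi Ht; unfold mul; rewrite propagator_S; auto; apply Hg.
Qed.

(** Symmetry of [S] and antisymmetry turn the hypothesis into pairing(g, S S f) = 0 for all test
    functions g. So the propagator of S S f is null; it is the convolution applied twice to that of
    f, hence the latter is null. *)
Lemma pairing_S_S_nondegenerate f : Ccomp_real f ->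
  (forall g, Ccomp_real g -> pairing (S_op lambda f) (S_op lambda g) = 0) -> P_image xi f.
Proof.
intros Hf H; assert (HSf := S_op_Ccomp_real lambda f Hl Hf).
assert (HSSf := S_op_Ccomp_real lambda _ Hl HSf).
assert (N : null (propagator (S_op lambda (S_op lambda f)))).
{ apply sper_zero_of_orthogonal; [apply propagator_sper, HSSf|]; intros g Tg.
  change (pairing (emb g) (S_op lambda (S_op lambda f)) = 0).
  assert (HSg := S_op_Ccomp_real lambda _ Hl Tg).
  rewrite pairing_S_symmetric, pairing_antisymmetric, H by assumption; ring. }
assert (Inj : forall h, Ccomp h -> null (propagator (S_op lambda h)) -> null (propagator h)).
{ intros h Hh Nh t phi Ht; destruct (propagator_sper h Hh) as [Sh Ph].
  apply (conv_kernel_injective lambda Hl (propagator h t)).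
  - intros x; now apply smooth_section.
  - intros x; now apply Ph.
  - intros x; change (convM (kernel lambda) (propagator h) t x = 0).
    rewrite <- propagator_S by assumption; now apply Nh. }
apply propagator_null_P_image; [assumption|].
apply Inj; [apply Hf|]; apply Inj; [apply HSf|exact N].
Qed.

End Smearing.
End Green.

(** * Symplectic quotients *)

Notation FM := field_ModuleSpace.

Lemma coset_in_U (U N : subspace FM) : (forall f, N f -> U f) ->
  forall (X : quot FM U N) f, X f -> U f.
Proof.
intros HNU X f Hf.
assert (E : f = plus (minus f (repr X)) (repr X)) by (symmetry; exact (plus_minus_cancel (G := FM) f (repr X))).
rewrite E; apply (sub_plus FM U); [|apply repr_U].
apply HNU, (quot_rel FM U N X); [apply repr_in|assumption].
Qed.

(** Instantiated for the three symplectic spaces: [om] is the complex-valued form, [B] its real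
    values. Linearity is supposed in the first argument and nullity on [N] in the second;
    antisymmetry carries each to the other side. *)
Section QuotientForm.
Variables (U N : subspace FM) (om : field -> field -> C) (B : field -> field -> R).
Hypotheses (HNU : forall f, N f -> U f)
  (Hom : forall f g, U f -> U g -> om f g = RtoC (B f g))
  (Bplus : forall f f' g, U f -> U f' -> U g -> B (fplus f f') g = B f g + B f' g)
  (Bscal : forall k f g, U f -> U g -> B (fscal (RtoC k) f) g = k * B f g)
  (Banti : forall f g, U f -> U g -> B f g = - B g f)
  (Bnull : forall f g, U f -> N g -> B f g = 0)
  (Bnondeg : forall f, U f -> (forall g, U g -> B g f = 0) -> N f).

Lemma form_coset_l (X : quot FM U N) f f' g : X f -> X f' -> U g -> B f g = B f' g.
Proof.
intros Hf Hf' Hg.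
assert (Hn : N (minus f f')) by now apply (quot_rel FM U N X).
assert (E : f = plus (minus f f') f') by (symmetry; exact (plus_minus_cancel (G := FM) f f')).
rewrite E; change (B (fplus (minus f f') f') g = B f' g).
assert (Hf'U := coset_in_U U N HNU X f' Hf').
rewrite Bplus, (Banti (minus f f')), Bnull by auto; ring.
Qed.

Lemma form_coset (X Y : quot FM U N) f f' g g' :
  X f -> X f' -> Y g -> Y g' -> B f g = B f' g'.
Proof.
intros Hf Hf' Hg Hg'.
assert (H1 := coset_in_U U N HNU X f Hf); assert (H2 := coset_in_U U N HNU X f' Hf').
assert (H3 := coset_in_U U N HNU Y g Hg); assert (H4 := coset_in_U U N HNU Y g' Hg').
rewrite (form_coset_l X f f' g), (Banti f' g), (form_coset_l Y g g' f'), (Banti g' f') by auto.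
ring.
Qed.

Lemma quot_form_eq (X Y : quot FM U N) f g : X f -> Y g -> quot_form om X Y = B f g.
Proof.
intros Hf Hg; unfold quot_form; rewrite Hom by apply repr_U.
exact (form_coset X Y _ _ _ _ (repr_in _ _ _ X) Hf (repr_in _ _ _ Y) Hg).
Qed.

Lemma quot_form_descends : descends_to om (quot_form (U := U) (N := N) om).
Proof.
intros X Y f g Hf Hg; rewrite (quot_form_eq X Y f g) by assumption.
apply Hom; [exact (coset_in_U U N HNU X f Hf)|exact (coset_in_U U N HNU Y g Hg)].
Qed.

Lemma quot_form_symplectic :
  symplectic_form (V := quot_ModuleSpace FM U N) (quot_form (U := U) (N := N) om).
Proof.
assert (Q : forall X Y : quot FM U N, quot_form om X Y = B (repr X) (repr Y))
  by (intros; apply quot_form_eq; apply repr_in).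
assert (Pl : forall X Y Z : quot FM U N,
  quot_form om (quot_plus FM U N X Y) Z = quot_form om X Z + quot_form om Y Z).
{ intros X Y Z.
  rewrite (quot_form_eq (quot_plus FM U N X Y) Z (plus (repr X) (repr Y)) (repr Z)), !Q.
  - apply Bplus; apply repr_U.
  - apply quot_plus_in; apply repr_in.
  - apply repr_in. }
assert (Sc : forall k (X Z : quot FM U N),
  quot_form om (quot_scal FM U N k X) Z = k * quot_form om X Z).
{ intros k X Z.
  rewrite (quot_form_eq (quot_scal FM U N k X) Z (scal k (repr X)) (repr Z)), Q.
  - apply Bscal; apply repr_U.
  - apply quot_scal_in, repr_in.
  - apply repr_in. }
assert (An : forall X Y : quot FM U N, quot_form om X Y = - quot_form om Y X)
  by (intros; rewrite !Q; apply Banti; apply repr_U).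
split; [exact Pl|split; [exact Sc|split; [|split; [|split; [exact An|]]]]].
- intros X Y Z; rewrite An; rewrite (An X Y), (An X Z).
  transitivity (- (quot_form om Y X + quot_form om Z X)); [f_equal; apply Pl|ring].
- intros k X Y; rewrite An, (An X Y).
  transitivity (- (k * quot_form om Y X)); [f_equal; apply Sc|ring].
- intros X H; apply (quot_ext FM U N X (quot_zero FM U N) (repr X)); [apply repr_in|].
  apply (quot_rel FM U N (quot_zero FM U N) zero); [apply quot_zero_in|].
  apply sub_minus; [|apply sub_zero].
  apply Bnondeg; [apply repr_U|]; intros g Hg.
  rewrite <- (quot_form_eq (cls FM U N g Hg) X g (repr X) (cls_self FM U N g Hg) (repr_in FM U N X)).
  rewrite An, H; ring.
Qed.

End QuotientForm.

Lemma linear_on_minus (A : subspace FM) (T : FM -> FM) f g : linear_on A T -> A f -> A g ->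
  T (minus f g) = minus (T f) (T g).
Proof.
intros [Tp Ts] Hf Hg; unfold minus; rewrite Tp by (auto; now apply sub_opp).
f_equal; rewrite <- (scal_opp_one (K := R_Ring) g), <- (scal_opp_one (K := R_Ring) (T g)).
now apply Ts.
Qed.

(** Instantiated twice with [Op = S]: with target [S_image] modulo [SP_image] for the isomorphism,
    with target [test_real] modulo [P_image] for the embedding. *)
Section InducedMap.
Variables (U N U' N' : subspace FM) (Op : field -> field).
Hypotheses (HNU : forall f, N f -> U f)
  (HOp : linear_on (E := FM) (F := FM) U Op)
  (HU : forall f, U f -> U' (Op f)) (HN : forall f, N f -> N' (Op f)).

Definition quot_map (X : quot FM U N) : quot FM U' N' :=
  cls FM U' N' (Op (repr X)) (HU _ (repr_U FM U N X)).

Lemma quot_map_induced : induced_by Op quot_map.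
Proof.
intros X f Hf; simpl.
assert (Hf' := coset_in_U U N HNU X f Hf).
rewrite <- (linear_on_minus U Op) by (auto; apply repr_U).
apply HN, (quot_rel FM U N X); [apply repr_in|assumption].
Qed.

Lemma quot_map_linear :
  linear_map (E := quot_ModuleSpace FM U N) (F := quot_ModuleSpace FM U' N') quot_map.
Proof.
split.
- intros X Y _ _; apply (quot_ext FM U' N' _ _ (Op (plus (repr X) (repr Y)))).
  + apply quot_map_induced; apply quot_plus_in; apply repr_in.
  + rewrite (proj1 HOp) by apply repr_U.
    apply quot_plus_in; apply quot_map_induced, repr_in.
- intros k X _; apply (quot_ext FM U' N' _ _ (Op (scal k (repr X)))).
  + apply quot_map_induced; apply quot_scal_in, repr_in.
  + rewrite (proj2 HOp) by apply repr_U.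
    apply quot_scal_in; apply quot_map_induced, repr_in.
Qed.

Lemma quot_map_injective : (forall f, U f -> N' (Op f) -> N f) -> Injective quot_map.
Proof.
intros Hinj X Y H.
apply (quot_ext FM U N X Y (repr X)); [apply repr_in|].
apply (quot_rel FM U N Y (repr Y)); [apply repr_in|].
apply Hinj; [apply sub_minus; apply repr_U|].
rewrite (linear_on_minus U Op) by (auto; apply repr_U).
assert (H1 := quot_map_induced X _ (repr_in FM U N X)).
assert (H2 := quot_map_induced Y _ (repr_in FM U N Y)).
rewrite H in H1; now apply (quot_rel FM U' N' (quot_map Y)).
Qed.

Lemma quot_map_surjective : (forall g, U' g -> exists f, U f /\ g = Op f) ->
  Surjective quot_map.
Proof.
intros Hs Y; destruct (Hs (repr Y) (repr_U FM U' N' Y)) as [f [Hf E]].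
exists (cls FM U N f Hf); apply (quot_ext FM U' N' _ _ (Op f)).
- apply quot_map_induced, cls_self.
- rewrite <- E; apply repr_in.
Qed.

End InducedMap.

Lemma bijective_of {A B : Type} (f : A -> B) : Injective f -> Surjective f -> Bijective f.
Proof.
intros Hi Hs.
exists (fun y => proj1_sig (constructive_indefinite_description _ (Hs y))); split.
- intros x; apply Hi; exact (proj2_sig (constructive_indefinite_description _ (Hs (f x)))).
- intros y; exact (proj2_sig (constructive_indefinite_description _ (Hs y))).
Qed.

Theorem mainTheorem12 (xi : R) (lambda : posreal) (Delta_plus Delta_minus : field -> field)
    (Hplus : is_green xi J_plus Delta_plus)
    (Hminus : is_green xi J_minus Delta_minus) :
  let S := S_op lambda in
  let Delta := fun f => fminus (Delta_plus f) (Delta_minus f) in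
  let om := omega Delta in
  let om_star := fun f g => omega Delta f (S (S g)) in
  let V := V_space xi in
  let V_img := V_img_space lambda xi in
  let omV : V -> V -> R := quot_form om in
  let omV_star : V -> V -> R := quot_form om_star in
  let omV_img : V_img -> V_img -> R := quot_form om in
  (* S maps C_0^oo(M) into itself, with the prescribed Fourier coefficients,
     and C_0^oo(M,R) into itself *)
  (forall f, Ccomp f ->
     Ccomp (S f) /\
     forall t n, 0 < t ->
       fourier (S f) t n = Cmult (RtoC (/ sqrt (cosh (3 * lambda * IZR n)))) (fourier f t n)) /\
  (forall f, Ccomp_real f -> Ccomp_real (S f)) /\
  (* S is a linear isomorphism onto its image, a proper subspace of C_0^oo(M) *)
  (forall f g, Ccomp f -> Ccomp g -> S (fplus f g) = fplus (S f) (S g)) /\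
  (forall c f, Ccomp f -> S (fscal c f) = fscal c (S f)) /\
  (forall f g, Ccomp f -> Ccomp g -> S f = S g -> f = g) /\
  (exists g, Ccomp g /\ ~ image_pred S Ccomp g) /\
  (* (V, omega), (V_star, omega_star) and (V_img, omega) are symplectic spaces *)
  (descends_to om omV /\ symplectic_form omV) /\
  (descends_to om_star omV_star /\ symplectic_form omV_star) /\
  (descends_to om omV_img /\ symplectic_form omV_img) /\
  (* the induced symplectic isomorphism T and symplectic embedding J *)
  exists (T : V -> V_img) (J : V -> V),
    (induced_by S T /\ symplectic_map omV_star omV_img T /\ Bijective T) /\
    (induced_by S J /\ symplectic_map omV_star omV J /\ Injective J) /\
    forall (A_star A_img A : CStarAlgebra)
      (W_star : V -> A_star) (W_img : V_img -> A_img) (W : V -> A),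
      weyl_algebra omV_star A_star W_star ->
      weyl_algebra omV_img A_img W_img ->
      weyl_algebra omV A W ->
      induces_unique_injective_morphism T A_star A_img W_star W_img /\
      induces_unique_injective_morphism J A_star A W_star W.
Proof.
intros S Delta om om_star V V_img omV omV_star omV_img.
assert (Hl := cond_pos lambda).
set (B := pairing Delta_plus Delta_minus).
assert (SR : forall f, Ccomp_real f -> Ccomp_real (S f))
  by (intros; now apply S_op_Ccomp_real).
assert (PR : forall f, P_image xi f -> Ccomp_real f)
  by (intros f [h [Hh ->]]; now apply P_op_Ccomp_real).
assert (Slin : linear_on (E := FM) (F := FM) test_real S)
  by (apply S_op_linear, test_real_Ccomp).
assert (HB : forall f g, Ccomp_real f -> Ccomp_real g -> om f g = RtoC (B f g))
  by (intros; now apply (omega_pairing xi)).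
assert (Bplus : forall f f' g, Ccomp_real f -> Ccomp_real f' -> Ccomp_real g ->
  B (fplus f f') g = B f g + B f' g) by (intros; now apply (pairing_plus_l xi)).
assert (Bscal : forall k f g, Ccomp_real f -> Ccomp_real g ->
  B (fscal (RtoC k) f) g = k * B f g) by (intros; now apply (pairing_scal_l xi)).
assert (Banti : forall f g, Ccomp_real f -> Ccomp_real g -> B f g = - B g f)
  by (intros; now apply (pairing_antisymmetric xi)).
assert (Bnull : forall f g, P_image xi g -> B f g = 0)
  by (intros f g [h [[Hh _] ->]]; now apply (pairing_P xi)).
assert (SP : forall f, P_image xi f -> P_image xi (S f)).
{ intros f [h [Hh ->]]; exists (S h); split; [now apply SR|].
  apply S_op_P; [exact Hl|apply Hh]. }
(* The identity omega_star(f, g) = omega(Sf, Sg), on which antisymmetry and nondegeneracy of the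
   deformed form and the symplecticity of both maps rest. *)
assert (BS : forall f g, Ccomp_real f -> Ccomp_real g -> B f (S (S g)) = B (S f) (S g)).
{ intros f g Hf Hg; exact (pairing_S_symmetric xi _ _ Hplus Hminus lambda Hl f (S g) Hf (SR _ Hg)). }
assert (SPS : forall f, SP_image lambda xi f -> P_image xi f)
  by (intros f [h [Hh ->]]; now apply SP).
assert (SPU : forall f, SP_image lambda xi f -> S_image lambda f)
  by (intros f [h [Hh ->]]; exists h; split; [now apply PR|reflexivity]).
assert (IR : forall f, S_image lambda f -> Ccomp_real f)
  by (intros f [h [Hh ->]]; now apply SR).
assert (F1 : descends_to om omV /\ symplectic_form omV).
{ split.
  - exact (quot_form_descends test_real (P_image xi) om B PR HB Bplus Banti
      (fun f g _ => Bnull f g)).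
  - exact (quot_form_symplectic test_real (P_image xi) om B PR HB Bplus Bscal Banti
      (fun f g _ => Bnull f g) (pairing_nondegenerate xi _ _ Hplus Hminus)). }
set (B_star := fun f g => B f (S (S g))).
assert (HB_star : forall f g, Ccomp_real f -> Ccomp_real g -> om_star f g = RtoC (B_star f g))
  by (intros f g Hf Hg; exact (HB f (S (S g)) Hf (SR _ (SR _ Hg)))).
assert (B_star_plus : forall f f' g, Ccomp_real f -> Ccomp_real f' -> Ccomp_real g ->
  B_star (fplus f f') g = B_star f g + B_star f' g)
  by (intros f f' g Hf Hf' Hg; exact (Bplus f f' _ Hf Hf' (SR _ (SR _ Hg)))).
assert (B_star_scal : forall k f g, Ccomp_real f -> Ccomp_real g ->
  B_star (fscal (RtoC k) f) g = k * B_star f g)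
  by (intros k f g Hf Hg; exact (Bscal k f _ Hf (SR _ (SR _ Hg)))).
assert (B_star_anti : forall f g, Ccomp_real f -> Ccomp_real g -> B_star f g = - B_star g f).
{ intros f g Hf Hg; unfold B_star; rewrite (BS f g Hf Hg), (BS g f Hg Hf).
  exact (Banti _ _ (SR _ Hf) (SR _ Hg)). }
assert (B_star_null : forall f g, P_image xi g -> B_star f g = 0)
  by (intros f g Hg; exact (Bnull f _ (SP _ (SP _ Hg)))).
assert (B_star_nondeg : forall f, Ccomp_real f ->
  (forall g, Ccomp_real g -> B_star g f = 0) -> P_image xi f).
{ intros f Hf H; apply (pairing_S_S_nondegenerate xi _ _ Hplus Hminus lambda Hl f Hf).
  intros g Hg; change (B (S f) (S g) = 0); rewrite <- (BS f g Hf Hg); change (B_star f g = 0).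
  rewrite (B_star_anti f g Hf Hg), (H g Hg); ring. }
assert (F2 : descends_to om_star omV_star /\ symplectic_form omV_star).
{ split.
  - exact (quot_form_descends test_real (P_image xi) om_star B_star PR HB_star B_star_plus
      B_star_anti (fun f g _ => B_star_null f g)).
  - exact (quot_form_symplectic test_real (P_image xi) om_star B_star PR HB_star B_star_plus
      B_star_scal B_star_anti (fun f g _ => B_star_null f g) B_star_nondeg). }
(* Here again the form is tested on elements S g only, so it is nondegeneracy of omega(Sf, Sg) that
   applies. *)
assert (B_img_nondeg : forall f, S_image lambda f ->
  (forall g, S_image lambda g -> B g f = 0) -> SP_image lambda xi f).
{ intros f [h [Hh ->]] H; exists h; split; [|reflexivity].
  apply (pairing_S_S_nondegenerate xi _ _ Hplus Hminus lambda Hl h Hh).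
  intros g Hg; change (B (S h) (S g) = 0).
  rewrite (Banti _ _ (SR _ Hh) (SR _ Hg)).
  assert (E : B (S g) (S h) = 0) by (apply H; exists g; now split).
  rewrite E; ring. }
assert (F3 : descends_to om omV_img /\ symplectic_form omV_img).
{ split.
  - exact (quot_form_descends (S_image lambda) (SP_image lambda xi) om B SPU
      (fun f g Hf Hg => HB f g (IR f Hf) (IR g Hg))
      (fun f f' g Hf Hf' Hg => Bplus f f' g (IR f Hf) (IR f' Hf') (IR g Hg))
      (fun f g Hf Hg => Banti f g (IR f Hf) (IR g Hg))
      (fun f g _ Hg => Bnull f g (SPS g Hg))).
  - exact (quot_form_symplectic (S_image lambda) (SP_image lambda xi) om B SPU
      (fun f g Hf Hg => HB f g (IR f Hf) (IR g Hg))
      (fun f f' g Hf Hf' Hg => Bplus f f' g (IR f Hf) (IR f' Hf') (IR g Hg))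
      (fun k f g Hf Hg => Bscal k f g (IR f Hf) (IR g Hg))
      (fun f g Hf Hg => Banti f g (IR f Hf) (IR g Hg))
      (fun f g _ Hg => Bnull f g (SPS g Hg)) B_img_nondeg). }
assert (HU1 : forall f, test_real f -> S_image lambda (S f)) by (intros f Hf; now exists f).
assert (HN1 : forall f, P_image xi f -> SP_image lambda xi (S f)) by (intros f Hf; now exists f).
set (T := quot_map test_real (P_image xi) (S_image lambda) (SP_image lambda xi) S HU1 : V -> V_img).
set (J := quot_map test_real (P_image xi) test_real (P_image xi) S SR : V -> V).
assert (HT : induced_by S T).
{ exact (quot_map_induced test_real (P_image xi) (S_image lambda) (SP_image lambda xi) S PR Slin HU1 HN1). }
assert (HJ : induced_by S J).
{ exact (quot_map_induced test_real (P_image xi) test_real (P_image xi) S PR Slin SR SP). }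
assert (Star : forall X Y : V, omV_star X Y = B (S (repr X)) (S (repr Y))).
{ intros X Y; unfold omV_star, quot_form, om_star.
  rewrite <- (BS _ _ (repr_U _ _ _ X) (repr_U _ _ _ Y)).
  assert (E := HB (repr X) (S (S (repr Y))) (repr_U _ _ _ X) (SR _ (SR _ (repr_U _ _ _ Y)))).
  unfold om in E; rewrite E; reflexivity. }
assert (MT : symplectic_map omV_star omV_img T).
{ split.
  - exact (quot_map_linear test_real (P_image xi) (S_image lambda) (SP_image lambda xi) S PR Slin HU1 HN1).
  - intros X Y; transitivity (B (S (repr X)) (S (repr Y))); [|symmetry; exact (Star X Y)].
    assert (E := proj1 F3 (T X) (T Y) _ _ (HT X _ (repr_in _ _ _ X)) (HT Y _ (repr_in _ _ _ Y))).
    rewrite (HB _ _ (SR _ (repr_U _ _ _ X)) (SR _ (repr_U _ _ _ Y))) in E.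
    symmetry; exact (f_equal Re E). }
assert (MJ : symplectic_map omV_star omV J).
{ split.
  - exact (quot_map_linear test_real (P_image xi) test_real (P_image xi) S PR Slin SR SP).
  - intros X Y; transitivity (B (S (repr X)) (S (repr Y))); [|symmetry; exact (Star X Y)].
    assert (E := proj1 F1 (J X) (J Y) _ _ (HJ X _ (repr_in _ _ _ X)) (HJ Y _ (repr_in _ _ _ Y))).
    rewrite (HB _ _ (SR _ (repr_U _ _ _ X)) (SR _ (repr_U _ _ _ Y))) in E.
    symmetry; exact (f_equal Re E). }
split; [|split; [exact SR|split; [|split; [|split; [|split; [|split; [exact F1|
  split; [exact F2|split; [exact F3|]]]]]]]]].
- intros f Hf; split; [now apply S_op_Ccomp|]; intros t n _; now apply S_op_fourier.
- intros f g Hf Hg; now apply S_op_plus.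
- intros c f Hf; now apply S_op_scal_C.
- intros f g Hf Hg H; now apply (S_op_injective lambda).
- now apply S_op_not_surjective.
- exists T, J; split; [|split].
  + split; [exact HT|split; [exact MT|]]; apply bijective_of.
    * apply (quot_map_injective test_real (P_image xi) (S_image lambda) (SP_image lambda xi) S PR Slin HU1 HN1).
      (* S f = S h with h in the image of P, so f = h by injectivity of [S]. *)
      intros f Hf [h [Hh E]].
      rewrite (S_op_injective lambda f h Hl (proj1 Hf) (P_image_Ccomp xi h Hh) E); exact Hh.
    * apply (quot_map_surjective test_real (P_image xi) (S_image lambda) (SP_image lambda xi) S PR Slin HU1 HN1).
      intros g [f Hf]; now exists f.
  + split; [exact HJ|split; [exact MJ|]].
    apply (quot_map_injective test_real (P_image xi) test_real (P_image xi) S PR Slin SR SP).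
    (* Here S f is in the image of P, with no preimage under S P at hand, so injectivity of [S] does
       not suffice. But S f is null for omega, and nondegeneracy of omega(Sf, Sg) concludes. *)
    intros f Hf Hn; apply (pairing_S_S_nondegenerate xi _ _ Hplus Hminus lambda Hl f Hf).
    intros g Hg; change (B (S f) (S g) = 0).
    rewrite (Banti _ _ (SR _ Hf) (SR _ Hg)), (Bnull (S g) (S f) Hn); ring.
  + intros A_star A_img A W_star W_img W H1 H2 H3; split.
    * exact (symplectic_map_induces omV_star omV_img T _ _ _ _ (proj2 F2) MT H1 H2).
    * exact (symplectic_map_induces omV_star omV J _ _ _ _ (proj2 F2) MJ H1 H3).
Qed.
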